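(* Let $n$ be a positive integer, $N=2n$, $\mu\in i\mathbb{R}$ and $\delta\in\mathbb{Z}$. The restriction of the degenerate principal series representation $\pi_{\mu,\delta}$ of $\mathrm{Sp}(n,\mathbb{C})$ to the maximal compact subgroup $\mathrm{Sp}(n)$ decomposes into irreducible components as $$\pi_{\mu,\delta}\big|_{\mathrm{Sp}(n)}\simeq\widehat{\bigoplus_{\substack{l-l'\geq|\delta|\\ l-l'\equiv\delta\ (\mathrm{mod}\ 2)}}}V_n^{l,l'},$$ and every $K$-type $V_n^{l,l'}$ (with $K=\mathrm{Sp}(n)$) occurs at most once in this decomposition.
   Context: $[a]=a/|a|$ for $a\in\mathbb{C}^\times$. On $\mathbb{C}^N=\mathbb{C}^n\times\mathbb{C}^n$, $\omega(X,Y)=\langle X_2,Y_1\rangle-\langle X_1,Y_2\rangle$ with $\langle X,Y\rangle=\sum_kx_ky_k$; $\mathrm{Sp}(n,\mathbb{C})$ is the subgroup of $\mathrm{GL}(N,\mathbb{C})$ preserving $\omega$ and $K=\mathrm{Sp}(n)=\mathrm{U}(N)\cap\mathrm{Sp}(n,\mathbb{C})$. Let $V_{\mu,\delta}^\infty$ be the space of $f\in C^\infty(\mathbb{C}^N\setminus\{0\})$ with $f(aX)=|a|^{-\mu-N}[a]^{-\delta}f(X)$ for all $a\in\mathbb{C}^\times$, and $V_{\mu,\delta}$ its completion for the $L^2$-norm on the unit sphere $\mathrm{S}^{2N-1}$ of $\mathbb{C}^N$. The representation $\pi_{\mu,\delta}$ acts on $V_{\mu,\delta}$ by $\pi_{\mu,\delta}(g)f=f(g^{-1}\cdot)$.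 (Equivalently, restricted to $K$, it is left translation on $\{f\in L^2(\mathrm{S}^{2N-1}) : f(e^{i\theta}\cdot)=e^{-i\delta\theta}f\ \forall\theta\in\mathbb{R}\}$.) $V_n^{l,l'}$, for integers $l\geq l'\geq0$, is the irreducible unitary representation of $\mathrm{Sp}(n)$ with highest weight $(l,l',0,\ldots,0)$; the sum runs over such pairs $(l,l')$. $\widehat\bigoplus$ denotes Hilbert direct sum. *)

(* Defs.v *)
(* Complex numbers are R[i] over an arbitrary realType R; the notions that do
   not need the real structure are over an arbitrary numClosedFieldType. *)
From HB Require Import structures.
From mathcomp Require Import all_boot all_order all_algebra.
From mathcomp Require Import complex sesquilinear spectral.
From mathcomp Require Import all_classical all_reals all_analysis.

Set Implicit Arguments.
Unset Strict Implicit.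
Unset Printing Implicit Defensive.

Import Order.TTheory GRing.Theory Num.Theory.
Import numFieldNormedType.Exports.

Local Open Scope classical_set_scope.
Local Open Scope ring_scope.

Section SymplecticGroups.
Variables (C : numClosedFieldType) (n : nat).

(* C^N = C^n x C^n with N = n + n; X_1 and X_2 are the upper and lower blocks. *)
Definition pairing (X Y : 'cV[C]_n) : C := \sum_(k < n) X k 0 * Y k 0.

Definition omega (X Y : 'cV[C]_(n + n)) : C :=
  pairing (dsubmx X) (usubmx Y) - pairing (usubmx X) (dsubmx Y).

Definition SpC : set 'M[C]_(n + n) :=
  [set g | g \in unitmx /\ forall X Y, omega (g *m X) (g *m Y) = omega X Y].

Definition SpK : set 'M[C]_(n + n) := [set g | g \is unitarymx] `&` SpC.

(* The standard maximal torus of SpK, for `|t_k| = 1. *)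
Definition torus_mx (t : 'rV[C]_n) : 'M[C]_(n + n) :=
  diag_mx (row_mx t (map_mx (fun x => x^-1) t)).

(* Finite-dimensional continuous unitary representations of SpK, on C^d with
   its standard inner product; since SpK is compact, every irreducible unitary
   representation of it is of this form.  Values outside SpK are irrelevant. *)
Definition is_unitary_rep d (rho : 'M[C]_(n + n) -> 'M[C]_d) : Prop :=
  [/\ rho 1%:M = 1%:M,
      forall g h, SpK g -> SpK h -> rho (g *m h) = rho g *m rho h,
      forall g, SpK g -> rho g \is unitarymx
    & {within SpK, continuous rho}].

Record unitary_rep := UnitaryRep {
  rep_dim : nat;
  rep_mx : 'M[C]_(n + n) -> 'M[C]_rep_dim;
  rep_mxP : is_unitary_rep rep_mx
}.

Definition irreducible_rep (V : unitary_rep) : Prop :=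
  (0 < rep_dim V)%N /\
  forall W : {vspace 'cV[C]_(rep_dim V)},
    (forall g, SpK g -> forall w, w \in W -> rep_mx V g *m w \in W) ->
    W = 0%VS \/ W = fullv.

Definition is_weight (V : unitary_rep) (la : 'I_n -> int) : Prop :=
  exists2 v : 'cV[C]_(rep_dim V), v != 0 &
    forall t : 'rV[C]_n, (forall k, `|t 0 k| = 1) ->
      rep_mx V (torus_mx t) *m v = (\prod_(k < n) t 0 k ^ la k) *: v.

Definition lex_lt (nu la : 'I_n -> int) : Prop :=
  exists i : 'I_n, (forall j : 'I_n, (j < i)%N -> nu j = la j) /\ nu i < la i.

(* The highest weight of an irreducible representation is its largest weight
   for the lexicographic ordering, the ordering for which the positive roots
   are e_i - e_j, e_i + e_j (i < j) and 2 e_i. *)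
Definition highest_weight (V : unitary_rep) (la : 'I_n -> int) : Prop :=
  is_weight V la /\ forall nu, is_weight V nu -> nu =1 la \/ lex_lt nu la.

End SymplecticGroups.

(* The weight (l, l', 0, ..., 0) in Z^n. *)
Definition two_row_weight n (p : nat * nat) : 'I_n -> int :=
  fun i => (nth 0%N [:: p.1; p.2] i)%:Z.

(* The pairs (l, l') for which (l, l', 0, ..., 0) is a dominant weight of
   Sp(n): when n = 1 there is no second coordinate, and l' must be 0. *)
Definition two_row (n : nat) (p : nat * nat) : bool :=
  (p.2 <= p.1)%N && ((n == 1)%N ==> (p.2 == 0)%N).

Definition ktype_index (n : nat) (delta : int) (p : nat * nat) : bool :=
  [&& two_row n p, (`|delta| <= p.1 - p.2)%N &
      ((p.1 - p.2)%N%:Z == delta %[mod 2])%Z].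

Section HilbertRepresentations.
Variables (C : numClosedFieldType) (n : nat).
Variables (H : completeNormedModType C) (ip : {dot H for Num.conj}).
Variable act : 'M[C]_(n + n) -> H -> H.

(* SpK-equivariant linear maps (automatically bounded, as rep_dim V is
   finite). *)
Definition intertwiner (V : unitary_rep C n) (T : 'cV[C]_(rep_dim V) -> H) :=
  linear T /\ forall g, SpK g -> forall v, T (rep_mx V g *m v) = act g (T v).

(* H is, as a representation of SpK, the Hilbert direct sum of the V i: the
   T i are isometric equivariant embeddings with pairwise orthogonal ranges
   whose algebraic sum is dense. *)
Definition hilbert_sum_of (I : eqType) (V : I -> unitary_rep C n) : Prop :=
  exists T : forall i, 'cV[C]_(rep_dim (V i)) -> H,
    [/\ forall i, intertwiner (T i),
        forall i v w, ip (T i v) (T i w) = \sum_k v k 0 * (w k 0)^*,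
        forall i j v w, i != j -> ip (T i v) (T j w) = 0
      & dense [set x : H | exists (s : seq I)
            (v : forall i, 'cV[C]_(rep_dim (V i))),
          x = \sum_(i <- s) T i (v i)]].

(* dim Hom_SpK (V, H) <= 1 *)
Definition occurs_at_most_once (V : unitary_rep C n) : Prop :=
  forall T1 T2 : 'cV[C]_(rep_dim V) -> H, intertwiner T1 -> intertwiner T2 ->
    exists a b : C, (a, b) != (0, 0) /\ forall v, a *: T1 v + b *: T2 v = 0.

End HilbertRepresentations.

Section Smooth.
Variables (R : realType) (V : normedModType R).

(* f is C^k on the open set D *)
Fixpoint Ck (k : nat) (D : set V) (f : V -> R) : Prop :=
  if k is k'.+1 then
    forall v, (forall x, D x -> derivable f x v) /\ Ck k' D ('D_v f)
  else forall x, D x -> {for x, continuous f}.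

Definition smooth_on (D : set V) (f : V -> R) := forall k, Ck k D f.

End Smooth.

Section SphereIntegral.
Variable R : realType.

(* Integral over R^m, as an iterated Lebesgue integral. *)
Fixpoint iter_integral (m : nat) : ('rV[R]_m -> \bar R) -> \bar R :=
  if m is m'.+1 then fun F =>
    (\int[lebesgue_measure]_x
      iter_integral (fun v : 'rV[R]_m' => F (row_mx (x%:M : 'rV_1) v)))%E
  else fun F => F 0.

(* The library norm of 'rV[R]_m is the sup norm. *)
Definition euclid_norm m (x : 'rV[R]_m) : R := Num.sqrt (\sum_i x 0 i ^+ 2).

Definition of_real_coords N (x : 'rV[R]_(N + N)) : 'cV[R[i]]_N :=
  \col_k Complex (lsubmx x 0 k) (rsubmx x 0 k).

(* Integral over the unit sphere of C^N for the surface measure: in polar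
   coordinates, \int_{|x| <= 1} h(x/|x|) dx = (2N)^-1 \int_S h. *)
Definition sphere_integral N (h : 'cV[R[i]]_N -> R) : \bar R :=
  ((N + N)%:R%:E * iter_integral (fun x : 'rV[R]_(N + N) =>
    if (euclid_norm x <= 1)%R
    then (h (of_real_coords ((euclid_norm x)^-1 *: x)%R))%:E else 0))%E.

Definition l2_sphere N (f : 'cV[R[i]]_N -> R[i]) : \bar R :=
  sphere_integral (fun X => complex.Re (f X) ^+ 2 + complex.Im (f X) ^+ 2).

(* r ^ s for r > 0 and complex s *)
Definition cpow (r : R) (s : R[i]) : R[i] :=
  let e := expR (complex.Re s * ln r) in let th := complex.Im s * ln r in
  Complex (e * cos th) (e * sin th).

End SphereIntegral.

Section DegeneratePrincipalSeries.
Variables (R : realType) (n : nat) (mu : R[i]) (delta : int).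
Local Notation C := (R[i]).
Local Notation N := (n + n)%N.

(* f is smooth away from 0 as a function of the 2N real coordinates. *)
Definition smooth_off0 (f : 'cV[C]_N -> C) : Prop :=
  let D : set 'rV[R]_(N + N) := [set x | x != 0] in
  smooth_on D (fun x => complex.Re (f (of_real_coords x))) /\
  smooth_on D (fun x => complex.Im (f (of_real_coords x))).

(* Functions on C^N \ {0} are represented by functions on C^N; the value at 0
   is irrelevant. *)
Definition Vinfty : set ('cV[C]_N -> C) := [set f | smooth_off0 f /\
  forall (a : C) X, a != 0 -> X != 0 ->
    f (a *: X) = cpow (complex.Re `|a|) (- mu - N%:R) *
                 (a / `|a|) ^ (- delta) * f X].

(* A Hilbert space completion V_{mu,delta} of Vinfty for the L^2-norm on the
   sphere (unique up to a unique isomorphism), with the extension to it of the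
   action of SpC by f |-> f (g^-1 .). *)
Record degenerate_principal_series := DegeneratePrincipalSeries {
  dps_space : completeNormedModType C;
  dps_ip : {dot dps_space for Num.conj};
  dps_normE : forall x, `|x| ^+ 2 = dps_ip x x;
  dps_inj : ('cV[C]_N -> C) -> dps_space;
  dps_inj_linear : forall (a : C) f g, Vinfty f -> Vinfty g ->
    dps_inj (fun X => a * f X + g X) = a *: dps_inj f + dps_inj g;
  dps_inj_norm : forall f, Vinfty f ->
    ((complex.Re `|dps_inj f|) ^+ 2)%:E = l2_sphere f;
  dps_inj_dense : dense [set dps_inj f | f in Vinfty];
  dps_act : 'M[C]_N -> dps_space -> dps_space;
  dps_act_linear : forall g, SpC g -> linear (dps_act g);
  dps_act_continuous : forall g, SpC g -> continuous (dps_act g);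
  dps_actE : forall g f, SpC g -> Vinfty f ->
    dps_act g (dps_inj f) = dps_inj (fun X => f (invmx g *m X))
}.

End DegeneratePrincipalSeries.

(* Main.v *)
Require Import Defs.
From HB Require Import structures.
From mathcomp Require Import all_boot all_order all_algebra.
From mathcomp Require Import complex sesquilinear spectral.
From mathcomp Require Import all_classical all_reals all_analysis.
From mathcomp Require cyclic separable cyclotomic.
From mathcomp Require Import measurable_realfun.
From mathcomp Require Import ring lra zify.

Set Implicit Arguments.
Unset Strict Implicit.
Unset Printing Implicit Defensive.

Import Order.TTheory GRing.Theory Num.Theory.
Import numFieldNormedType.Exports.

Local Open Scope classical_set_scope.
Local Open Scope ring_scope.

(* Restricted to the unit sphere, V_{mu,delta} is densely filled by the functions
   X |-> F(J conj X, X), where F(U, V) is a polynomial, homogeneous of degree a in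
   U and b in V with a - b = delta: Bernstein-type polynomials approximate
   continuous functions uniformly on the sphere, and an average over roots of
   unity extracts the right homogeneity.  As J conj X transforms like X under
   Sp(n), F |-> F(J conj X, X) is equivariant; it is injective because the points
   (J conj X, X) span all pairs (U, V).

   The nilpotent part of a Borel subalgebra moves a generic pair (U, V) to a
   four-parameter slice on which the torus and the scalings of U and V have a
   dense orbit.  So a highest weight vector F of given bidegree and weight is
   unique up to a scalar, and it is a monomial u^i v^j m^k omega(U, V)^s, with u, v
   the first lower coordinates of U and V and m the minor of U and V in the first
   two lower coordinates.  Its weight is (i + j + k, k, 0, ..., 0), its bidegree
   (i + k + s, j + k + s).  Since omega(J conj X, X) = |X|^2, the factor omega^s
   is 1 on the sphere, so the pairs l - l' = i + j with i - j = delta remain, each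
   once.  The translates of such a monomial span an irreducible representation,
   a highest weight vector in the complement of all of them cannot exist, and
   Schur's lemma gives the multiplicities. *)

(** The abstract completion comes with a continuous action only, so unitarity has to be derived:
    sphere integrals of polynomials are invariant by a linear change of variables in Lebesgue
    integrals, and density carries this to the whole space. Complements of stable subspaces are then
    orthogonal complements. Differentiation along the Lie algebra is purely algebraic. Rotations
    generated by a matrix B with B^3 = -B are parametrised rationally, homogeneity clears the
    denominators, and interpolation recovers the linear coefficient from finitely many translates.
    For a root vector A with conjugate transpose A^H, the compact directions A - A^H and i(A + A^H)
    combine to A over the complex numbers. Torus weights are extracted in the same way, after a
    scalar factor has removed negative powers; every weight therefore appears shifted by the degree.
    Irreducibility of the span of the translates of a monomial follows from uniqueness of highest
    weight vectors, but to know its highest weight one more invariant is used, the degree of F(U +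
    tV, V) in t, since several monomials share a bidegree. *)

Section Interpolation.
Variable C : idomainType.

Lemma poly_eq0_seq (p : {poly C}) (x : nat -> C) :
  injective x -> (forall k, p.[x k] = 0) -> p = 0.
Proof.
move=> xI px; apply: (@roots_geq_poly_eq0 _ p (map x (iota 0 (size p)))).
- by apply/allP => _ /mapP [k _ ->]; apply/rootP.
- by rewrite map_inj_uniq ?iota_uniq.
- by rewrite size_map size_iota.
Qed.

Lemma poly_eq_seq (p q : {poly C}) (x : nat -> C) :
  injective x -> (forall k, p.[x k] = q.[x k]) -> p = q.
Proof.
move=> xI px; apply/eqP; rewrite -subr_eq0; apply/eqP.
by apply: (poly_eq0_seq xI) => k; rewrite !hornerE px subrr.
Qed.

End Interpolation.

(** Lagrange interpolation at M nodes, read on the m-th coefficient. The weights c depend on the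
    nodes only, so a subspace that contains the values of a family of polynomials at the nodes also
    contains each coefficient of the family. *)
Lemma coef_interpolation (C : fieldType) (x : nat -> C) (M m : nat) :
  injective x -> exists c : 'I_M -> C, forall p : {poly C}, (size p <= M)%N ->
    p`_m = \sum_k c k * p.[x k].
Proof.
move=> xI.
pose L (k : 'I_M) : {poly C} :=
  \prod_(j < M | j != k) ((x k - x j)^-1 *: ('X - (x j)%:P)).
have Lx (k j : 'I_M) : (L k).[x j] = (j == k)%:R.
  rewrite horner_prod; have [->|jk] := eqVneq j k.
    rewrite big1 // => i ik; rewrite !hornerE mulVf // subr_eq0.
    by apply: contra_neq ik => /xI /val_inj ->.
  by rewrite (bigD1 j jk)/= !hornerE subrr mulr0 mul0r.
have szL k : (size (L k) <= M)%N.
  apply: (leq_trans (size_poly_prod_leq _ _)).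
  have -> : (\sum_(i < M | i != k) size ((x k - x i)^-1 *: ('X - (x i)%:P)) =
             \sum_(i < M | i != k) 2)%N.
    apply: eq_bigr => i ik; rewrite size_scale ?size_XsubC // invr_eq0 subr_eq0.
    by apply: contra_neq ik => /xI /val_inj ->.
  rewrite sum_nat_const -[#|_|]/(#|predC1 k|) -[X in (_ - X)%N]/(#|predC1 k|).
  by rewrite cardC1 card_ord; have := ltn_ord k; lia.
exists (fun k => (L k)`_m) => p szp.
have -> : p = \sum_(k < M) p.[x k] *: L k.
  apply/eqP; rewrite -subr_eq0; apply/eqP.
  apply: (@roots_geq_poly_eq0 _ _ (map x (iota 0 M))).
  - apply/allP => y /mapP [k]; rewrite mem_iota add0n => kM -> {y}.
    apply/rootP; rewrite !hornerE horner_sum (bigD1 (Ordinal kM))//=.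
    rewrite !hornerE (Lx (Ordinal kM) (Ordinal kM)) eqxx mulr1 big1 ?addr0 ?subrr // => i ik.
    by rewrite !hornerE (Lx i (Ordinal kM)) eq_sym (negbTE ik) mulr0.
  - by rewrite map_inj_uniq ?iota_uniq.
  - rewrite size_map size_iota (leq_trans (size_polyD _ _))// geq_max szp/=.
    rewrite size_polyN (leq_trans (size_sum _ _ _))//.
    by apply/bigmax_leqP => i _; rewrite (leq_trans (size_scale_leq _ _)).
rewrite coef_sum; apply: eq_bigr => k _; rewrite coefZ mulrC; congr (_ * _).
rewrite horner_sum (bigD1 k)//= !hornerE Lx eqxx mulr1 big1 ?addr0 // => i ik.
by rewrite !hornerE Lx eq_sym (negbTE ik) mulr0.
Qed.

(** * Homogeneous functions and their derivatives *)

Section HomogeneousFunctions.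
Variables (C : numFieldType) (N r : nat).
Local Notation E := 'M[C]_(N, r).
Implicit Types (F G : E -> C) (Z Y : E).

Lemma natr_inj : injective (fun k : nat => k%:R : C).
Proof. by move=> i j /eqP; rewrite eqr_nat => /eqP. Qed.

(* Homogeneous polynomial functions of degree d, by recursion on d. *)
Fixpoint hom (d : nat) (F : E -> C) : Prop :=
  if d is d'.+1 then exists G : 'I_N * 'I_r -> E -> C,
    (forall k, hom d' (G k)) /\ forall Z, F Z = \sum_k Z k.1 k.2 * G k Z
  else exists c, forall Z, F Z = c.

Lemma hom_ext d F G : F =1 G -> hom d F -> hom d G.
Proof. by move=> /funext ->. Qed.

Lemma homP d F G a : hom d F -> hom d G -> hom d (fun Z => a * F Z + G Z).
Proof.
elim: d F G => [F G [c Fc] [c' Gc]|d IH F G [F' [hF' FE]] [G' [hG' GE]]].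
  by exists (a * c + c') => Z; rewrite Fc Gc.
exists (fun k Z => a * F' k Z + G' k Z); split=> [k|Z]; first exact: IH (hF' k) (hG' k).
by rewrite FE GE mulr_sumr -big_split; apply: eq_bigr => k _/=; ring.
Qed.

Lemma hom0 d : hom d (fun=> 0).
Proof.
elim: d => [|d IH]; first by exists 0.
by exists (fun=> fun=> 0); split=> // Z; rewrite big1 // => k _; rewrite mulr0.
Qed.

Lemma homZ d F a : hom d F -> hom d (fun Z => a * F Z).
Proof.
by move=> hF; apply: hom_ext (homP a hF (hom0 d)) => Z; rewrite addr0.
Qed.

Lemma homD d F G : hom d F -> hom d G -> hom d (fun Z => F Z + G Z).
Proof.
by move=> hF hG; apply: hom_ext (homP 1 hF hG) => Z; rewrite mul1r.
Qed.

Lemma hom_sum d (I : Type) (s : seq I) (P : pred I) (F : I -> E -> C) :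
  (forall i, P i -> hom d (F i)) -> hom d (fun Z => \sum_(i <- s | P i) F i Z).
Proof.
move=> hF; elim: s => [|i s IH].
  by apply: hom_ext (hom0 d) => Z; rewrite big_nil.
case Pi: (P i); last by apply: hom_ext IH => Z; rewrite big_cons Pi.
by apply: hom_ext (homD (hF i Pi) IH) => Z; rewrite big_cons Pi.
Qed.

Lemma homS d F i j : hom d F -> hom d.+1 (fun Z => Z i j * F Z).
Proof.
move=> hF; exists (fun k Z => (k == (i, j))%:R * F Z); split=> [k|Z].
  exact: homZ.
rewrite (bigD1 (i, j))//= eqxx mul1r big1 ?addr0 // => k /negbTE ->.
by rewrite mul0r mulr0.
Qed.

Lemma hom_entry i j : hom 1 (fun Z => Z i j).
Proof.
by apply: hom_ext (@homS 0 (fun=> 1) i j _); [move=> Z; rewrite mulr1|exists 1].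
Qed.

Lemma hom_mul d e F G : hom d F -> hom e G -> hom (d + e) (fun Z => F Z * G Z).
Proof.
move=> + hG; elim: d F => [F [c Fc]|d IH F [F' [hF' FE]]].
  by apply: hom_ext (homZ c hG) => Z; rewrite Fc.
exists (fun k Z => F' k Z * G Z); split=> [k|Z]; first exact: IH (hF' k).
by rewrite FE mulr_suml; apply: eq_bigr => k _; rewrite mulrA.
Qed.

Lemma hom_exp d F k : hom d F -> hom (k * d) (fun Z => F Z ^+ k).
Proof.
move=> hF; elim: k => [|k IH]; first by exists 1 => Z; rewrite expr0.
by apply: hom_ext (hom_mul hF IH) => Z; rewrite exprS.
Qed.

Lemma linear_entries (L : {linear E -> E}) :
  exists M : 'I_N * 'I_r -> 'I_N * 'I_r -> C, forall Z k,
    L Z k.1 k.2 = \sum_l M k l * Z l.1 l.2.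
Proof.
exists (fun k l => L (delta_mx l.1 l.2) k.1 k.2) => Z k.
rewrite [in LHS](matrix_sum_delta Z) linear_sum summxE.
under eq_bigr => i _. rewrite linear_sum summxE. over.
rewrite pair_big/=; apply: eq_bigr => l _.
by rewrite linearZ mxE mulrC.
Qed.

Lemma hom_lin d F (L : {linear E -> E}) : hom d F -> hom d (fun Z => F (L Z)).
Proof.
have [M LE] := linear_entries L.
elim: d F => [F [c Fc]|d IH F [F' [hF' FE]]]; first by exists c => Z.
exists (fun l Z => \sum_k M k l * F' k (L Z)); split=> [l|Z].
  by apply: hom_sum => k _; apply: homZ; apply: IH (hF' k).
rewrite FE; under eq_bigr do rewrite LE mulr_suml.
rewrite exchange_big/=; apply: eq_bigr => l _; rewrite mulr_sumr.
by apply: eq_bigr => k _; ring.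
Qed.

Lemma hom_scale d F c Z : hom d F -> F (c *: Z) = c ^+ d * F Z.
Proof.
elim: d F => [F [c' Fc]|d IH F [F' [hF' FE]]].
  by rewrite !Fc expr0 mul1r.
rewrite !FE mulr_sumr; apply: eq_bigr => k _.
by rewrite mxE (IH _ (hF' k)) exprS; ring.
Qed.

(** A matrix of polynomials is a polynomial curve in [E]; its coefficients of order 0 and 1 are the
    initial point and the initial velocity. *)
Definition peval (zeta : 'M[{poly C}]_(N, r)) (t : C) : E :=
  map_mx (fun p => p.[t]) zeta.
Definition pcoef (zeta : 'M[{poly C}]_(N, r)) (m : nat) : E :=
  map_mx (fun p : {poly C} => p`_m) zeta.

(* D Z Y is the differential of F at Z applied to Y. *)
Lemma hom_curve_diff d F : hom d F -> exists D : E -> E -> C,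
  [/\ forall Z a Y Y', D Z (a *: Y + Y') = a * D Z Y + D Z Y',
      forall L : {linear E -> E}, hom d (fun Z => D Z (L Z))
    & forall (e : nat) (zeta : 'M[{poly C}]_(N, r)),
        (forall i j, (size (zeta i j) <= e.+1)%N) ->
        exists p : {poly C}, [/\ (size p <= (d * e).+1)%N,
          forall t, F (peval zeta t) = p.[t] &
          p`_1 = D (pcoef zeta 0) (pcoef zeta 1)]].
Proof.
elim: d F => [F [c Fc]|d IH F [G [hG FE]]].
  exists (fun _ _ => 0); split=> [Z a Y Y'|L|e zeta _].
  - by rewrite mulr0 addr0.
  - exact: hom0.
  - exists c%:P; split=> [|t|]; first by rewrite size_polyC; case: (c == 0).
    + by rewrite Fc hornerC.
    + by rewrite coefC.
have /choice [D HD] : forall k, exists D : E -> E -> C,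
  [/\ forall Z a Y Y', D Z (a *: Y + Y') = a * D Z Y + D Z Y',
      forall L : {linear E -> E}, hom d (fun Z => D Z (L Z))
    & forall (e : nat) (zeta : 'M[{poly C}]_(N, r)),
        (forall i j, (size (zeta i j) <= e.+1)%N) ->
        exists p : {poly C}, [/\ (size p <= (d * e).+1)%N,
          forall t, G k (peval zeta t) = p.[t] &
          p`_1 = D (pcoef zeta 0) (pcoef zeta 1)]].
  by move=> k; apply: IH (hG k).
exists (fun Z Y => \sum_k (Y k.1 k.2 * G k Z + Z k.1 k.2 * D k Z Y)).
split=> [Z a Y Y'|L|e zeta sz].
- rewrite mulr_sumr -big_split; apply: eq_bigr => k _/=.
  by have [-> _ _] := HD k; rewrite !mxE; ring.
- have [M LE] := linear_entries L.
  apply: hom_sum => k _; apply: homD; last by have [_ h _] := HD k; apply: homS.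
  apply: hom_ext (_ : hom _ (fun Z => \sum_l Z l.1 l.2 * (M k l * G k Z))).
    by move=> Z; rewrite LE mulr_suml; apply: eq_bigr => l _; ring.
  by apply: hom_sum => l _; apply: homS; apply: homZ; apply: hG.
- have /choice [p Hp] : forall k, exists p : {poly C},
    [/\ (size p <= (d * e).+1)%N, forall t, G k (peval zeta t) = p.[t] &
        p`_1 = D k (pcoef zeta 0) (pcoef zeta 1)].
    by move=> k; have [_ _] := HD k; apply.
  exists (\sum_k zeta k.1 k.2 * p k); split=> [|t|].
  + apply: (leq_trans (size_sum _ _ _)); apply/bigmax_leqP => k _.
    have [szp _ _] := Hp k.
    apply: (leq_trans (size_polyMleq _ _)); have := sz k.1 k.2.
    rewrite mulSn; move: (size _) szp (size _) => a ha b hb; lia.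
  + rewrite FE horner_sum; apply: eq_bigr => k _.
    by rewrite hornerM; have [_ <- _] := Hp k; rewrite mxE.
  + rewrite coef_sum; apply: eq_bigr => k _; have [_ ev p1] := Hp k.
    rewrite coefM big_ord_recl big_ord1 /= /bump /= addn0 subn1/= p1 !mxE.
    suff -> : G k (pcoef zeta 0) = (p k)`_0 by ring.
    rewrite -horner_coef0 -ev; congr (G k _).
    by apply/matrixP => i j; rewrite !mxE horner_coef0.
Qed.

(* Junk unless t |-> F (Z + t *: Y) is polynomial. *)
Definition der F Z Y : C :=
  (xget 0 [set p : {poly C} | forall t, F (Z + t *: Y) = p.[t]])`_1.

Lemma derE F Z Y (p : {poly C}) : (forall t, F (Z + t *: Y) = p.[t]) ->
  der F Z Y = p`_1.
Proof.
move=> Fp; rewrite /der; case: xgetP => [q _ /= Fq|/(_ p)//].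
suff -> : q = p by [].
by apply: (poly_eq_seq natr_inj) => k; rewrite -Fq -Fp.
Qed.

Definition line Z Y : 'M[{poly C}]_(N, r) :=
  \matrix_(i, j) ((Z i j)%:P + (Y i j)%:P * 'X).

Lemma peval_line Z Y t : peval (line Z Y) t = Z + t *: Y.
Proof. by apply/matrixP => i j; rewrite !mxE !hornerE mulrC. Qed.

Lemma pcoef_line Z Y : (pcoef (line Z Y) 0 = Z) * (pcoef (line Z Y) 1 = Y).
Proof.
split; apply/matrixP => i j; rewrite !mxE coefD coefMX !coefC/=.
  by rewrite addr0.
by rewrite add0r.
Qed.

Lemma size_line Z Y i j : (size (line Z Y i j) <= 2)%N.
Proof.
rewrite mxE (leq_trans (size_polyD _ _))// geq_max.
rewrite (leq_trans (size_polyC_leq1 _))//=.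
by rewrite (leq_trans (size_polyMleq _ _))// size_polyX;
  move: (size_polyC_leq1 (Y i j)); lia.
Qed.

(** [der] inherits linearity, homogeneity and the chain rule from the differential. Curves of any
    degree e are allowed because rotations, once denominators are cleared, are quadratic in the
    parameter. *)
Lemma hom_der d F : hom d F ->
  [/\ forall Z a Y Y', der F Z (a *: Y + Y') = a * der F Z Y + der F Z Y',
      forall L : {linear E -> E}, hom d (fun Z => der F Z (L Z))
    & forall (e : nat) (zeta : 'M[{poly C}]_(N, r)),
        (forall i j, (size (zeta i j) <= e.+1)%N) ->
        exists p : {poly C}, [/\ (size p <= (d * e).+1)%N,
          forall t, F (peval zeta t) = p.[t] &
          p`_1 = der F (pcoef zeta 0) (pcoef zeta 1)]].
Proof.
move=> /hom_curve_diff [D [Dl Dh Dc]].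
have DE Z Y : der F Z Y = D Z Y.
  have [p [_ ev p1]] := Dc _ _ (size_line Z Y).
  by rewrite (@derE _ _ _ p) ?p1 ?pcoef_line // => t; rewrite -ev peval_line.
split=> [Z a Y Y'|L|e zeta /Dc [p [? ? p1]]].
- by rewrite !DE.
- by apply: hom_ext (Dh L) => Z; rewrite DE.
- by exists p; rewrite DE.
Qed.

Lemma hom_line d F Z Y : hom d F -> exists p : {poly C},
  [/\ (size p <= d.+1)%N, forall t, F (Z + t *: Y) = p.[t],
      p`_1 = der F Z Y & p`_0 = F Z].
Proof.
move=> /hom_der [_ _ /(_ _ _ (size_line Z Y)) [p [sz ev p1]]].
exists p; split=> [|t||]; rewrite ?pcoef_line// in p1 *.
- by rewrite muln1 in sz.
- by rewrite -ev peval_line.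
- by rewrite -horner_coef0 -ev peval_line scale0r addr0.
Qed.

End HomogeneousFunctions.

(** * The compact symplectic group and highest weight vectors *)

Section SymplecticMatrices.
Variables (C : numClosedFieldType) (n : nat).
Local Open Scope sesquilinear_scope.
Local Notation M := 'M[C]_(n + n).
Implicit Types (A B g h : M).

Definition Jmx : M := block_mx 0 (- 1%:M) 1%:M 0.

Lemma Jmx_sqr : Jmx *m Jmx = - 1%:M.
Proof.
rewrite /Jmx mulmx_block !(mul0mx, mulmx0, mulmx1, mul1mx, add0r, addr0).
by rewrite [in RHS]scalar_mx_block opp_block_mx !oppr0.
Qed.

Lemma Jmx_tr : Jmx^T = - Jmx.
Proof.
by rewrite /Jmx tr_block_mx opp_block_mx !trmx0 linearN/= trmx1 opprK !oppr0.
Qed.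

Lemma Jmx_conj : Jmx ^ Num.conj = Jmx.
Proof. by rewrite /Jmx map_block_mx !map_mx0 raddfN/= !map_mx1. Qed.

Lemma omegaE (X Y : 'cV[C]_(n + n)) : omega X Y = (X^T *m Jmx *m Y) 0 0.
Proof.
rewrite -{2}[X]vsubmxK -{2}[Y]vsubmxK tr_col_mx /Jmx mul_row_block.
rewrite !(mulmx0, mulmx1, mulmxN, addr0, add0r) mul_row_col mulNmx.
rewrite /omega /pairing [RHS]mxE [X in _ = _ + X]mxE; congr (_ - _).
  by rewrite mxE; apply: eq_bigr => k _; rewrite !mxE.
by rewrite mxE; apply: eq_bigr => k _; rewrite !mxE.
Qed.

Lemma trmx_delta_mul g (i j : 'I_(n + n)) :
  ((delta_mx i 0 : 'cV_(n + n))^T *m g *m (delta_mx j 0 : 'cV_(n + n))) 0 0 = g i j.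
Proof. by rewrite -colE mxE trmx_delta -rowE mxE. Qed.

Lemma SpCP g : SpC g <-> g^T *m Jmx *m g = Jmx.
Proof.
split=> [[_ gP]|gP]; last first.
  split; last by move=> X Y; rewrite !omegaE -[in RHS]gP trmx_mul !mulmxA.
  suff : - Jmx *m g^T *m Jmx *m g = 1%:M by move=> /mulmx1_unit [].
  by rewrite -!mulmxA (mulmxA g^T) gP mulNmx Jmx_sqr opprK.
apply/matrixP => i j; rewrite -(trmx_delta_mul (g^T *m Jmx *m g)) -(trmx_delta_mul Jmx).
have := gP (delta_mx i 0) (delta_mx j 0).
by rewrite !omegaE => <-; rewrite trmx_mul !mulmxA.
Qed.

Lemma SpKP g : SpK g <-> g *m g^t* = 1%:M /\ g^T *m Jmx *m g = Jmx.
Proof.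
split=> [[gU /SpCP gJ]|[gU gJ]]; first by split=> //; apply/unitarymxP.
by split; [apply/unitarymxP|apply/SpCP].
Qed.

Lemma SpK_1 : SpK (1%:M : M).
Proof. by apply/SpKP; rewrite !trmx1 map_mx1 !mulmx1 mul1mx. Qed.

Lemma SpK_mul g h : SpK g -> SpK h -> SpK (g *m h).
Proof.
move=> /SpKP [gU gJ] /SpKP [hU hJ]; apply/SpKP; split.
  by rewrite trmx_mul map_mxM -mulmxA (mulmxA h) hU mul1mx.
transitivity (h^T *m (g^T *m Jmx *m g) *m h); last by rewrite gJ.
by rewrite trmx_mul !mulmxA.
Qed.

Lemma SpK_inv g : SpK g -> SpK (g^t*).
Proof.
move=> gK; have [gU gJ] := (SpKP g).1 gK; apply/SpKP; split.
  by rewrite trmxCK; apply: mulmx1C.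
rewrite -[in LHS]gJ -!mulmxA gU mulmx1 !mulmxA -trmx_mul gU trmx1.
by rewrite mul1mx.
Qed.

Lemma SpK_invmx g : SpK g -> invmx g = g^t*.
Proof. by move=> [gU _]; apply: invmx_unitary. Qed.

Lemma SpK_SpC g : SpK g -> SpC g.
Proof. by case. Qed.

(** Rodrigues' formula: when B^3 = -B, the exponential of theta B is this matrix with s = sin theta
    and u = 1 - cos theta. *)
Definition quadmx B (s u : C) : M := 1%:M + s *: B + u *: (B *m B).

Lemma quadmx_mul B s u s' u' : B *m B *m B = - B ->
  quadmx B s u *m quadmx B s' u' =
  quadmx B (s + s' - (s * u' + u * s')) (u + u' + s * s' - u * u').
Proof.
move=> B3; rewrite /quadmx; set P := B *m B.
have PB : P *m B = - B by [].
have BP : B *m P = - B by rewrite /P mulmxA.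
have PP : P *m P = - P by rewrite {2}/P mulmxA PB mulNmx.
rewrite !(mulmxDl, mulmxDr, mul1mx, mulmx1) -!scalemxAl -!scalemxAr PB BP PP.
rewrite -/P.
by apply/matrixP => i j; rewrite !mxE; ring.
Qed.

(** The inverse is obtained by changing s into -s, thanks to c^2 + s^2 = 1. Conjugate transposition
    and transposition through [Jmx] both turn B into -B, so each of them produces this inverse. *)
Lemma quadmx_SpK B (c s : C) :
  B^t* = - B -> B^T *m Jmx = - (Jmx *m B) -> B *m B *m B = - B ->
  c^* = c -> s^* = s -> c ^+ 2 + s ^+ 2 = 1 -> SpK (quadmx B s (1 - c)).
Proof.
move=> BU BJ B3 cr sr cs1.
have key : quadmx B s (1 - c) *m quadmx B (- s) (1 - c) = 1%:M.
  rewrite quadmx_mul // /quadmx.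
  rewrite (_ : s - s - _ = 0) ?scale0r ?addr0; last by ring.
  rewrite (_ : 1 - c + _ + _ - _ = 0) ?scale0r ?addr0 //.
  by apply/eqP; rewrite -subr_eq0; apply/eqP; transitivity (1 - (c ^+ 2 + s ^+ 2));
    [ring|rewrite cs1 subrr].
apply/SpKP; split.
  rewrite -[RHS]key; congr (_ *m _).
  have : (B *m B)^t* = B *m B by rewrite trmx_mul map_mxM BU mulNmx mulmxN opprK.
  rewrite /quadmx; move: (B *m B) => P PU; apply/matrixP => i j.
  have := congr1 (fun X : M => X i j) BU; have := congr1 (fun X : M => X i j) PU.
  rewrite !mxE !(rmorphD, rmorphM, rmorphN)/= => -> ->.
  by rewrite sr cr !rmorph1 mulrN mulNr conjC_nat eq_sym.
have /mulmx1C {}key := key.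
transitivity (Jmx *m (quadmx B (- s) (1 - c) *m quadmx B s (1 - c))); last first.
  by rewrite key mulmx1.
rewrite mulmxA; congr (_ *m _).
rewrite /quadmx !linearD /= !linearZ /= trmx1 trmx_mul.
rewrite !(mulmxDl, mulmxDr) -!scalemxAl -?scalemxAr mul1mx mulmx1 -(mulmxA B^T) BJ.
by rewrite mulmxN !mulmxA BJ mulNmx opprK scaleNr scalerN.
Qed.

Lemma torus_SpK (t : 'rV[C]_n) : (forall k, `|t 0 k| = 1) -> SpK (torus_mx t).
Proof.
move=> t1; have t0 k : t 0 k != 0 by rewrite -normr_gt0 t1.
apply/SpKP; split.
  apply/matrixP => i j; rewrite /torus_mx tr_diag_mx map_diag_mx mulmx_diag !mxE.
  case: eqP => // _; rewrite !mulr1n; case: splitP => k _; rewrite ?mxE.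
    by rewrite -normCK t1 expr1n.
  by rewrite rmorphV ?unitfE //= -invfM -normCK t1 expr1n invr1.
rewrite /torus_mx tr_diag_mx /Jmx.
rewrite (_ : diag_mx _ = block_mx (diag_mx t) 0 0
          (diag_mx (map_mx (fun x => x^-1) t))); last first.
  exact: diag_mx_row.
rewrite !mulmx_block !(mul0mx, mulmx0, mulmx1, mul1mx, add0r, addr0, mulNmx, mulmxN).
by congr block_mx; [congr (- _)|]; apply/matrixP => i j;
  rewrite mulmx_diag !mxE ?mulfV ?mulVf.
Qed.

(* Root vectors of the complexified Lie algebra, normalised as in sl_2. *)
Definition nilroot A :=
  [/\ A *m A = 0, A *m A^t* *m A = A & A^T *m Jmx = - (Jmx *m A)].

Lemma nilroot_adj A : nilroot A -> nilroot (A^t*).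
Proof.
move=> [AA A3 AJ]; split.
- by rewrite -map_mxM -trmx_mul AA trmx0 map_mx0.
- rewrite trmxCK -[X in _ *m X *m _]trmxCK -!map_mxM/= -!trmx_mul !mulmxA.
  by rewrite A3.
- have := congr1 (fun X => X ^ Num.conj) AJ.
  rewrite map_mxN !map_mxM Jmx_conj /= => /(congr1 (fun X => Jmx *m X *m Jmx)).
  rewrite mulmxN mulNmx !mulmxA Jmx_sqr !mulNmx mul1mx opprK -!mulmxA Jmx_sqr.
  by rewrite mulmxN mulmx1 mulmxN !map_trmx trmxK => <-.
Qed.

(** Write A^H for the conjugate transpose. As A and A^H have square zero, the cube of B = A - A^H
    keeps only the alternating products A A^H A = A and A^H A A^H = A^H, with signs that give -B. *)
Lemma nilroot_skew A : nilroot A -> let B := A - A^t* in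
  [/\ B^t* = - B, B^T *m Jmx = - (Jmx *m B) & B *m B *m B = - B].
Proof.
move=> nA B; have [AA A3 AJ] := nA; have [AA' A3' AJ'] := nilroot_adj nA.
rewrite trmxCK in A3'.
split.
- by rewrite /B linearB/= map_mxD map_mxN trmxCK opprB.
- by rewrite /B linearB/= mulmxBl AJ AJ' mulmxBr opprB opprK addrC.
- rewrite /B !(mulmxDl, mulmxDr, mulNmx, mulmxN) AA AA' !mul0mx A3 A3'.
  rewrite -(mulmxA _ A A) -(mulmxA _ (A^t*) (A^t*)) AA AA' !mulmx0.
  by rewrite !(oppr0, opprK, addr0, add0r) opprB addrC.
Qed.

(** Supplies the second compact direction i(A + A^H), which together with A - A^H spans A over the
    complex numbers. *)
Lemma nilroot_iscale A : nilroot A -> nilroot ('i *: A).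
Proof.
move=> [AA A3 AJ]; split.
- by rewrite -scalemxAl -scalemxAr AA !scaler0.
- have -> : ('i *: A)^t* = - 'i *: A^t*.
    by apply/matrixP => i j; rewrite !mxE rmorphM/= conjCi.
  rewrite -!scalemxAl -!scalemxAr -!scalemxAl !scalerA A3.
  by rewrite mulrN -expr2 sqrCi opprK mulr1.
- by rewrite linearZ/= -scalemxAl AJ -scalemxAr scalerN.
Qed.

End SymplecticMatrices.

(** * Stable subspaces of functions, root operators and torus weights *)

Section Stability.
Variables (C : numClosedFieldType) (n : nat).
Local Open Scope sesquilinear_scope.
Local Notation M := 'M[C]_(n + n).
Local Notation E := 'M[C]_(n + n, 2).
Implicit Types (A B g h : M) (F G : E -> C) (Z : E) (W : set (E -> C)).

Definition subsp W :=
  W (fun=> 0) /\ forall a F G, W F -> W G -> W (fun Z => a * F Z + G Z).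

Definition kstab W := forall g F, SpK g -> W F -> W (fun Z => F (g *m Z)).

Lemma set_ext W F G : F =1 G -> W F -> W G.
Proof. by move=> /funext ->. Qed.

Lemma subspZ W a F : subsp W -> W F -> W (fun Z => a * F Z).
Proof.
by move=> [W0 WP] WF; apply: set_ext (WP a _ _ WF W0) => Z; rewrite addr0.
Qed.

Lemma subsp_sum W (I : Type) (s : seq I) (c : I -> C) (F : I -> E -> C) :
  subsp W -> (forall i, W (F i)) -> W (fun Z => \sum_(i <- s) c i * F i Z).
Proof.
move=> [W0 WP] WF; elim: s => [|i s IH].
  by apply: set_ext W0 => Z; rewrite big_nil.
by apply: set_ext (WP (c i) _ _ (WF i) IH) => Z; rewrite big_cons.
Qed.

Lemma subsp_coef W (x : nat -> C) K (p : E -> {poly C}) :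
  subsp W -> injective x -> (forall Z, (size (p Z) <= K)%N) ->
  (forall k, W (fun Z => (p Z).[x k])) -> forall m, W (fun Z => (p Z)`_m).
Proof.
move=> sW xI sz Wp m; have [c cE] := coef_interpolation K m xI.
apply: set_ext (subsp_sum (index_enum 'I_K) c sW (fun k : 'I_K => Wp k)) => Z.
by rewrite cE.
Qed.

(** The rotations generated by B are parametrised by c = (1 - t^2)/(1 + t^2) and s = 2t/(1 + t^2).
    Multiplication by (1 + t^2)^d makes the translate of F polynomial in t. W contains its values at
    natural t, hence by interpolation its coefficients, and the linear one is a multiple of the
    derivative along B. *)
Lemma kstab_skew W d F B : subsp W -> kstab W -> hom d F -> W F ->
  B^t* = - B -> B^T *m Jmx C n = - (Jmx C n *m B) -> B *m B *m B = - B ->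
  W (fun Z => der F Z (B *m Z)).
Proof.
move=> sW kW hF WF BU BJ B3; have [Dl _ Dc] := hom_der hF.
(* This is (1 + t^2) times the rotated Z, as 1 - c = 2t^2/(1 + t^2). *)
pose zeta Z : 'M[{poly C}]_(n + n, 2) := \matrix_(i, j)
  ((Z i j)%:P + ((2 *: (B *m Z)) i j)%:P * 'X
   + ((Z + 2 *: (B *m B *m Z)) i j)%:P * 'X^2).
have sz Z i j : (size (zeta Z i j) <= 3)%N.
  rewrite mxE !mul_polyC; apply: (leq_trans (size_polyD _ _)); rewrite geq_max.
  rewrite (leq_trans (size_scale_leq _ _)) ?size_polyXn // andbT.
  apply: (leq_trans (size_polyD _ _)); rewrite geq_max.
  rewrite (leq_trans (size_scale_leq _ _)) ?size_polyX // andbT.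
  by rewrite (leq_trans (size_polyC_leq1 _)).
have /choice [p Hp] := fun Z => Dc 2%N (zeta Z) (sz Z).
have W1 : forall m, W (fun Z => (p Z)`_m).
  apply: (@subsp_coef W _ (d * 2).+1 p sW (@natr_inj C)) => [Z|k]; first by have [] := Hp Z.
  set t : C := k%:R.
  have t2 : 1 + t ^+ 2 != 0.
    by rewrite gt_eqF// -natrX -(natrD _ 1)  ltr0n.
  pose c := (1 - t ^+ 2) / (1 + t ^+ 2); pose s := 2 * t / (1 + t ^+ 2).
  have tR : t \is Num.real by rewrite realn.
  have cr : c^* = c.
    by apply: conj_Creal; rewrite rpred_div ?rpredB ?rpredD ?rpredX ?rpred1.
  have sr : s^* = s.
    by apply: conj_Creal; rewrite rpred_div ?rpredM ?rpredD ?rpredX ?rpred1 ?rpred_nat.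
  have cs : c ^+ 2 + s ^+ 2 = 1 by rewrite /c /s; field.
  have gK := quadmx_SpK BU BJ B3 cr sr cs.
  apply: set_ext (subspZ ((1 + t ^+ 2) ^+ d) sW (kW _ _ gK WF)) => Z.
  have [_ <- _] := Hp Z; rewrite -(hom_scale _ _ hF); congr F.
  apply/matrixP => i j; rewrite [in RHS]mxE [zeta _ _ _]mxE !hornerE.
  rewrite /quadmx !mulmxDl mul1mx -!scalemxAl.
  rewrite mxE [in LHS]mxE [in LHS]mxE ![(_ *: (_ *m _)) i j]mxE.
  rewrite [(Z + _) i j]mxE [(2 *: (B *m B *m Z)) i j]mxE /=.
  by move: (Z i j) ((B *m Z) i j) ((B *m B *m Z) i j) => u v w; rewrite /c /s; field.
(* The velocity of [zeta] at t = 0 is 2BZ, whence the factor 1/2. *)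
apply: set_ext (subspZ 2^-1 sW (W1 1%N)) => Z.
have [_ _ ->] := Hp Z.
have -> : pcoef (zeta Z) 0 = Z.
  apply/matrixP => i j; rewrite mxE [zeta _ _ _]mxE !coefD coefC coefMX coefCM coefXn /=.
  by rewrite mulr0 !addr0.
have -> : pcoef (zeta Z) 1 = 2 *: (B *m Z) + 0.
  apply/matrixP => i j; rewrite mxE [zeta _ _ _]mxE !coefD coefC coefMX coefCM coefXn /=.
  by rewrite mulr0 coefC/= addr0 add0r addr0.
have D0 : der F Z 0 = 0.
  by have := Dl Z 1 0 0; rewrite scaler0 addr0 mul1r => /eqP;
    rewrite -subr_eq0 opprD addNKr oppr_eq0 => /eqP.
by rewrite Dl D0 addr0 mulrA mulVf ?mul1r // pnatr_eq0.
Qed.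

Lemma kstab_nilroot W d F A : subsp W -> kstab W -> hom d F -> W F ->
  nilroot A -> W (fun Z => der F Z (A *m Z)).
Proof.
move=> sW kW hF WF nA; have [Dl _ _] := hom_der hF.
have [B1 B2 B3] := nilroot_skew nA.
have [B1' B2' B3'] := nilroot_skew (nilroot_iscale nA).
have W1 := kstab_skew sW kW hF WF B1 B2 B3.
have W2 := kstab_skew sW kW hF WF B1' B2' B3'.
(* A = (A - A^H)/2 - (i/2)(iA - (iA)^H), where ^H is the conjugate transpose. *)
have := sW.2 (2^-1) _ _ W1 (subspZ (- 'i / 2) sW W2).
apply: set_ext => Z.
set Y1 := (A - _) *m Z; set Y2 := ('i *: A - _) *m Z.
have D0 : der F Z 0 = 0.
  by have := Dl Z 1 0 0; rewrite scaler0 addr0 mul1r => /eqP;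
    rewrite -subr_eq0 opprD addNKr oppr_eq0 => /eqP.
rewrite -[_ / 2 * _]addr0 -D0 -Dl -Dl; congr (der F Z _).
rewrite addr0 /Y1 /Y2 !scalemxAl -mulmxDl; congr (_ *m Z).
apply/matrixP => i j; rewrite !mxE rmorphM/= conjCi.
have i2 : 'i * 'i = - 1 :> C by rewrite -expr2 sqrCi.
move: (A i j) (Num.conj (A j i)) => u v.
transitivity (2^-1 * (u - v) - ('i * 'i) / 2 * (u + v)); first by field.
by rewrite i2; field.
Qed.

(* z times the torus element with k-th entry z^-1, so that no inverse occurs. *)
Definition gr (k : 'I_n) (z : C) : M :=
  diag_mx (row_mx (\row_i (if i == k then 1 else z))
                  (\row_i (if i == k then z ^+ 2 else z))).

Lemma gr_mul k z w : gr k z *m gr k w = gr k (z * w).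
Proof.
apply/matrixP => i j; rewrite mulmx_diag !mxE; congr (_ *+ _).
case: splitP => l _; rewrite !mxE; case: eqP => // _; first by rewrite mulr1.
by rewrite exprMn.
Qed.

Lemma gr_comm k l z w : gr k z *m gr l w = gr l w *m gr k z.
Proof.
by rewrite !mulmx_diag; congr diag_mx; apply/rowP => i; rewrite !mxE mulrC.
Qed.

Lemma gr_1 k : gr k 1 = 1%:M.
Proof.
apply/matrixP => i j; rewrite !mxE; congr (_ *+ _).
by case: splitP => l _; rewrite mxE ?expr1n if_same.
Qed.

Lemma gr_torus k z : `|z| = 1 ->
  gr k z = z *: torus_mx (\row_i (if i == k then z^-1 else 1)).
Proof.
move=> z1; have z0 : z != 0 by rewrite -normr_gt0 z1.
apply/matrixP => i j; rewrite !mxE mulrnAr; congr (_ *+ _).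
case: splitP => l _; rewrite !mxE; case: eqP => // _; rewrite ?mulr1 ?mulfV//.
  by rewrite invrK expr2.
by rewrite invr1 mulr1.
Qed.

(* F has weight m - d for the k-th coordinate of the torus when it is
   homogeneous of degree d. *)
Definition wt (k : 'I_n) F (m : nat) :=
  forall z Z, F (gr k z *m Z) = z ^+ m * F Z.

(* Infinitely many points of the unit circle. *)
Definition cay (k : nat) : C := (1 + 'i * k%:R) / (1 - 'i * k%:R).

Lemma cay_den k : 1 - 'i * k%:R != 0 :> C.
Proof.
rewrite subr_eq0; apply/negP => /eqP /(congr1 (fun x => x ^+ 2)).
rewrite exprMn sqrCi mulN1r expr1n => /eqP; rewrite -subr_eq0 opprK.
by rewrite -natrX -(natrD _ 1) pnatr_eq0.
Qed.

Lemma norm_cay k : `|cay k| = 1.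
Proof.
have e : (1 + 'i * k%:R) = (1 - 'i * k%:R)^* :> C.
  by rewrite rmorphB rmorphM rmorph1/= conjCi conjC_nat mulNr opprK.
rewrite /cay normrM normfV e norm_conjC divff //.
by rewrite normr_eq0 cay_den.
Qed.

Lemma cay_inj : injective cay.
Proof.
move=> i j /eqP; rewrite /cay eqr_div ?cay_den // => /eqP e.
have : 2 * 'i * (i%:R - j%:R) = 0 :> C.
  transitivity ((1 + 'i * i%:R) * (1 - 'i * j%:R) -
                (1 + 'i * j%:R) * (1 - 'i * i%:R) : C); first by ring.
  by rewrite e subrr.
move=> /eqP; rewrite mulf_eq0 mulf_eq0 pnatr_eq0 (negbTE (neq0Ci _))/=.
by rewrite subr_eq0 eqr_nat => /eqP.
Qed.

(** The diagonal entries of [gr k z] are 1, z or z^2, which gives the degree bound 2d in z. *)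
Lemma gr_curve d F k : hom d F -> exists p : E -> {poly C},
  forall Z, (size (p Z) <= (d * 2).+1)%N /\
            forall z, F (gr k z *m Z) = (p Z).[z].
Proof.
move=> hF; have [_ _ Dc] := hom_der hF.
pose ex (i : 'I_(n + n)) : nat := match fintype.split i with
  inl l => (l != k)%N | inr l => (l == k).+1 end.
pose zeta Z : 'M[{poly C}]_(n + n, 2) := \matrix_(i, j) ((Z i j) *: 'X^(ex i)).
have sz Z i j : (size (zeta Z i j) <= 3)%N.
  rewrite mxE (leq_trans (size_scale_leq _ _))// size_polyXn /ex.
  by case: fintype.split => l; case: eqP.
have /choice [p Hp] := fun Z => Dc 2%N (zeta Z) (sz Z).
exists p => Z; have [szp ev _] := Hp Z; split=> // z; rewrite -ev; congr F.
apply/matrixP => i j; rewrite mul_diag_mx !mxE !hornerE /ex mulrC.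
by case: splitP => l _; rewrite mxE; case: eqP; rewrite /= ?expr0 ?expr1.
Qed.

Lemma gr_stab W d k z F : subsp W -> kstab W -> hom d F -> W F -> `|z| = 1 ->
  W (fun Z => F (gr k z *m Z)).
Proof.
move=> sW kW hF WF z1.
have tK : SpK (torus_mx (\row_i (if i == k then z^-1 else 1))).
  apply: torus_SpK => i; rewrite mxE; case: eqP; rewrite ?normr1 //.
  by rewrite normfV z1 invr1.
apply: set_ext (subspZ (z ^+ d) sW (kW _ _ tK WF)) => Z.
by rewrite gr_torus // -scalemxAl (hom_scale _ _ hF).
Qed.

(** The coefficients in z of F(gr k z Z) are the weight components of F. Only |z| = 1 comes from the
    group, so they are interpolated at the points [cay]. Stability is assumed for one torus
    coordinate only: the lemma is applied to a common weight space of the earlier coordinates, which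
    the group does not preserve. *)
Lemma wt_component W d k F : subsp W -> (forall F, W F -> hom d F) ->
  (forall z F, `|z| = 1 -> W F -> W (fun Z => F (gr k z *m Z))) ->
  W F -> (exists Z, F Z != 0) ->
  exists G m, [/\ W G, exists Z, G Z != 0 & wt k G m].
Proof.
move=> sW hW gW WF [Z0 FZ0]; have [p Hp] := gr_curve k (hW _ WF).
have Wm : forall m, W (fun Z => (p Z)`_m).
  apply: (@subsp_coef W cay (d * 2).+1 p sW cay_inj) => [Z|j]; first by have [] := Hp Z.
  apply: set_ext (gW _ _ (norm_cay j) WF) => Z.
  by have [_ <-] := Hp Z.
have [m pm0] : exists m, (p Z0)`_m != 0.
  apply: contrapT => /forallNP p0; move: FZ0; have [_ ev] := Hp Z0.
  have := ev 1; rewrite gr_1 mul1mx => ->.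
  rewrite (_ : p Z0 = 0) ?horner0 ?eqxx //; apply/polyP => m; rewrite coef0.
  by apply/eqP/negPn/negP; apply: p0.
exists (fun Z => (p Z)`_m), m; split=> [//||w Z]; first by exists Z0.
(* Both sides describe F at gr k (zw) Z; comparing coefficients of z shows that the m-th one is
   multiplied by w^m. *)
have -> : p (gr k w *m Z) = \poly_(i < size (p Z)) ((p Z)`_i * w ^+ i).
  apply: (poly_eq_seq (@natr_inj C)) => j.
  have [_ <-] := Hp (gr k w *m Z); rewrite mulmxA gr_mul.
  have [_ ->] := Hp Z; rewrite horner_poly horner_coef.
  by apply: eq_bigr => i _; rewrite exprMn; ring.
rewrite coef_poly; case: ltnP => [_|le]; first by rewrite mulrC.
by rewrite nth_default // mulr0.
Qed.

Lemma wt_bound d k F m Z : hom d F -> wt k F m -> F Z != 0 -> (m <= d * 2)%N.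
Proof.
move=> hF wF FZ; have [p Hp] := gr_curve k hF; have [sz ev] := Hp Z.
have pE : p Z = F Z *: 'X^m.
  apply: (poly_eq_seq (@natr_inj C)) => j.
  by rewrite -ev wF !hornerE mulrC.
by move: sz; rewrite pE size_scale // size_polyXn ltnS.
Qed.

(** Maximality at coordinate k is tested against functions that share the weights at the earlier
    coordinates, that is, lexicographically. Natural numbers suffice because [gr] shifts the weights
    by the degree. *)
Definition lexmax W (la : nat -> nat) F :=
  [/\ W F, exists Z, F Z != 0, forall k : 'I_n, wt k F (la k)
    & forall (k : 'I_n) G m, W G -> (exists Z, G Z != 0) ->
        (forall j : 'I_n, (j < k)%N -> wt j G (la j)) -> wt k G m ->
        (m <= la k)%N].

(** Greedy choice, one coordinate at a time: in the common weight space found so far, the weights of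
    the next coordinate are bounded by 2d, so a largest one is attained. *)
Lemma lexmax_exists W d : subsp W -> kstab W -> (forall F, W F -> hom d F) ->
  (exists F, W F /\ exists Z, F Z != 0) -> exists la F, lexmax W la F.
Proof.
move=> sW kW hW [F0 [WF0 F0Z]].
suff H : forall i, (i <= n)%N -> exists (la : nat -> nat) F,
  [/\ W F, exists Z, F Z != 0, forall k : 'I_n, (k < i)%N -> wt k F (la k)
    & forall (k : 'I_n) G m, (k < i)%N -> W G -> (exists Z, G Z != 0) ->
        (forall j : 'I_n, (j < k)%N -> wt j G (la j)) -> wt k G m ->
        (m <= la k)%N].
  have [la [F [WF FZ wF mF]]] := H n (leqnn n).
  by exists la, F; split=> // [k|k G m]; [apply: wF|apply: mF].
elim=> [_|i IH lt_in]; first by exists (fun=> 0%N), F0; split.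
have [la [F [WF FZ wF mF]]] := IH (ltnW lt_in).
pose k0 := Ordinal lt_in.
pose Wi : set (E -> C) :=
  [set G | W G /\ forall j : 'I_n, (j < i)%N -> wt j G (la j)].
have sWi : subsp Wi.
  split; first by split; [exact: sW.1|move=> j _ z Z; rewrite mulr0].
  move=> a G G' [WG wG] [WG' wG']; split; first exact: sW.2.
  by move=> j ji z Z; rewrite wG // wG' //; ring.
have gWi z G : `|z| = 1 -> Wi G -> Wi (fun Z => G (gr k0 z *m Z)).
  move=> z1 [WG wG]; split; first by apply: (gr_stab k0 sW kW (hW _ WG)).
  by move=> j ji w Z; rewrite mulmxA gr_comm -mulmxA wG.
have [G [m [WG GZ wG]]] := @wt_component Wi d k0 F sWi
  (fun G' wG' => hW G' (proj1 wG')) gWi (conj WF wF) FZ.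
pose P m := `[< exists G, [/\ Wi G, exists Z, G Z != 0 & wt k0 G m] >].
have exP : exists m, P m by exists m; apply/asboolP; exists G.
have bP m' : P m' -> (m' <= d * 2)%N.
  move=> /asboolP [G' [WG' [Z GZ'] wG']].
  exact: wt_bound (hW _ WG'.1) wG' GZ'.
case: (ex_maxnP exP bP) => m1 /asboolP [G1 [[WG1 wG1] GZ1 wk1]] mx.
exists (fun j => if j == i then m1 else la j), G1; split=> // [k|k G' m'].
  rewrite ltnS leq_eqVlt; case: eqP => [ki _|_ /=]; last exact: wG1.
  by have -> : k = k0 by apply: val_inj.
rewrite ltnS leq_eqVlt; case: eqP => [ki _|_ /= ki] WG' GZ' wG' wk'.
  have kk : k = k0 by apply: val_inj.
  apply: mx; apply/asboolP; exists G'; split; rewrite -?kk//; split=> // j ji.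
  by have := wG' j; rewrite ki ji (ltn_eqF ji); apply.
apply: mF WG' GZ' _ wk' => // j jk.
by have := wG' j jk; rewrite (ltn_eqF (ltn_trans jk ki)).
Qed.

End Stability.

(** * Positive root vectors of the symplectic Lie algebra and highest weight conditions *)

Section RaisingOperators.
Variables (C : numClosedFieldType) (n : nat).
Local Open Scope sesquilinear_scope.
Local Notation M := 'M[C]_(n + n).
Local Notation E := 'M[C]_(n + n, 2).
Implicit Types (A : M) (F G : E -> C) (Z : E) (X S : 'M[C]_n).

Definition levi_mx X : M := block_mx X 0 0 (- X^T).
Definition siegel_mx S : M := block_mx 0 S 0 0.

Lemma block0mx : block_mx 0 0 0 0 = 0 :> M.
Proof.
apply/matrixP => i j; rewrite !mxE; case: splitP => k _; rewrite !mxE.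
  by case: splitP => l _; rewrite mxE.
by case: splitP => l _; rewrite mxE.
Qed.

Lemma delta_conj (i j : 'I_n) : (delta_mx i j : 'M[C]_n)^t* = delta_mx j i.
Proof. by rewrite trmx_delta map_delta_mx. Qed.

Lemma siegel_nilroot S : S^T = S -> S *m S^t* *m S = S -> nilroot (siegel_mx S).
Proof.
move=> ST S3; rewrite /siegel_mx; split.
- by rewrite mulmx_block !(mul0mx, mulmx0, addr0) block0mx.
- rewrite tr_block_mx map_block_mx !mulmx_block !trmx0 !map_mx0.
  by rewrite !(mul0mx, mulmx0, addr0, add0r) S3.
- rewrite tr_block_mx /Jmx !mulmx_block !trmx0 ST opp_block_mx.
  by rewrite !(mul0mx, mulmx0, addr0, add0r, mul1mx, mulmxN, mulmx1, oppr0).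
Qed.

Lemma levi_nilroot X : X *m X = 0 -> X *m X^t* *m X = X -> nilroot (levi_mx X).
Proof.
move=> XX X3; rewrite /levi_mx; split.
- rewrite mulmx_block !(mul0mx, mulmx0, addr0, add0r) XX mulNmx mulmxN opprK.
  by rewrite -trmx_mul XX trmx0 block0mx.
- rewrite tr_block_mx map_block_mx !mulmx_block !trmx0 !map_mx0.
  have -> : (- X^T)^t* = - map_mx Num.conj X.
    by apply/matrixP => a b; rewrite !mxE rmorphN.
  rewrite !(mul0mx, mulmx0, addr0, add0r) X3 !(mulNmx, mulmxN, opprK).
  congr (block_mx _ _ _ (- _)).
  rewrite -[in RHS]X3 !trmx_mul mulmxA; congr (_ *m _ *m _).
  by apply/matrixP => a b; rewrite !mxE.
- rewrite tr_block_mx /Jmx !mulmx_block !trmx0 opp_block_mx [(- X^T)^T]linearN/= trmxK.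
  by rewrite !(mul0mx, mulmx0, addr0, add0r, mul1mx, mulmxN, mulNmx, mulmx1,
     oppr0, opprK).
Qed.

Lemma levi_delta_nilroot (i j : 'I_n) : i != j ->
  nilroot (levi_mx (delta_mx i j)).
Proof.
move=> ij; apply: levi_nilroot; first by rewrite mul_delta_mx_0 // eq_sym.
by rewrite delta_conj !mul_delta_mx.
Qed.

Lemma siegel_diag_nilroot (i : 'I_n) : nilroot (siegel_mx (delta_mx i i)).
Proof.
by apply: siegel_nilroot; rewrite ?trmx_delta // map_delta_mx !mul_delta_mx.
Qed.

Lemma siegel_delta_nilroot (i j : 'I_n) : i != j ->
  nilroot (siegel_mx (delta_mx i j + delta_mx j i)).
Proof.
move=> ij; have ji : j != i by rewrite eq_sym.
apply: siegel_nilroot; first by rewrite linearD/= !trmx_delta addrC.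
have -> : (delta_mx i j + delta_mx j i : 'M[C]_n)^t* = delta_mx i j + delta_mx j i.
  by rewrite linearD/= map_mxD !delta_conj addrC.
have e1 : delta_mx i j *m delta_mx i j = 0 :> 'M[C]_n by rewrite mul_delta_mx_0.
have e2 : delta_mx j i *m delta_mx j i = 0 :> 'M[C]_n by rewrite mul_delta_mx_0.
have e3 : delta_mx j j *m delta_mx i j = 0 :> 'M[C]_n by rewrite mul_delta_mx_0.
have e4 : delta_mx i i *m delta_mx j i = 0 :> 'M[C]_n by rewrite mul_delta_mx_0.
by rewrite !(mulmxDl, mulmxDr) !(mul_delta_mx, e1, e2, e3, e4, mul0mx, addr0, add0r).
Qed.

(** For F of weight m at coordinate k, the function Z |-> [der F Z (A *m Z)] then has weight m + e
    there and unchanged earlier weights. The operator acts on functions, hence A stands to the left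
    of [gr k z]. *)
Definition raises A k e :=
  (forall z, A *m gr k z = z ^+ e *: (gr k z *m A)) /\
  (forall (j : 'I_n) z, (j < k)%N -> A *m gr j z = gr j z *m A).

Lemma grE (k : 'I_n) (z : C) : gr k z = block_mx
  (diag_mx (\row_i (if i == k then 1 else z))) 0 0
  (diag_mx (\row_i (if i == k then z ^+ 2 else z))).
Proof. exact: diag_mx_row. Qed.

Lemma delta_diag (i j : 'I_n) (d : 'rV[C]_n) :
  (delta_mx i j *m diag_mx d = d 0 j *: delta_mx i j) *
  (diag_mx d *m delta_mx i j = d 0 i *: delta_mx i j).
Proof.
split; apply/matrixP => a b; rewrite ?mul_mx_diag ?mul_diag_mx !mxE.
  case: (b =P j) => [->|_]; first by rewrite mulrC.
  by rewrite andbF mul0r mulr0.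
by case: (a =P i) => [->//|_]; rewrite mulr0 mulr0.
Qed.

Lemma levi_raises (i j : 'I_n) : (i < j)%N -> raises (levi_mx (delta_mx i j)) i 1.
Proof.
move=> ij; have ji : (j == i) = false by apply: gtn_eqF.
split=> [z|k z ki]; rewrite grE /levi_mx !mulmx_block ?scale_block_mx
  !(mul0mx, mulmx0, addr0, add0r) ?scaler0 !trmx_delta mulNmx mulmxN !delta_diag
  !mxE.
  by rewrite eqxx ji scale1r -scalerN -scalerN scalerA expr1 -expr2.
have ik : (i == k) = false by apply: gtn_eqF.
by rewrite ik; have -> : (j == k) = false by apply: gtn_eqF; apply: ltn_trans ij.
Qed.

Lemma siegel_diag_raises (i : 'I_n) : raises (siegel_mx (delta_mx i i)) i 2.
Proof.
split=> [z|k z ki]; rewrite grE /siegel_mx !mulmx_block ?scale_block_mx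
  !(mul0mx, mulmx0, addr0, add0r) ?scaler0 !delta_diag !mxE.
  by rewrite eqxx scale1r.
by have -> : (i == k) = false by apply: gtn_eqF.
Qed.

Lemma siegel_raises (i j : 'I_n) : (i < j)%N ->
  raises (siegel_mx (delta_mx i j + delta_mx j i)) i 1.
Proof.
move=> ij; have ji : (j == i) = false by apply: gtn_eqF.
split=> [z|k z ki]; rewrite grE /siegel_mx !mulmx_block ?scale_block_mx
  !(mul0mx, mulmx0, addr0, add0r) ?scaler0 mulmxDl mulmxDr !delta_diag !mxE.
  by rewrite eqxx ji scale1r scalerDr scalerA expr1 expr2.
have ik : (i == k) = false by apply: gtn_eqF.
by rewrite ik; have -> : (j == k) = false by apply: gtn_eqF; apply: ltn_trans ij.
Qed.

Lemma der_wt d F k m z Z Y : hom d F -> wt k F m ->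
  der F (gr k z *m Z) (gr k z *m Y) = z ^+ m * der F Z Y.
Proof.
move=> hF wF; have [p [_ ev <- _]] := hom_line Z Y hF.
rewrite (@derE _ _ _ _ _ _ (z ^+ m *: p)) ?coefZ // => t.
by rewrite scalemxAr -mulmxDr wF ev hornerZ.
Qed.

(** The derivative along A stays in W and keeps the weights before k, but has weight la k + e at k;
    were it nonzero, maximality would fail. *)
Lemma lexmax_raise W d la F A k e : subsp W -> kstab W ->
  (forall G, W G -> hom d G) -> lexmax W la F ->
  nilroot A -> raises A k e -> (0 < e)%N -> forall Z, der F Z (A *m Z) = 0.
Proof.
move=> sW kW hW [WF FZ wF mF] nA [Ak Aj] e0 Z.
have hF := hW _ WF; have [Dl _ _] := hom_der hF.
apply/eqP/negPn/negP => nz.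
have key : ~~ (la k + e <= la k)%N by rewrite -ltnNge -addn1 leq_add2l.
apply: (negP key); apply: (mF k (fun Z => der F Z (A *m Z))).
- exact: (kstab_nilroot sW kW hF WF nA).
- by exists Z.
- move=> j jk z Y; rewrite mulmxA (Aj j z jk) -mulmxA.
  by rewrite (der_wt _ _ _ hF (wF j)).
- have D0 Y : der F Y 0 = 0.
    by have := Dl Y 1 0 0; rewrite scaler0 addr0 mul1r => /eqP;
      rewrite -subr_eq0 opprD addNKr oppr_eq0 => /eqP.
  move=> z Y; rewrite mulmxA Ak -scalemxAl -mulmxA -[X in der F _ X]addr0 Dl D0.
  by rewrite addr0 (der_wt _ _ _ hF (wF k)) exprD; ring.
Qed.

(* Strictly upper triangular X and symmetric S: the nilradical of the Borel
   subalgebra with positive roots e_i - e_j, e_i + e_j (i < j) and 2 e_i. *)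
Definition nplus A := exists X S,
  [/\ A = levi_mx X + siegel_mx S, forall i j : 'I_n, (j <= i)%N -> X i j = 0
    & S^T = S].

(* Killed by the raising operators. *)
Definition hw F := forall A, nplus A -> forall Z, der F Z (A *m Z) = 0.

Definition posroot A :=
  (exists i j : 'I_n, (i < j)%N /\ (A = levi_mx (delta_mx i j) \/
     A = siegel_mx (delta_mx i j + delta_mx j i))) \/
  exists i : 'I_n, A = siegel_mx (delta_mx i i).

Lemma posroot_nilroot A : posroot A -> nilroot A.
Proof.
case=> [[i [j [ij [->|->]]]]|[i ->]].
- by apply: levi_delta_nilroot; rewrite neq_ltn ij.
- by apply: siegel_delta_nilroot; rewrite neq_ltn ij.
- exact: siegel_diag_nilroot.
Qed.

Lemma posroot_raises A : posroot A -> exists k e, (0 < e)%N /\ raises A k e.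
Proof.
case=> [[i [j [ij [->|->]]]]|[i ->]].
- by exists i, 1%N; split=> //; exact: levi_raises.
- by exists i, 1%N; split=> //; exact: siegel_raises.
- by exists i, 2; split=> //; exact: siegel_diag_raises.
Qed.

Lemma posroot_nplus A : posroot A -> nplus A.
Proof.
case=> [[i [j [ij [->|->]]]]|[i ->]].
- exists (delta_mx i j), 0; split; last by rewrite trmx0.
    by rewrite /siegel_mx block0mx addr0.
  move=> k l lk; rewrite mxE; case: (k =P i) => //= ki; case: (l =P j) => //= lj.
  by move: lk; rewrite ki lj leqNgt ij.
- exists 0, (delta_mx i j + delta_mx j i); split=> [|k l _|].
  + by rewrite /levi_mx trmx0 oppr0 block0mx add0r.
  + by rewrite mxE.
  + by rewrite linearD/= !trmx_delta addrC.
- exists 0, (delta_mx i i); split=> [|k l _|].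
  + by rewrite /levi_mx trmx0 oppr0 block0mx add0r.
  + by rewrite mxE.
  + by rewrite trmx_delta.
Qed.

(** The condition is linear in A and the positive root vectors span the nilradical. *)
Lemma hw_posroot d F : hom d F ->
  (forall A, posroot A -> forall Z, der F Z (A *m Z) = 0) -> hw F.
Proof.
move=> hF hR A [X [S [-> Xu ST]]] Z.
have [Dl _ _] := hom_der hF.
pose V : set M := [set A | der F Z (A *m Z) = 0].
have D0 : der F Z 0 = 0.
  by have := Dl Z 1 0 0; rewrite scaler0 addr0 mul1r => /eqP;
    rewrite -subr_eq0 opprD addNKr oppr_eq0 => /eqP.
have VP a A1 A2 : V A1 -> V A2 -> V (a *: A1 + A2).
  by rewrite /V/= => V1 V2; rewrite mulmxDl -scalemxAl Dl V1 V2 mulr0 addr0.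
have V0 : V 0 by rewrite /V/= mul0mx.
have VD A1 A2 : V A1 -> V A2 -> V (A1 + A2).
  by move=> V1 V2; rewrite -[A1]scale1r; apply: (VP).
have VZ a A1 : V A1 -> V (a *: A1).
  by move=> V1; rewrite -[_ *: _]addr0; apply: (VP).
apply: (VD).
  rewrite [X]matrix_sum_delta.
  elim/big_ind: _ => [|X1 X2 h1 h2|i _].
  - by rewrite /levi_mx trmx0 oppr0 block0mx.
  - have -> : levi_mx (X1 + X2) = levi_mx X1 + levi_mx X2.
      by rewrite /levi_mx add_block_mx linearD/= opprD !addr0.
    exact: (VD).
  elim/big_ind: _ => [|X1 X2 h1 h2|j _].
  - by rewrite /levi_mx trmx0 oppr0 block0mx.
  - have -> : levi_mx (X1 + X2) = levi_mx X1 + levi_mx X2.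
      by rewrite /levi_mx add_block_mx linearD/= opprD !addr0.
    exact: (VD).
  have -> a : levi_mx (a *: delta_mx i j) = a *: levi_mx (delta_mx i j).
    by rewrite /levi_mx scale_block_mx linearZ/= !scaler0 scalerN.
  have [ji|ij] := leqP j i; first by rewrite Xu // scale0r.
  by apply: (VZ); apply: (hR); left; exists i, j; split=> //; left.
(* The halves compensate for the two occurrences of each off-diagonal pair, and for the doubled
   diagonal unit when i = j. *)
have -> : S = \sum_i \sum_j (S i j / 2) *: (delta_mx i j + delta_mx j i).
  transitivity (2^-1 *: (S + S^T)).
    by rewrite ST; apply/matrixP => a b; rewrite !mxE; field.
  rewrite [X in X + _]matrix_sum_delta [X in X^T]matrix_sum_delta.
  rewrite linear_sum -big_split scaler_sumr; apply: eq_bigr => i _ /=.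
  rewrite linear_sum -big_split scaler_sumr; apply: eq_bigr => j _ /=.
  by rewrite linearZ/= trmx_delta -scalerDr scalerA mulrC.
elim/big_ind: _ => [|X1 X2 h1 h2|i _].
- by rewrite /siegel_mx block0mx.
- have -> : siegel_mx (X1 + X2) = siegel_mx X1 + siegel_mx X2.
    by rewrite /siegel_mx add_block_mx !addr0.
  exact: (VD).
elim/big_ind: _ => [|X1 X2 h1 h2|j _].
- by rewrite /siegel_mx block0mx.
- have -> : siegel_mx (X1 + X2) = siegel_mx X1 + siegel_mx X2.
    by rewrite /siegel_mx add_block_mx !addr0.
  exact: (VD).
have -> a S1 : siegel_mx (a *: S1) = a *: siegel_mx S1.
  by rewrite /siegel_mx scale_block_mx !scaler0.
apply: (VZ); case: (ltngtP i j) => [ij|ji|/val_inj ->].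
- by apply: (hR); left; exists i, j; split=> //; right.
- rewrite addrC.
  by apply: (hR); left; exists j, i; split=> //; right.
- have -> : siegel_mx (delta_mx j j + delta_mx j j) = 2 *: siegel_mx (delta_mx j j).
    by rewrite /siegel_mx scale_block_mx !scaler0 scaler_nat mulr2n.
  by apply: (VZ); apply: (hR); right; exists j.
Qed.

Lemma lexmax_hw W d la F : subsp W -> kstab W ->
  (forall G, W G -> hom d G) -> lexmax W la F -> hw F.
Proof.
move=> sW kW hW lF; have [WF _ _ _] := lF.
apply: (hw_posroot (hW _ WF)) => A rA; have [k [e [e0 Ake]]] := posroot_raises rA.
exact: (lexmax_raise sW kW hW lF (posroot_nilroot rA) Ake e0).
Qed.

Lemma deriv_eq0 (p : {poly C}) : p^`() = 0 -> p = (p`_0)%:P.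
Proof.
move=> p0; apply/polyP => -[|i]; rewrite coefC //=.
have := congr1 (fun q : {poly C} => q`_i) p0; rewrite coef_deriv coef0 => /eqP.
by rewrite mulrn_eq0 /= => /eqP.
Qed.

(** The infinitesimal condition is integrated: since A^2 = 0, A sends every point of the line Z +
    tAZ to AZ, so the derivative of F along this line vanishes at each t and F is constant on it. *)
Lemma hw_invariant d F A Z : hom d F -> hw F -> nplus A -> A *m A = 0 ->
  F (Z + A *m Z) = F Z.
Proof.
move=> hF wF nA AA; have [p [_ ev _ p0]] := hom_line Z (A *m Z) hF.
suff pE : p = (p`_0)%:P by have := ev 1; rewrite scale1r => ->; rewrite pE hornerC.
apply: deriv_eq0; apply: (poly_eq0_seq (@natr_inj C)) => k.
set t : C := k%:R; rewrite -[RHS](wF A nA (Z + t *: (A *m Z))).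
have -> : A *m (Z + t *: (A *m Z)) = A *m Z.
  by rewrite mulmxDr -scalemxAr mulmxA AA mul0mx scaler0 addr0.
rewrite (@derE _ _ _ _ _ _ (p \Po ('X + t%:P))).
  have -> : (p \Po ('X + t%:P))`_1 = (p \Po ('X + t%:P))^`()`_0.
    by rewrite coef_deriv mulr1n.
  rewrite -horner_coef0 deriv_comp derivD derivX derivC addr0 mulr1 horner_comp.
  by rewrite hornerD hornerX hornerC add0r.
by move=> s; rewrite horner_comp !hornerE -addrA -scalerDl addrC -ev addrC [s + t]addrC.
Qed.

Lemma hw_levi d F X (P Q : 'M[C]_(n, 2)) : hom d F -> hw F ->
  (forall i j : 'I_n, (j <= i)%N -> X i j = 0) -> X *m X = 0 ->
  F (col_mx P Q) = F (col_mx (P + X *m P) (Q - X^T *m Q)).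
Proof.
move=> hF wF Xu XX.
rewrite -(@hw_invariant d F (levi_mx X) (col_mx P Q) hF wF).
- rewrite /levi_mx mul_block_col !mul0mx add0r addr0 add_col_mx mulNmx.
  by [].
- exists X, 0; split=> //; last by rewrite trmx0.
  by rewrite /siegel_mx block0mx addr0.
- rewrite /levi_mx mulmx_block !(mul0mx, mulmx0, addr0, add0r) XX mulNmx mulmxN.
  by rewrite opprK -trmx_mul XX trmx0 block0mx.
Qed.

Lemma hw_siegel d F S (P Q : 'M[C]_(n, 2)) : hom d F -> hw F -> S^T = S ->
  F (col_mx P Q) = F (col_mx (P + S *m Q) Q).
Proof.
move=> hF wF ST.
rewrite -(@hw_invariant d F (siegel_mx S) (col_mx P Q) hF wF).
- by rewrite /siegel_mx mul_block_col !mul0mx !add0r add_col_mx addr0.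
- exists 0, S; split=> // [|i j _]; last by rewrite mxE.
  by rewrite /levi_mx trmx0 oppr0 block0mx add0r.
- by rewrite /siegel_mx mulmx_block !(mul0mx, mulmx0, addr0) block0mx.
Qed.

End RaisingOperators.

(** * Reduction of a generic pair to a four-parameter slice *)

Section Slices.
Variables (C : numClosedFieldType) (n' : nat).
Local Notation n := n'.+1.
Local Notation E := 'M[C]_(n + n, 2).
Implicit Types (F G : E -> C) (Z : E) (P Q : 'M[C]_(n, 2)).

Lemma ord2P (c : 'I_2) : c = 0 \/ c = 1.
Proof. by case: c => -[|[|//]] h; [left|right]; apply: val_inj. Qed.

(** Row elimination in the lower block: X has the single nonzero row r, supported strictly to the
    right of the diagonal, so X^2 = 0. The upper block changes too, but only the vanishing of its
    first column has to be remembered. *)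
Lemma hw_levi_row d F (r : 'I_n) (c : 'I_n -> C) P Q : hom d F -> hw F ->
  (forall j : 'I_n, (j <= r)%N -> c j = 0) ->
  exists P', ((forall j, P j 0 = 0) -> forall j, P' j 0 = 0) /\
    F (col_mx P Q) = F (col_mx P' (\matrix_(j, k) (Q j k - c j * Q r k))).
Proof.
move=> hF wF cr.
pose X : 'M[C]_n := \matrix_(i, j) if i == r then c j else 0.
have Xu (i j : 'I_n) : (j <= i)%N -> X i j = 0.
  by rewrite mxE; case: eqP => // -> /cr.
have XX : X *m X = 0.
  apply/matrixP => i j; rewrite !mxE big1 // => k _; rewrite !mxE.
  by case: (k =P r) => [->|_]; rewrite ?mulr0 // cr // if_same mul0r.
exists (P + X *m P); split=> [P0 j|].
  by rewrite !mxE P0 add0r big1 // => k _; rewrite P0 mulr0.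
rewrite (hw_levi _ _ hF wF Xu XX); congr (F (col_mx _ _)).
apply/matrixP => j k; rewrite !mxE (bigD1 r)//= !mxE eqxx big1 ?addr0 //.
by move=> i /negbTE ir; rewrite !mxE ir mul0r.
Qed.

(** The symmetric matrix is supported on row and column r. It clears a column of the upper block
    with a pivot in row r of the lower block, at the price of an extra term in row r. *)
Lemma hw_siegel_row d F (r : 'I_n) (v : 'I_n -> C) P Q : hom d F -> hw F ->
  F (col_mx P Q) = F (col_mx (\matrix_(i, k) (P i k + v i * Q r k +
     (if i == r then \sum_(j | j != r) v j * Q j k else 0))) Q).
Proof.
move=> hF wF.
pose S : 'M[C]_n := \matrix_(i, j)
  if j == r then v i else if i == r then v j else 0.
have ST : S^T = S.
  apply/matrixP => i j; rewrite !mxE.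
  by have [ir|_] := eqVneq i r; have [jr|_] := eqVneq j r; rewrite ?ir ?jr.
rewrite (hw_siegel _ _ hF wF ST); congr (F (col_mx _ _)).
apply/matrixP => i k; rewrite !mxE (bigD1 r)//= !mxE eqxx addrA; congr (_ + _).
case: (i =P r) => ir; first by apply: eq_bigr => j /negbTE jr; rewrite mxE jr ir eqxx.
by apply: big1 => j /negbTE jr; rewrite mxE jr; case: eqP => // _; rewrite mul0r.
Qed.

Definition sl (al al' x y : C) : E := col_mx
  (\matrix_(i < n, c < 2) (x *+ ((val i == 0)%N && (c == 1))))
  (\matrix_(i < n, c < 2) (if c == 0 then al *+ (val i == 0)%N
     else al' *+ (val i == 0)%N + y *+ (val i == 1)%N)).

(** Each of the two pivots clears the entries below it in its column of the lower block, then that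
    column of the upper block. The second pivot must not touch row 0, so al' and x survive. *)
Lemma hw_slice d F P Q : hom d F -> hw F -> Q 0 0 != 0 ->
  (forall j : 'I_n, val j = 1%N -> Q 0 0 * Q j 1 - Q j 0 * Q 0 1 != 0) ->
  exists al al' x y, [/\ al != 0, y != 0 & F (col_mx P Q) = F (sl al al' x y)].
Proof.
move=> hF wF Q0 Q1.
have [j /= |P1 [_ ->]] := @hw_levi_row d F 0
  (fun j => if j == 0 then 0 else Q j 0 / Q 0 0) P Q hF wF.
  by rewrite leqn0 => /eqP j0; rewrite (_ : j = 0) ?eqxx //; apply: val_inj.
set Q' := (X in col_mx P1 X).
have Q'E i k : Q' i k = Q i k - (if i == 0 then 0 else Q i 0 / Q 0 0) * Q 0 k.
  by rewrite mxE.
clearbody Q'.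
have Q'0 k : Q' 0 k = Q 0 k by rewrite Q'E eqxx mul0r subr0.
have Q'j (j : 'I_n) : j != 0 -> Q' j 0 = 0.
  by move=> /negbTE j0; rewrite Q'E j0 mulfVK // subrr.
rewrite (hw_siegel_row 0 (fun j => - P1 j 0 / Q 0 0) _ _ hF wF).
set P2 := (X in col_mx X Q').
have P20 j : P2 j 0 = 0.
  rewrite mxE Q'0 mulfVK // subrr add0r; case: eqP => // _; apply: big1 => i i0.
  by rewrite Q'j // mulr0.
clearbody P2.
case: (ltngtP n 1%N) => // [n1|n1]; last first.
  (* For n = 1 there is no second pivot and the slice does not depend on y; 1 is an arbitrary
     nonzero value. *)
  exists (Q 0 0), (Q 0 1), (P2 0 1), 1; split; rewrite ?oner_eq0 //.
  have i0 (i : 'I_n) : i = 0.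
    by apply: val_inj => /=; case: i => /= m; rewrite n1; case: m.
  congr (F (col_mx _ _)); apply/matrixP => i c; rewrite (i0 i).
    by case: (ord2P c) => ->; rewrite [RHS]mxE /= ?mulr1n ?P20.
  by case: (ord2P c) => ->; rewrite [RHS]mxE /= ?mulr1n ?mulr0n ?addr0 Q'0.
pose i1 : 'I_n := Ordinal n1.
have i10 : i1 != 0 by [].
have Q'1 : Q' i1 1 != 0.
  rewrite Q'E (negbTE i10); have := Q1 i1 erefl; apply: contra_neq => e.
  have : Q 0 0 * (Q i1 1 - Q i1 0 / Q 0 0 * Q 0 1) = 0 by rewrite e mulr0.
  move=> <-; move: (Q 0 0) Q0 (Q i1 0) (Q 0 1) (Q i1 1) => a a0 b c e'.
  by field.
have [j /= j1|P3 [P30 ->]] := @hw_levi_row d F i1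
  (fun j => if (j <= 1)%N then 0 else Q' j 1 / Q' i1 1) P2 Q' hF wF.
  by rewrite j1.
have {}P30 := P30 P20.
set Q'' := (X in col_mx P3 X).
have Q''0 (j : 'I_n) : Q'' j 0 = Q' j 0 by rewrite mxE (Q'j i1) // mulr0 subr0.
have Q''1 (j : 'I_n) : Q'' j 1 = if (j <= 1)%N then Q' j 1 else 0.
  by rewrite mxE; case: ifP => _; rewrite ?mul0r ?subr0 // mulfVK // subrr.
clearbody Q''.
(* The zero at j = 0 protects the first column of the upper block: otherwise symmetry would bring a
   multiple of Q 0 0 into row 1. *)
rewrite (hw_siegel_row i1 (fun j => if j == 0 then 0 else - P3 j 1 / Q' i1 1)
  _ _ hF wF).
exists (Q 0 0), (Q 0 1), (P3 0 1), (Q' i1 1); split=> //.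
congr (F (col_mx _ _)); apply/matrixP => i c; rewrite !mxE.
  case: (ord2P c) => -> /=.
    rewrite P30 Q''0 Q'j // mulr0 add0r andbF mulr0n add0r.
    case: eqP => // _; apply: big1 => j ji1; rewrite Q''0.
    by case: (j =P 0) => [_|/eqP j0]; rewrite ?mul0r // Q'j // mulr0.
  rewrite andbT Q''1 leqnn.
  have [->|i0] := eqVneq i 0.
    by case: eqP => [/(congr1 val)//|_]; rewrite mul0r !addr0.
  rewrite mulfVK // subrr add0r (_ : (val i == 0)%N = false); last first.
    by apply: contraNF i0 => /eqP i0; apply/eqP/val_inj.
  case: eqP => // _; apply: big1 => j ji1.
  have [->|j0] := eqVneq j 0; first by rewrite mul0r.
  rewrite Q''1; case: leqP => j1; last by rewrite mulr0.
  case/negP: ji1; apply/eqP/val_inj => /=.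
  by have : (val j != 0)%N := j0; move: j1 => /=; lia.
case: (ord2P c) => -> /=.
  rewrite Q''0; have [->|i0] := eqVneq i 0; first by rewrite Q'0 mulr1n.
  rewrite Q'j // (_ : (val i == 0)%N = false) //.
  by apply: contraNF i0 => /eqP i0; apply/eqP/val_inj.
rewrite Q''1.
have [->|i0] := eqVneq i 0; first by rewrite Q'0 mulr1n mulr0n addr0.
have -> : (val i == 0)%N = false.
  by apply: contraNF i0 => /eqP i0; apply/eqP/val_inj.
rewrite mulr0n add0r; case: (ltngtP (val i) 1%N) => [|//|i1E].
  by rewrite ltnS leqn0 => /eqP i0'; case/eqP: i0; apply: val_inj.
by rewrite mulr1n (_ : i = i1) //; apply: val_inj.
Qed.

Definition dg (c e : C) : 'M[C]_2 := diag_mx (\row_j if j == 0 then c else e).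

Definition bideg a b F := forall c e Z, F (Z *m dg c e) = c ^+ a * e ^+ b * F Z.

Lemma gr0_sl z c e al al' x y : gr 0 z *m sl al al' x y *m dg c e =
  sl (c * z ^+ 2 * al) (e * z ^+ 2 * al') (e * x) (e * z * y).
Proof.
rewrite grE /sl mul_block_col !mul0mx addr0 add0r mul_col_mx.
congr col_mx; apply/matrixP => i k; rewrite mul_mx_diag mul_diag_mx !mxE.
  have -> : (i == 0) = (val i == 0)%N by [].
  by case: (ord2P k) => -> /=; case: eqP => _; rewrite /= ?mulr1n ?mulr0n; ring.
have -> : (i == 0) = (val i == 0)%N by [].
case: (val i) => [|[|m]]; case: (ord2P k) => -> /=;
  by rewrite ?mulr1n ?mulr0n; ring.
Qed.

Lemma gr1_sl (i1 : 'I_n) z al al' x y : val i1 = 1%N ->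
  gr i1 z *m sl al al' x y = sl (z * al) (z * al') (z * x) (z ^+ 2 * y).
Proof.
move=> i1E; rewrite grE /sl mul_block_col !mul0mx addr0 add0r.
congr col_mx; apply/matrixP => i k; rewrite mul_diag_mx !mxE.
  have -> : (i == i1) = (val i == 1)%N by rewrite -i1E.
  by case: (ord2P k) => -> /=; case: (val i) => [|[|m]]; rewrite /= ?mulr1n ?mulr0n; ring.
have -> : (i == i1) = (val i == 1)%N by rewrite -i1E.
case: (val i) => [|[|m]]; case: (ord2P k) => -> /=;
  by rewrite ?mulr1n ?mulr0n; ring.
Qed.

Lemma gr2_sl (i2 : 'I_n) z al al' x y : (1 < val i2)%N ->
  gr i2 z *m sl al al' x y = z *: sl al al' x y.
Proof.
move=> i2E; rewrite grE /sl mul_block_col !mul0mx addr0 add0r scale_col_mx.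
congr col_mx; apply/matrixP => i k; rewrite mul_diag_mx !mxE.
  case: (i =P i2) => [ii|//]; have -> : (val i == 0)%N = false.
    by rewrite ii; case: (val i2) i2E.
  by rewrite mulr0n !mulr0.
case: (i =P i2) => [ii|//]; have -> : (val i == 0)%N = false.
  by rewrite ii; case: (val i2) i2E.
have -> : (val i == 1)%N = false by rewrite ii; case: (val i2) i2E => [|[]].
by rewrite !mulr0n addr0 if_same !mulr0.
Qed.

Lemma sl_y_irrelevant al al' x y y' : n = 1%N -> sl al al' x y = sl al al' x y'.
Proof.
move=> n1; congr (col_mx _ _); apply/matrixP => i k; rewrite !mxE.
have -> : (val i == 1)%N = false by case: i => /= m; rewrite n1; case: m.
by rewrite !mulr0n.
Qed.

(* The torus of Sp(n, C) and the scalings of U and V act with a dense orbit on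
   the slice. *)
Lemma sl_scaling F a b (la : nat -> nat) c e z1 z2 : bideg a b F ->
  (forall k : 'I_n, wt k F (la k)) -> forall al al' x y,
  F (sl (c * z1 ^+ 2 * z2 * al) (e * z1 ^+ 2 * z2 * al') (e * z2 * x)
        (e * z1 * z2 ^+ 2 * y)) =
  c ^+ a * e ^+ b * z1 ^+ la 0%N * z2 ^+ (if (1 < n)%N then la 1%N else (a + b)%N)
    * F (sl al al' x y).
Proof.
move=> bF wF al al' x y; case: ifP => n1.
  pose i1 : 'I_n := Ordinal n1.
  have := bF c e (gr 0 z1 *m (gr i1 z2 *m sl al al' x y)).
  rewrite wF wF (@gr1_sl i1) // gr0_sl => h.
  transitivity (c ^+ a * e ^+ b * (z1 ^+ la 0%N * (z2 ^+ la 1%N * F (sl al al' x y)))).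
    by rewrite -h; congr (F (sl _ _ _ _)); ring.
  by ring.
have n1' : n = 1%N by case: (n') n1.
have := bF (c * z2) (e * z2) (gr 0 z1 *m sl al al' x y).
rewrite wF gr0_sl exprMn exprMn exprD => h.
transitivity (c ^+ a * z2 ^+ a * (e ^+ b * z2 ^+ b) * (z1 ^+ la 0%N * F (sl al al' x y))).
  rewrite -h (sl_y_irrelevant _ _ _ _ (e * z2 * z1 * y) n1').
  by congr (F (sl _ _ _ _)); ring.
by ring.
Qed.

End Slices.

(** * Classification of highest weight vectors *)

Section HighestWeightVectors.
Variables (C : numClosedFieldType) (n' : nat).
Local Notation n := n'.+1.
Local Notation E := 'M[C]_(n + n, 2).
Implicit Types (F G : E -> C) (Z : E).

Lemma hom_right d F (h : 'M[C]_2) : hom d F -> hom d (fun Z => F (Z *m h)).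
Proof. exact: (@hom_lin _ _ _ d F (mulmxr h)). Qed.

Lemma hw_right d F (h : 'M[C]_2) : hom d F -> hw F -> hw (fun Z => F (Z *m h)).
Proof.
move=> hF wF A nA Z; rewrite -(wF A nA (Z *m h)).
have [p [_ ev <- _]] := hom_line (Z *m h) (A *m (Z *m h)) hF.
by apply: derE => t; rewrite -ev mulmxDl -scalemxAl mulmxA.
Qed.

Lemma poly_vanish (p : {poly C}) : (forall k : nat, p.[k.+1%:R] = 0) -> p = 0.
Proof.
by apply: (@poly_eq0_seq _ _ (fun k => k.+1%:R)) => i j /eqP; rewrite eqr_nat => /eqP [].
Qed.

Lemma natS_neq0 (k : nat) : k.+1%:R != 0 :> C.
Proof. by rewrite pnatr_eq0. Qed.

(** One value controls F. Torus and scalings carry the base point to all slice points with nonzero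
    coordinates; polynomial identities remove the conditions on x and al'; elimination reaches every
    generic Z, and a line in a generic direction reaches the rest. *)
Lemma hw_zero d F a b (la : nat -> nat) : hom d F -> hw F -> bideg a b F ->
  (forall k : 'I_n, wt k F (la k)) -> F (sl n' 1 1 1 1) = 0 -> forall Z, F Z = 0.
Proof.
move=> hF wF bF laF F1.
have S1 (al al' x y : C) : al != 0 -> al' != 0 -> x != 0 -> y != 0 ->
    F (sl n' al al' x y) = 0.
  (* The system is c z1^2 z2 = al, e z1^2 z2 = al', e z2 = x, e z1 z2^2 = y: the second and third
     equations give z1^2, the last one then gives z2. *)
  move=> al0 al'0 x0 y0; pose z1 := sqrtC (al' / x).
  have z12 : z1 ^+ 2 = al' / x by rewrite sqrtCK.
  have z10 : z1 != 0 by rewrite sqrtC_eq0 mulf_neq0 // invr_eq0.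
  pose z2 := if (1 < n)%N then y / (x * z1) else 1.
  have z20 : z2 != 0.
    by rewrite /z2; case: ifP => _; rewrite ?oner_eq0 // mulf_neq0 // invr_eq0 mulf_neq0.
  have := sl_scaling (al / (z1 ^+ 2 * z2)) (x / z2) z1 z2 bF laF 1 1 1 1.
  rewrite F1 mulr0 !mulr1 => h; rewrite -[RHS]h.
  have e1 : al / (z1 ^+ 2 * z2) * z1 ^+ 2 * z2 = al by field; rewrite z20 z10.
  have e2 : x / z2 * z1 ^+ 2 * z2 = al' by rewrite z12; field; rewrite z20 x0.
  have e3 : x / z2 * z2 = x by field.
  rewrite e1 e2 e3; case: (ltnP 1 n) => n1.
    by congr (F (sl _ _ _ _ _)); rewrite {1}/z2 n1 /z2 n1; field; rewrite z10 x0 y0.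
  by congr F; apply: sl_y_irrelevant; apply/eqP; rewrite eqn_leq n1.
have slx (al al' x y : C) : sl n' al al' x y = sl n' al al' 0 y + x *: sl n' 0 0 1 0.
  rewrite /sl scale_col_mx add_col_mx; congr col_mx; apply/matrixP => i k; rewrite !mxE.
    by rewrite mul0rn add0r mulr_natr.
  by rewrite !mul0rn addr0 if_same mulr0 addr0.
have sla (al al' x y : C) : sl n' al al' x y = sl n' al 0 x y + al' *: sl n' 0 1 0 0.
  rewrite /sl scale_col_mx add_col_mx; congr col_mx; apply/matrixP => i k; rewrite !mxE.
    by rewrite !mul0rn mulr0 addr0.
  rewrite !mul0rn add0r addr0; case: ifP => _; first by rewrite mulr0 addr0.
  by rewrite mulr_natr addrC.
have S2 (al al' x y : C) : al != 0 -> al' != 0 -> y != 0 -> F (sl n' al al' x y) = 0.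
  move=> al0 al'0 y0.
  have [p [_ ev _ _]] := hom_line (sl n' al al' 0 y) (sl n' 0 0 1 0) hF.
  rewrite slx ev (_ : p = 0) ?horner0 //; apply: poly_vanish => k.
  by rewrite -ev -slx S1 // natS_neq0.
have S3 (al al' x y : C) : al != 0 -> y != 0 -> F (sl n' al al' x y) = 0.
  move=> al0 y0.
  have [p [_ ev _ _]] := hom_line (sl n' al 0 x y) (sl n' 0 1 0 0) hF.
  rewrite sla ev (_ : p = 0) ?horner0 //; apply: poly_vanish => k.
  by rewrite -ev -sla S2 // natS_neq0.
have S4 Z : let Q := dsubmx Z in Q 0 0 != 0 ->
    (forall j : 'I_n, val j = 1%N -> Q 0 0 * Q j 1 - Q j 0 * Q 0 1 != 0) -> F Z = 0.
  move=> Q Q0 Q1; rewrite -[Z]vsubmxK.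
  by have [al [al' [x [y [al0 y0 ->]]]]] := hw_slice (usubmx Z) hF wF Q0 Q1; apply: S3.
(* The lower block of Y has leading minors 1, so those of Z + tY are monic in t and vanish for
   finitely many t only. *)
move=> Z; set Q := dsubmx Z; pose Y : E := sl n' 1 0 0 1.
have Yd : dsubmx Y = \matrix_(i, c) (if c == 0 then (val i == 0%N)%:R else (val i == 1%N)%:R).
  by rewrite /Y /sl col_mxKd; apply/matrixP => i c; rewrite !mxE mul0rn add0r.
have dE t i c : dsubmx (Z + t *: Y) i c = Q i c + t * dsubmx Y i c.
  by rewrite linearD linearZ/= mxE [X in _ + X]mxE.
have [p [_ ev _ p0]] := hom_line Z Y hF.
suff [q q0 qP] : exists2 q : {poly C}, q != 0 & forall t, q.[t] != 0 ->
    let Q := dsubmx (Z + t *: Y) in Q 0 0 != 0 /\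
    (forall j : 'I_n, val j = 1%N -> Q 0 0 * Q j 1 - Q j 0 * Q 0 1 != 0).
  have : p * q = 0.
    apply: (poly_eq0_seq (@natr_inj C)) => k; rewrite hornerM -ev.
    have [->|/qP [Q0 Q1]] := eqVneq q.[k%:R] 0; first by rewrite mulr0.
    by rewrite S4 ?mul0r.
  move/eqP; rewrite mulf_eq0 (negbTE q0) orbF => /eqP pE.
  by rewrite -p0 pE coef0.
have Y00 : dsubmx Y 0 0 = 1 by rewrite Yd mxE.
have Y01 : dsubmx Y 0 1 = 0 by rewrite Yd mxE.
have Yj (j : 'I_n) : val j = 1%N -> dsubmx Y j 0 = 0 /\ dsubmx Y j 1 = 1.
  by move=> j1; rewrite Yd !mxE j1.
have q1 : 'X + (Q 0 0)%:P != 0 :> {poly C} by rewrite -size_poly_eq0 size_XaddC.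
case: (ltnP 1 n) => n1; last first.
  exists ('X + (Q 0 0)%:P) => // t; rewrite !hornerE => ht; split.
    by rewrite dE Y00 mulr1 addrC.
  by move=> j j1; have := ltn_ord j; rewrite -[X in (X < _)%N]/(val j) j1 ltnNge n1.
pose i1 : 'I_n := Ordinal n1.
pose q2 : {poly C} := 'X^2 + (Q 0 0 + Q i1 1)%:P * 'X +
  (Q 0 0 * Q i1 1 - Q i1 0 * Q 0 1)%:P.
have q20 : q2 != 0.
  apply/eqP => /(congr1 (fun r : {poly C} => r`_2)) /eqP.
  by rewrite /q2 !coefD coefXn coefMX !coefC /= !addr0 oner_eq0.
exists (('X + (Q 0 0)%:P) * q2); first by rewrite mulf_neq0.
move=> t; rewrite hornerM mulf_eq0 negb_or => /andP [h1 h2]; split.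
  by move: h1; rewrite !hornerE dE Y00 mulr1 addrC.
move=> j j1; have -> : j = i1 by apply: val_inj.
have [Y10 Y11] := Yj i1 erefl.
move: h2; rewrite /q2 !dE Y00 Y01 Y10 Y11 !mulr1 !mulr0 !addr0 !hornerE.
by rewrite /=; apply: contra_neq => <-; ring.
Qed.

(** The identity X^A p(X^2) = f0 X^B holds at the positive integers, hence for polynomials; the
    coefficient of X^B forces B - A to be even and nonnegative. *)
Lemma monomial_exponent (p : {poly C}) f0 A B : f0 != 0 ->
  (forall k : nat, k.+1%:R ^+ A * p.[k.+1%:R ^+ 2] = k.+1%:R ^+ B * f0) ->
  exists j, B = (A + 2 * j)%N.
Proof.
move=> f00 pE; have e : 'X^A * (p \Po 'X^2) = f0 *: 'X^B.
  apply/eqP; rewrite -subr_eq0; apply/eqP/poly_vanish => k.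
  by rewrite hornerD hornerN hornerM hornerZ horner_comp !hornerXn pE mulrC subrr.
have := congr1 (fun r : {poly C} => r`_B) e.
rewrite coefXnM coefZ coefXn eqxx mulr1; case: ltnP => AB; first by move/eqP; rewrite eq_sym (negbTE f00).
rewrite coef_comp_poly_Xn //; case: ifP => [/dvdnP [j jE] _|_ /eqP]; last first.
  by rewrite eq_sym (negbTE f00).
by exists j; rewrite mulnC -jE subnKC.
Qed.

(** On the slice F behaves as a monomial, and [hwv i j k s] is al^(i+k+s) al'^j x^s y^k there.
    Polynomiality of F in al', x and y makes j, s and k natural numbers; i comes from exchanging U
    and V. The weights carry the shift a + b. *)
Lemma hw_weights F a b (la : nat -> nat) : hom (a + b) F -> hw F ->
  bideg a b F -> (forall k : 'I_n, wt k F (la k)) -> (exists Z, F Z != 0) ->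
  exists i j k s, [/\ a = (i + k + s)%N, b = (j + k + s)%N,
    la 0%N = (a + b + i + j + k)%N,
    (if (1 < n)%N then la 1%N = (a + b + k)%N else k = 0%N) &
    forall m : 'I_n, (1 < m)%N -> la m = (a + b)%N].
Proof.
move=> hF wF bF laF [Z0 FZ0].
set L1 := if (1 < n)%N then la 1%N else (a + b)%N.
have f00 : F (sl n' 1 1 1 1) != 0.
  by apply: contra_neq FZ0 => e; apply: (hw_zero hF wF bF laF e).
have slx (al al' x y : C) : sl n' al al' x y = sl n' al al' 0 y + x *: sl n' 0 0 1 0.
  rewrite /sl scale_col_mx add_col_mx; congr col_mx; apply/matrixP => i k; rewrite !mxE.
    by rewrite mul0rn add0r mulr_natr.
  by rewrite !mul0rn addr0 if_same mulr0 addr0.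
have sla (al al' x y : C) : sl n' al al' x y = sl n' al 0 x y + al' *: sl n' 0 1 0 0.
  rewrite /sl scale_col_mx add_col_mx; congr col_mx; apply/matrixP => i k; rewrite !mxE.
    by rewrite !mul0rn mulr0 addr0.
  rewrite !mul0rn add0r addr0; case: ifP => _; first by rewrite mulr0 addr0.
  by rewrite mulr_natr addrC.
have sly (al al' x y : C) : sl n' al al' x y = sl n' al al' x 0 + y *: sl n' 0 0 0 1.
  rewrite /sl scale_col_mx add_col_mx; congr col_mx; apply/matrixP => i k; rewrite !mxE.
    by rewrite !mul0rn mulr0 addr0.
  rewrite !mul0rn add0r addr0; case: ifP => _; first by rewrite mulr0 addr0.
  by rewrite mulr_natr.
have alpha_exp G a' b' (c' := (a' + b')%N) : hom c' G -> bideg a' b' G ->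
    c' = (a + b)%N ->
    (forall k : 'I_n, wt k G (la k)) -> G (sl n' 1 1 1 1) != 0 ->
    exists j, (b' + la 0%N = a' + L1 + 2 * j)%N.
  move=> hG bG cE laG g00.
  have [p [_ ev _ _]] := hom_line (sl n' 1 0 1 1) (sl n' 0 1 0 0) hG.
  apply: (@monomial_exponent p _ _ _ g00) => k.
  set r : C := k.+1%:R; have r0 : r != 0 by apply: natS_neq0.
  (* These parameters fix al, x and y and multiply al' by r^2. *)
  have := sl_scaling r^-1 r r r^-1 bG laG 1 1 1 1.
  rewrite -/c' cE -/L1 !mulr1 -ev -sla => h.
  transitivity (r ^+ (a' + L1) * (r^-1 ^+ a' * r ^+ b' * r ^+ la 0%N * r^-1 ^+ L1 *
      G (sl n' 1 1 1 1))).
    by rewrite -h; congr (_ * G (sl _ _ _ _ _)); field.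
  rewrite !exprVn !exprD; field.
  by rewrite !expf_neq0.
have [j jE] := alpha_exp F a b hF bF erefl laF f00.
have [s sE] : exists s, (3 * (a + b) = la 0%N + L1 + 2 * s)%N.
  have [p [_ ev _ _]] := hom_line (sl n' 1 1 0 1) (sl n' 0 0 1 0) hF.
  apply: (@monomial_exponent p _ _ _ f00) => k.
  set r : C := k.+1%:R; have r0 : r != 0 by apply: natS_neq0.
  (* Here only x moves, by the factor r^2. *)
  have := sl_scaling (r ^+ 3) (r ^+ 3) r^-1 r^-1 bF laF 1 1 1 1.
  rewrite -/L1 !mulr1 -ev -slx => h.
  transitivity (r ^+ (la 0%N + L1) * ((r ^+ 3) ^+ a * (r ^+ 3) ^+ b * r^-1 ^+ la 0%N *
      r^-1 ^+ L1 * F (sl n' 1 1 1 1))).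
    by rewrite -h; congr (_ * F (sl _ _ _ _ _)); field.
  rewrite !exprVn -!exprM mulnDr !exprD; field.
  by rewrite !expf_neq0.
have [k kE] : exists k, L1 = (a + b + k)%N /\ ((1 < n)%N = false -> k = 0%N).
  case: (ltnP 1 n) => n1; last by exists 0%N; rewrite /L1 ltnNge n1 addn0.
  exists (L1 - (a + b))%N; split=> //; rewrite subnKC //.
  have [p [_ ev _ _]] := hom_line (sl n' 1 1 1 0) (sl n' 0 0 0 1) hF.
  have e : 'X^(a + b) * p = F (sl n' 1 1 1 1) *: 'X^L1.
    apply/eqP; rewrite -subr_eq0; apply/eqP/poly_vanish => k.
    set r : C := k.+1%:R; have r0 : r != 0 by apply: natS_neq0.
    (* Here only y moves, by the factor r. *)
    have := sl_scaling r^-1 r^-1 1 r bF laF 1 1 1 1.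
    rewrite -/L1 !mulr1 !expr1n !mulr1 mulVf // => h.
    apply/eqP; rewrite !hornerE subr_eq0 -ev -sly; apply/eqP.
    transitivity (r ^+ (a + b) * (r^-1 ^+ a * r^-1 ^+ b * r ^+ L1 * F (sl n' 1 1 1 1))).
      by rewrite -h; congr (_ * F (sl _ _ _ _ _)); field.
    by rewrite !exprVn exprD; field; rewrite !expf_neq0.
  have := congr1 (fun r : {poly C} => r`_L1) e.
  rewrite coefXnM coefZ coefXn eqxx mulr1; case: ltnP => // _ /eqP.
  by rewrite eq_sym (negbTE f00).
have [i iE] : exists i, (a + la 0%N = b + L1 + 2 * i)%N.
  (* The exchange of columns commutes with the group and swaps the bidegree, so the argument for j
     yields i; the value at the base point stays nonzero by [hw_zero]. *)
  pose h : 'M[C]_2 := \matrix_(i, j) (i != j)%:R.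
  have ZhE (Z : E) i c : (Z *m h) i c = Z i (if c == 0 then 1 else 0).
    rewrite mxE big_ord_recl big_ord1 !mxE.
    by case: (ord2P c) => -> /=; rewrite !(mulr1, mulr0, addr0, add0r); congr (Z i _); apply: val_inj.
  have hh : h *m h = 1%:M.
    apply/matrixP => p q; rewrite mxE big_ord_recl big_ord1 !mxE.
    by case: (ord2P p) => ->; case: (ord2P q) => -> /=;
      rewrite !(mulr1, mulr0, addr0, add0r).
  have dgh c e : dg c e *m h = h *m dg e c.
    apply/matrixP => p q; rewrite mul_mx_diag mul_diag_mx !mxE.
    by case: (ord2P p) => ->; case: (ord2P q) => -> /=; rewrite !(mulr1, mulr0, mul0r, mul1r).
  apply: (alpha_exp (fun Z => F (Z *m h)) b a); first by rewrite addnC; apply: hom_right.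
  - move=> c e Z; rewrite -mulmxA dgh mulmxA bF; ring.
  - by rewrite addnC.
  - by move=> m z Z; rewrite -mulmxA laF.
  - apply: contra_neq FZ0 => e.
    have hG : hom (b + a) (fun Z => F (Z *m h)) by rewrite addnC; apply: hom_right.
    have wG := hw_right h hF wF.
    have bG : bideg b a (fun Z => F (Z *m h)).
      by move=> c e' Z; rewrite -mulmxA dgh mulmxA bF; ring.
    have laG (m : 'I_n) : wt m (fun Z => F (Z *m h)) (la m).
      by move=> z Z; rewrite -mulmxA laF.
    by have := hw_zero hG wG bG laG e (Z0 *m h); rewrite -mulmxA hh mulmx1.
exists i, j, k, s.
have [L1E k0] := kE.
split; try lia.
  move: L1E k0; rewrite /L1; case: ifP => // _ _; apply.
  by [].
move=> m m1; apply/eqP.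
(* Beyond the first two coordinates [gr] acts on the slice as a scalar, so homogeneity fixes the
   weight. *)
have := laF m 2 (sl n' 1 1 1 1); rewrite gr2_sl // (hom_scale _ _ hF) => /(mulIf f00).
rewrite -!natrX => /eqP; rewrite eqr_nat eqn_exp2l // => /eqP ->.
by [].
Qed.

(** A missing row reads as 0. For n = 1 the minor [mi] is therefore 0, and [hwv] is nonzero only
    when k = 0. *)
Definition lo Z (p : nat) (c : 'I_2) : C :=
  if insub p is Some i then dsubmx Z (i : 'I_n) c else 0.
Definition mi Z : C := lo Z 0 0 * lo Z 1 1 - lo Z 1 0 * lo Z 0 1.
Definition om Z : C := omega (col 0 Z) (col 1 Z).
Definition hwv (i j k s : nat) Z : C :=
  lo Z 0 0 ^+ i * lo Z 0 1 ^+ j * mi Z ^+ k * om Z ^+ s.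

Lemma lo_hom p c : hom 1 (fun Z => lo Z p c).
Proof.
rewrite /lo; case: insubP => [i _ _|_]; last exact: hom0.
by apply: hom_ext (@hom_entry C _ _ (rshift n i) c) => Z; rewrite mxE.
Qed.

Lemma mi_hom : hom 2 mi.
Proof.
apply: hom_ext (homD (hom_mul (lo_hom 0 0) (lo_hom 1 1))
  (homZ (-1) (hom_mul (lo_hom 1 0) (lo_hom 0 1)))) => Z.
by rewrite mulN1r.
Qed.

Lemma omE Z : om Z = \sum_(k < n)
  (Z (rshift n k) 0 * Z (lshift n k) 1 - Z (lshift n k) 0 * Z (rshift n k) 1).
Proof.
by rewrite /om /omega /pairing -sumrB; apply: eq_bigr => k _; rewrite !mxE.
Qed.

Lemma om_hom : hom 2 om.
Proof.
have h (i j : 'I_(n + n)) : hom 2 (fun Z : E => Z i 0 * Z j 1).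
  by have := hom_mul (@hom_entry C _ 2 i 0) (@hom_entry C _ 2 j 1).
have h2 (k : 'I_n) : hom 2 (fun Z : E =>
    Z (rshift n k) 0 * Z (lshift n k) 1 + -1 * (Z (lshift n k) 0 * Z (rshift n k) 1)).
  by apply: homD => //; apply: homZ.
apply: hom_ext (@hom_sum C _ _ 2 'I_n (index_enum _) xpredT _ (fun k _ => h2 k)) => Z.
by rewrite omE; apply: eq_bigr => k _; rewrite mulN1r.
Qed.

Lemma hwv_hom i j k s : hom (i + j + k * 2 + s * 2) (hwv i j k s).
Proof.
have := hom_mul (hom_mul (hom_mul (hom_exp i (lo_hom 0 0)) (hom_exp j (lo_hom 0 1)))
  (hom_exp k mi_hom)) (hom_exp s om_hom).
by rewrite !muln1.
Qed.

Lemma lo_lin Z Y t p c : lo (Z + t *: Y) p c = lo Z p c + t * lo Y p c.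
Proof.
by rewrite /lo; case: insubP => [i _ _|_]; rewrite ?mxE ?mulr0 ?addr0 // !mxE.
Qed.

Lemma lo_dg Z c e p q : lo (Z *m dg c e) p q = (if q == 0 then c else e) * lo Z p q.
Proof.
rewrite /lo; case: insubP => [i _ _|_]; last by rewrite mulr0.
by rewrite mxE mul_mx_diag !mxE mulrC.
Qed.

Lemma lo_gr (k : 'I_n) z Z p q :
  lo (gr k z *m Z) p q = (if p == k then z ^+ 2 else z) * lo Z p q.
Proof.
rewrite /lo; case: insubP => [i _ ip|_]; last by rewrite mulr0.
rewrite -ip grE -[Z]vsubmxK mul_block_col !mul0mx addr0 add0r !col_mxKd.
by rewrite mul_diag_mx !mxE.
Qed.

Lemma om_dg Z c e : om (Z *m dg c e) = c * e * om Z.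
Proof.
have h i q : (Z *m dg c e) i q = (if q == 0 then c else e) * Z i q.
  by rewrite mul_mx_diag !mxE mulrC.
by rewrite !omE mulr_sumr; apply: eq_bigr => k _; rewrite !h /=; ring.
Qed.

Lemma om_gr (k : 'I_n) z Z : om (gr k z *m Z) = z ^+ 2 * om Z.
Proof.
have l (i : 'I_n) c : (gr k z *m Z) (lshift n i) c =
    (if i == k then 1 else z) * Z (lshift n i) c.
  by rewrite mul_diag_mx mxE row_mxEl mxE.
have r (i : 'I_n) c : (gr k z *m Z) (rshift n i) c =
    (if i == k then z ^+ 2 else z) * Z (rshift n i) c.
  by rewrite mul_diag_mx mxE row_mxEr mxE.
rewrite !omE mulr_sumr; apply: eq_bigr => i _.
by rewrite !l !r; case: eqP => _; ring.
Qed.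

Lemma hwv_bideg i j k s : bideg (i + k + s) (j + k + s) (hwv i j k s).
Proof.
move=> c e Z; rewrite /hwv /mi om_dg !lo_dg /= !exprD !exprMn.
have -> : c * lo Z 0 0 * (e * lo Z 1 1) - c * lo Z 1 0 * (e * lo Z 0 1) =
  c * e * (lo Z 0 0 * lo Z 1 1 - lo Z 1 0 * lo Z 0 1) by ring.
by rewrite !exprMn; ring.
Qed.

Lemma hwv_wt i j k s (m : 'I_n) : wt m (hwv i j k s)
  (if val m == 0%N then i * 2 + j * 2 + k * 3 + s * 2
   else if val m == 1%N then i + j + k * 3 + s * 2
   else i + j + k * 2 + s * 2)%N.
Proof.
move=> z Z; rewrite /hwv /mi om_gr !lo_gr.
have e0 : (0%N == m) = (val m == 0%N) by rewrite eq_sym.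
have e1 : (1%N == m) = (val m == 1%N) by rewrite eq_sym.
rewrite e0 e1; case: (val m) => [|[|m']] /=.
- have -> : z ^+ 2 * lo Z 0 0 * (z * lo Z 1 1) - z * lo Z 1 0 * (z ^+ 2 * lo Z 0 1) =
    z ^+ 3 * (lo Z 0 0 * lo Z 1 1 - lo Z 1 0 * lo Z 0 1) by ring.
  by rewrite !exprD !exprM !exprMn; ring.
- have -> : z * lo Z 0 0 * (z ^+ 2 * lo Z 1 1) - z ^+ 2 * lo Z 1 0 * (z * lo Z 0 1) =
    z ^+ 3 * (lo Z 0 0 * lo Z 1 1 - lo Z 1 0 * lo Z 0 1) by ring.
  by rewrite !exprD !exprM !exprMn; ring.
- have -> : z * lo Z 0 0 * (z * lo Z 1 1) - z * lo Z 1 0 * (z * lo Z 0 1) =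
    z ^+ 2 * (lo Z 0 0 * lo Z 1 1 - lo Z 1 0 * lo Z 0 1) by ring.
  by rewrite !exprD !exprM !exprMn; ring.
Qed.

Lemma nplus_sp (A : 'M[C]_(n + n)) : nplus A -> A^T *m Jmx C n = - (Jmx C n *m A).
Proof.
move=> [X [S [-> _ ST]]]; rewrite /levi_mx /siegel_mx add_block_mx !add0r !addr0.
rewrite tr_block_mx /Jmx !mulmx_block !trmx0 ST opp_block_mx [(- X^T)^T]linearN/= trmxK.
by rewrite !(mul0mx, mulmx0, addr0, add0r, mul1mx, mulmxN, mulNmx, mulmx1,
     oppr0, opprK).
Qed.

Lemma lo_nplus (A : 'M[C]_(n + n)) Z : nplus A -> exists x, forall c,
  lo (A *m Z) 0 c = 0 /\ lo (A *m Z) 1 c = x * lo Z 0 c.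
Proof.
move=> [X [S [-> Xu _]]]; rewrite /levi_mx /siegel_mx add_block_mx !add0r !addr0.
have lE p (i : 'I_n) c : (dsubmx (block_mx X S p (- X^T) *m Z)) i c =
    (p *m usubmx Z) i c - \sum_k X k i * dsubmx Z k c.
  rewrite -{1}[Z]vsubmxK mul_block_col col_mxKd mulNmx mxE [X in _ + X]mxE.
  by congr (_ - _); rewrite mxE; apply: eq_bigr => k _; rewrite !mxE.
pose x : C := if insub 1%N is Some i then - X 0 (i : 'I_n) else 0.
exists x => c; split; rewrite /lo.
  case: insubP => // i _ /= i0; rewrite lE mul0mx mxE add0r big1 ?oppr0 // => k _.
  by rewrite Xu ?mul0r // i0.
rewrite /x; case: insubP => [i _ i1|_]; last by rewrite mul0r.
rewrite insubT /= lE mul0mx mxE add0r (bigD1 0)//= big1 ?addr0 => [|k k0].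
  by rewrite mulNr; congr (- (_ * dsubmx Z _ _)); apply: val_inj.
rewrite Xu ?mul0r // i1 lt0n; apply: contra_neq k0 => k0; exact: val_inj.
Qed.

Lemma omegaP_l (a : C) (X X' Y : 'cV[C]_(n + n)) :
  omega (X + a *: X') Y = omega X Y + a * omega X' Y.
Proof.
by rewrite !omegaE linearD linearZ /= !mulmxDl -!scalemxAl mxE [X in _ + X]mxE.
Qed.

Lemma omegaP_r (a : C) (X Y Y' : 'cV[C]_(n + n)) :
  omega X (Y + a *: Y') = omega X Y + a * omega X Y'.
Proof.
by rewrite !omegaE !mulmxDr -!scalemxAr mxE [X in _ + X]mxE.
Qed.

(** The term linear in t cancels because A lies in the symplectic Lie algebra. *)
Lemma om_nplus (A : 'M[C]_(n + n)) Z t : nplus A ->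
  om (Z + t *: (A *m Z)) = om Z + t ^+ 2 * omega (A *m col 0 Z) (A *m col 1 Z).
Proof.
move=> /nplus_sp AJ; rewrite /om !linearD !linearZ /= !colE -!mulmxA -!colE.
rewrite omegaP_l !omegaP_r.
have -> : omega (A *m col 0 Z) (col 1 Z) = - omega (col 0 Z) (A *m col 1 Z).
  rewrite !omegaE trmx_mul -(mulmxA _ A^T) AJ mulmxN mulNmx mxE.
  by rewrite !mulmxA.
ring.
Qed.

(** Along Z + tAZ the first lower row is constant and the second one changes by a multiple of it, so
    the minor is constant too, and omega has no linear term in t. Hence neither has the product. *)
Lemma hwv_hw i j k s : hw (hwv i j k s).
Proof.
move=> A nA Z; have [x lx] := lo_nplus Z nA.
set w := omega (A *m col 0 Z) (A *m col 1 Z).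
pose p : {poly C} := (lo Z 0 0 ^+ i * lo Z 0 1 ^+ j * mi Z ^+ k)%:P *
  ((om Z)%:P + w%:P * 'X^2) ^+ s.
rewrite (@derE _ _ _ _ _ _ p) => [|t]; last first.
  rewrite /hwv /mi om_nplus // !lo_lin !((lx _).1, (lx _).2) !mulr0 !addr0.
  have -> : lo Z 0 0 * (lo Z 1 1 + t * (x * lo Z 0 1)) -
    (lo Z 1 0 + t * (x * lo Z 0 0)) * lo Z 0 1 = mi Z by rewrite /mi; ring.
  by rewrite /p hornerM horner_exp !hornerC hornerD hornerM !hornerC hornerXn mulrC
    [w * _]mulrC mulrC.
have -> : p`_1 = p^`()`_0 by rewrite coef_deriv mulr1n.
rewrite -horner_coef0 /p derivM derivC mul0r add0r deriv_exp derivD derivC add0r.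
rewrite derivM derivC mul0r add0r derivXn hornerM hornerMn hornerM [_.[0] in X in _ * X]hornerM.
by rewrite hornerMn hornerXn expr0n /= mul0rn mulr0 mul0r mul0rn mulr0.
Qed.

Lemma lo_sl al al' x y c : (lo (sl n' al al' x y) 0 c = if c == 0 then al else al') *
  (lo (sl n' al al' x y) 1 c = if c == 0 then 0 else if (1 < n)%N then y else 0).
Proof.
split; rewrite /lo.
  rewrite insubT /= col_mxKd mxE /=.
  by case: ifP; rewrite ?mulr1n ?mulr0n ?addr0.
case: insubP => [i n1 i1|/negbTE ->]; last by rewrite if_same.
rewrite n1 col_mxKd mxE i1 /=.
by case: ifP; rewrite ?mulr1n ?mulr0n ?add0r.
Qed.

Lemma om_sl al al' x y : om (sl n' al al' x y) = al * x.
Proof.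
rewrite /om /omega /pairing.
rewrite [X in _ - X]big1 => [|k _]; last first.
  by rewrite [usubmx _ _ _]mxE [col _ _ _ _]mxE col_mxEu mxE /= andbF mulr0n mul0r.
rewrite subr0 (bigD1 0)//= big1 ?addr0 => [|k k0].
  by rewrite [usubmx _ _ _]mxE [dsubmx _ _ _]mxE ![col _ _ _ _]mxE col_mxEu col_mxEd !mxE /= !mulr1n.
rewrite [dsubmx _ _ _]mxE [col _ _ _ _]mxE col_mxEd mxE /=.
have -> : (val k == 0%N) = false by apply: contraNF k0 => /eqP k0; apply/eqP/val_inj.
by rewrite mulr0n mul0r.
Qed.

Lemma hwv_sl i j k s : (if (1 < n)%N then true else k == 0%N) ->
  hwv i j k s (sl n' 1 1 1 1) = 1.
Proof.
rewrite /hwv /mi !lo_sl om_sl /=; case: ltnP => [_ _|_ /eqP ->].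
  by rewrite !mulr1 subr0 !expr1n !mulr1.
by rewrite expr0 !mulr1 !expr1n !mulr1.
Qed.

(* On Z = (U, V) this acts by (U, V) |-> (U + t V, V). *)
Definition sh (t : C) : 'M[C]_2 := 1%:M + t *: delta_mx 1 0.

(** The shear acts on the right, so it commutes with the group and the bound cuts out a stable
    subspace. *)
Definition degT i F := forall Z, exists p : {poly C}, (size p <= i.+1)%N /\
  forall t, F (Z *m sh t) = p.[t].

Lemma mul_sh Z t i : ((Z *m sh t) i 0 = Z i 0 + t * Z i 1) *
  ((Z *m sh t) i 1 = Z i 1).
Proof.
rewrite /sh mulmxDr mulmx1 -scalemxAr.
have h c : (Z *m (delta_mx 1 0 : 'M[C]_2)) i c = if c == 0 then Z i 1 else 0.
  rewrite mxE big_ord_recl big_ord1 !mxE /=.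
  have -> : lift ord0 (ord0 : 'I_1) = 1 :> 'I_2 by apply: val_inj.
  rewrite mulr0 add0r; case: (c == 0); by rewrite ?mulr1 ?mulr0.
by split; rewrite mxE [X in _ + X]mxE h /= ?mulr0 ?addr0.
Qed.

Lemma hwv_sh i j k s Z t : hwv i j k s (Z *m sh t) =
  (lo Z 0 0 + t * lo Z 0 1) ^+ i * lo Z 0 1 ^+ j * mi Z ^+ k * om Z ^+ s.
Proof.
have l p : (lo (Z *m sh t) p 0 = lo Z p 0 + t * lo Z p 1) *
    (lo (Z *m sh t) p 1 = lo Z p 1).
  by split; rewrite /lo; case: insubP => [q _ _|_];
    rewrite ?mulr0 ?addr0 // ![dsubmx _ _ _]mxE mul_sh.
rewrite /hwv /mi !l; congr (_ * _ ^+ _ * _ ^+ _); first by ring.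
rewrite !omE; apply: eq_bigr => q _; rewrite !mul_sh; ring.
Qed.

Lemma hwv_degT i j k s : degT i (hwv i j k s).
Proof.
move=> Z; exists ((lo Z 0 1 ^+ j * mi Z ^+ k * om Z ^+ s) *:
  ((lo Z 0 0)%:P + (lo Z 0 1)%:P * 'X) ^+ i); split=> [|t]; last first.
  rewrite hwv_sh hornerZ horner_exp hornerD hornerM !hornerC hornerX mulrC -!mulrA.
  by rewrite [t * _]mulrC; ring.
apply: (leq_trans (size_scale_leq _ _)).
apply: (leq_trans (size_poly_exp_leq _ _)); rewrite ltnS.
set q := _ + _; have : (size q <= 2)%N.
  rewrite /q (leq_trans (size_polyD _ _))// geq_max (leq_trans (size_polyC_leq1 _))//=.
  by rewrite mul_polyC (leq_trans (size_scale_leq _ _)) ?size_polyX.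
by case: (size q) => [|[|[|]]] //= _; rewrite ?mul0n ?mul1n.
Qed.

(** Sheared from the base point, the function is c(1 + t)^i, of degree exactly i. *)
Lemma hwv_degT_le i j k s i' c : c != 0 -> (if (1 < n)%N then true else k == 0%N) ->
  degT i' (fun Z => c * hwv i j k s Z) -> (i <= i')%N.
Proof.
move=> c0 k0 /(_ (sl n' 1 1 1 1)) [p [sz ev]].
have pE : p = c *: ('X + 1%:P) ^+ i.
  apply: (poly_eq_seq (@natr_inj C)) => m; rewrite -ev hwv_sh !lo_sl om_sl /= !mulr1.
  rewrite hornerZ horner_exp hornerD hornerX hornerC !expr1n !mulr1 addrC; congr (_ * _).
  rewrite -[RHS]mulr1; congr (_ * _).
  have := hwv_sl 0 0 0 k0; rewrite /hwv /mi !lo_sl om_sl /=.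
  by set b := (_ - _) ^+ k; rewrite !expr0 !mul1r !mulr1.
have := size_exp ('X + 1%:P : {poly C}) i; rewrite size_XaddC mul1n.
by move: sz; rewrite pE size_scale // => + <-; case: (size _).
Qed.

End HighestWeightVectors.

(** * Invariance of the sphere integral *)

Section IteratedIntegral.
Variable R : realType.
Local Open Scope ereal_scope.
Local Notation mu := (@lebesgue_measure R).

(** The integral of a nonnegative function is a supremum over the simple functions below it, so
    comparison makes sense for arbitrary functions, as in the box estimates. *)
Lemma ge0_le_integralT d (T : measurableType d) (m : {measure set T -> \bar R})
    (f g : T -> \bar R) : (forall x, 0 <= f x) -> (forall x, f x <= g x) ->
  \int[m]_x f x <= \int[m]_x g x.
Proof.
move=> f0 fg; have g0 x : 0 <= g x by apply: le_trans (fg x).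
rewrite !ge0_integralTE //; apply: ereal_sup_le => _ [h hf <-]; exists h => //= x.
exact: le_trans (fg x).
Qed.

Lemma iter_integral_ge0 m (F : 'rV[R]_m -> \bar R) : (forall x, 0 <= F x) ->
  0 <= iter_integral F.
Proof.
elim: m F => [F F0|m IH F F0]; first exact: F0.
by apply: integral_ge0 => x _; apply: IH.
Qed.

Lemma eq_iter_integral m (F G : 'rV[R]_m -> \bar R) : F =1 G ->
  iter_integral F = iter_integral G.
Proof. by move=> /funext ->. Qed.

Lemma iter_integral0 m : iter_integral (fun _ : 'rV[R]_m => 0) = 0.
Proof.
elim: m => //= m IH; under eq_integral do rewrite IH.
exact: integral0.
Qed.

Lemma row_cons0 m (x : R) (v : 'rV[R]_m) :
  (row_mx (x%:M : 'rV_1) v : 'rV_m.+1) ord0 ord0 = x.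
Proof.
rewrite (_ : ord0 = lshift m (ord0 : 'I_1) :> 'I_(1 + m)); last exact: val_inj.
by rewrite [LHS]row_mxEl mxE eqxx mulr1n.
Qed.

Lemma row_consS m (x : R) (v : 'rV[R]_m) i :
  (row_mx (x%:M : 'rV_1) v : 'rV_m.+1) ord0 (lift ord0 i) = v ord0 i.
Proof.
rewrite (_ : lift ord0 i = rshift 1 i :> 'I_(1 + m)); last exact: val_inj.
exact: row_mxEr.
Qed.

(** A crude estimate that yields finiteness, as the next one yields positivity, of the ball volume
    and of sphere integrals, whose exact values never matter. *)
Lemma iter_integral_le_box m (c : R) (F : 'rV[R]_m -> \bar R) : (0 <= c)%R ->
  (forall x, 0 <= F x) -> (forall x, F x <= c%:E) ->
  (forall (x : 'rV[R]_m) i, (1 < `|x ord0 i|)%R -> F x = 0) ->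
  iter_integral F <= (c * 2 ^+ m)%:E.
Proof.
elim: m c F => [c F c0 F0 Fc _|m IH c F c0 F0 Fc Fb].
  by rewrite expr0 mulr1; apply: Fc.
pose D := `[(-1)%R, 1%R]%classic : set R.
have k0 : (0 <= c * 2 ^+ m)%R by rewrite mulr_ge0 // exprn_ge0.
apply: (@le_trans _ _ (\int[mu]_x (((fun=> (c * 2 ^+ m)%:E) : R -> \bar R) \_ D) x)).
  apply: ge0_le_integralT => x; first by apply: iter_integral_ge0.
  rewrite [leLHS](_ : _ = iter_integral (fun v => F (row_mx (x%:M : 'rV_1) v))) //.
  rewrite patchE; case: ifPn => xD.
    apply: IH => // v i vi; apply: (Fb _ (lift ord0 i)).
    by rewrite row_consS.
  have -> : (fun v : 'rV_m => F (row_mx (x%:M : 'rV_1) v)) = fun=> 0; last first.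
    by rewrite iter_integral0.
  apply/funext => v.
  apply: (Fb _ ord0); rewrite row_cons0.
  move: xD; rewrite notin_setE /D /= in_itv /= => /negP.
  by rewrite -ler_norml -ltNge.
rewrite -integral_mkcond integral_cst; last exact: measurable_itv.
rewrite /= /D lebesgue_measure_itv /= lte_fin (_ : (-1 < 1)%R); last by rewrite ltrN10 || lra.
rewrite -EFinB -EFinM lee_fin exprSr mulrA opprK.
by rewrite (_ : (1 + 1 = 2)%R).
Qed.

Lemma iter_integral_ge_box m (c eta : R) (x0 : 'rV[R]_m) (F : 'rV[R]_m -> \bar R) :
  (0 <= c)%R -> (0 < eta)%R -> (forall x, 0 <= F x) ->
  (forall x : 'rV[R]_m, (forall i, `|x ord0 i - x0 ord0 i| < eta)%R -> c%:E <= F x) ->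
  (c * (2 * eta) ^+ m)%:E <= iter_integral F.
Proof.
elim: m c x0 F => [c x0 F c0 e0 F0 Fc|m IH c x0 F c0 e0 F0 Fc].
  by rewrite expr0 mulr1; apply: Fc => -[].
have k0 : (0 <= c * (2 * eta) ^+ m)%R.
  by rewrite mulr_ge0 // exprn_ge0 // mulr_ge0 // ltW.
pose a : R := x0 ord0 ord0.
pose D := `](a - eta)%R, (a + eta)%R[%classic : set R.
apply: (@le_trans _ _
  (\int[mu]_x (((fun=> (c * (2 * eta) ^+ m)%:E) : R -> \bar R) \_ D) x)); last first.
  apply: ge0_le_integralT => x; first by rewrite patchE; case: ifP.
  rewrite patchE; case: ifPn => xD; last exact: iter_integral_ge0.
  apply: (IH _ (\row_i x0 ord0 (lift ord0 i))) => // v vi; apply: Fc => i.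
  case: (unliftP ord0 i) => [j|] ->; last first.
    by rewrite row_cons0 -/a; move: xD; rewrite inE /D /= in_itv /= ltr_distl.
  by rewrite row_consS; have := vi j; rewrite mxE.
rewrite -integral_mkcond integral_cst; last exact: measurable_itv.
rewrite /= /D lebesgue_measure_itv /= lte_fin (_ : (a - eta < a + eta)%R); last by lra.
rewrite -EFinB -EFinM lee_fin exprSr mulrA ler_wpM2l //; lra.
Qed.

(** Measurability is tested on all measurable families of coordinate functions, with a parameter in
    S carried along. In this form passing to sections and to linear substitutions is composition. *)
Definition jmeas d0 (S : measurableType d0) m (G : S -> 'rV[R]_m -> \bar R) :=
  forall d (T : measurableType d) (psi : T -> S) (phi : 'I_m -> T -> R),
    measurable_fun setT psi -> (forall i, measurable_fun setT (phi i)) ->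
    measurable_fun setT (fun t => G (psi t) (\row_i phi i t)).

Definition bmeas m (F : 'rV[R]_m -> \bar R) :=
  forall d (T : measurableType d) (phi : 'I_m -> T -> R),
    (forall i, measurable_fun setT (phi i)) ->
    measurable_fun setT (fun t => F (\row_i phi i t)).

Lemma row_mx_row m (x : R) (phi : 'I_m -> R) :
  row_mx (x%:M : 'rV_1) (\row_i phi i) =
  \row_(i < 1 + m) match fintype.split i with inl _ => x | inr j => phi j end.
Proof.
apply/rowP => i; rewrite !mxE; case: splitP => j _; rewrite mxE //.
by rewrite ord1 eqxx mulr1n.
Qed.

Lemma jmeas_cons d0 (S : measurableType d0) m (G : S -> 'rV[R]_m.+1 -> \bar R) :
  jmeas G -> jmeas (fun (sx : S * (measurableTypeR R)) (v : 'rV[R]_m) =>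
    G sx.1 (row_mx (sx.2%:M : 'rV_1) v)).
Proof.
move=> mG d T psi phi mpsi mphi.
pose phi' (i : 'I_(1 + m)) t : R :=
  match fintype.split i with inl _ => (psi t).2 | inr j => phi j t end.
have := mG d T (fst \o psi) phi'.
rewrite (_ : (fun t => _) = (fun t => G (psi t).1 (row_mx ((psi t).2%:M : 'rV_1) (\row_i phi i t)))).
  apply; first exact: measurableT_comp.
  move=> i; rewrite /phi'; case: (fintype.split (i : 'I_(1 + m))) => j; last exact: mphi.
  exact: measurableT_comp.
by apply/funext => t /=; rewrite row_mx_row.
Qed.

Lemma measurable_iter_integral d0 (S : measurableType d0) m
    (G : S -> 'rV[R]_m -> \bar R) : jmeas G -> (forall s x, 0 <= G s x) ->
  measurable_fun setT (fun s => iter_integral (G s)).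
Proof.
elim: m d0 S G => [|m IH] d0 S G mG G0 /=.
  have := mG _ S id (fun _ _ => 0%R) (@measurable_id _ _ _) (fun _ => measurable_cst _).
  by rewrite (_ : \row__ 0%R = 0%R) //; apply/rowP => -[].
have := IH _ _ _ (jmeas_cons mG) (fun sx v => G0 _ _).
move=> mH; apply: (measurable_fun_fubini_tonelli_F (m2 := mu) _ mH) => sx.
exact: iter_integral_ge0.
Qed.

(** Tonelli's theorem in two variables, used to move the outer integral past the coordinates one by
    one. *)
Lemma iter_integral_swap m (G : measurableTypeR R -> 'rV[R]_m -> \bar R) :
  jmeas G -> (forall s x, 0 <= G s x) ->
  \int[mu]_x iter_integral (G x) = iter_integral (fun v => \int[mu]_x G x v).
Proof.
elim: m G => [//|m IH G mG G0] /=.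
have mH := measurable_iter_integral (jmeas_cons mG) (fun sx v => G0 _ _).
rewrite (fubini_tonelli (m1 := mu) (m2 := mu) _ mH); last first.
  by move=> sx; apply: iter_integral_ge0.
apply: eq_integral => y _; rewrite /fubini_G /= IH // => d T psi phi mpsi mphi.
by apply: (jmeas_cons mG (psi := fun t => (psi t, y))) => //; apply: measurable_fun_pair.
Qed.

End IteratedIntegral.

(** * Linear change of variables for iterated Lebesgue integrals *)

Section LinearChangeOfVariables.
Variable R : realType.
Local Open Scope ereal_scope.
Local Notation mu := (@lebesgue_measure R).
Local Notation RR := (measurableTypeR R).

Lemma measurable_affine (a c : R) :
  measurable_fun setT (fun x : RR => (a * x + c)%R : RR).
Proof.
apply: measurable_funD; last exact: measurable_cst.
by apply: measurable_funM; [exact: measurable_cst|exact: measurable_id].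
Qed.

Lemma preimage_affine (a c u v : R) : a != 0%R ->
  (fun x : R => (a * x + c)%R) @^-1` `]u, v]%classic =
  if (0 < a)%R then `](u - c) / a, (v - c) / a]%classic%R
  else `[(v - c) / a, (u - c) / a[%classic%R.
Proof.
move=> a0; apply/seteqP; split=> x /=; rewrite in_itv /=.
  case: ifPn => [a_gt0|a_le0]; rewrite /= in_itv /=.
    by rewrite ltr_pdivrMr // ler_pdivlMr // ltrBlDr lerBrDr (mulrC x).
  have a_lt0 : (a < 0)%R by rewrite lt_neqAle a0 leNgt.
  by rewrite ltr_ndivlMr // ler_ndivrMr // ltrBlDr lerBrDr (mulrC x) andbC.
case: ifPn => [a_gt0|a_le0]; rewrite /= in_itv /=.
  by rewrite ltr_pdivrMr // ler_pdivlMr // ltrBlDr lerBrDr (mulrC x).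
have a_lt0 : (a < 0)%R by rewrite lt_neqAle a0 leNgt.
by rewrite ltr_ndivlMr // ler_ndivrMr // ltrBlDr lerBrDr (mulrC x) andbC.
Qed.

(** By uniqueness of Lebesgue measure: |a| times the pushforward gives half-open intervals their
    length. *)
Lemma lebesgue_affine (a c : R) : a != 0%R -> forall A : set RR, measurable A ->
  lebesgue_measure ((fun x : RR => (a * x + c)%R : RR) @^-1` A) =
  (`|a|^-1)%:E * lebesgue_measure A.
Proof.
move=> a0 A mA.
have na : (0 <= `|a|)%R by [].
have na0 : (`|a| != 0)%R by rewrite normr_eq0.
pose mpf : {measure set RR -> \bar R} :=
  measure_function_pushforward__canonical__measure_function_Measure
    mu (measurable_affine a c).
pose nu : {measure set RR -> \bar R} := mscale (NngNum na) mpf.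
have -> : lebesgue_measure A = nu A; last first.
  by rewrite /nu /mscale /= muleA -EFinM mulVf // mul1e.
apply: lebesgue_measure_unique => // X [[u v] _ <-].
change (lebesgue_measure (`]u, v]%classic : set R) = `|a|%:E * lebesgue_measure
  ((fun x : R => (a * x + c)%R) @^-1` `]u, v]%classic)).
rewrite preimage_affine //; case: ifPn => [a_gt0|a_le0].
  rewrite !lebesgue_measure_itv /= !lte_fin ltr_pM2r ?invr_gt0 // ltrD2r.
  case: ifP => _; last by rewrite mule0.
  rewrite -!EFinB -EFinM gtr0_norm //; congr (_%:E).
  by field.
have a_lt0 : (a < 0)%R by rewrite lt_neqAle a0 leNgt.
rewrite !lebesgue_measure_itv /= !lte_fin ltr_nM2r ?invr_lt0 // ltrD2r.
case: ifP => _; last by rewrite mule0.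
rewrite -!EFinB -EFinM ltr0_norm //; congr (_%:E).
by field.
Qed.

Lemma ge0_integral_affine (a c : R) (f : RR -> \bar R) : a != 0%R ->
  measurable_fun setT f -> (forall x, 0 <= f x) ->
  \int[mu]_x f (a * x + c)%R = (`|a|^-1)%:E * \int[mu]_x f x.
Proof.
move=> a0 mf f0.
have na : (0 <= `|a|^-1)%R by rewrite invr_ge0.
have [nu [nuE ->]] : exists nu : {measure set RR -> \bar R},
    (forall A, nu A = lebesgue_measure ((fun x : RR => (a * x + c)%R : RR) @^-1` A)) /\
    \int[mu]_x f (a * x + c)%R = \int[nu]_x f x.
  exists (measure_function_pushforward__canonical__measure_function_Measure
    mu (measurable_affine a c)); split=> //.
  by rewrite (ge0_integral_pushforward (measurable_affine a c)).
have := ge0_integral_mscale mu (@measurableT _ RR) (NngNum na) mf (fun x _ => f0 x).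
move=> /= <-; apply: eq_measure_integral => A mA _.
by rewrite nuE lebesgue_affine.
Qed.

Lemma bmeas_mul m p (A : 'M[R]_(m, p)) (F : 'rV[R]_p -> \bar R) :
  bmeas F -> bmeas (fun x => F (x *m A)).
Proof.
move=> mF d T phi mphi.
have := mF d T (fun j t => \sum_i phi i t * A i j)%R.
rewrite (_ : (fun t => _) = (fun t => F (\row_i phi i t *m A))); last first.
  apply/funext => t; congr F; apply/rowP => j; rewrite !mxE.
  by apply: eq_bigr => i _; rewrite mxE.
apply=> j; apply: measurable_sum => i.
by apply: measurable_funM.
Qed.

Lemma bmeas_cons m (F : 'rV[R]_m.+1 -> \bar R) : bmeas F ->
  jmeas (fun (x : RR) (v : 'rV[R]_m) => F (row_mx (x%:M : 'rV_1) v)).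
Proof.
move=> mF d T psi phi mpsi mphi.
pose phi' (i : 'I_(1 + m)) t : R :=
  match fintype.split i with inl _ => psi t | inr j => phi j t end.
have := mF d T phi'.
rewrite (_ : (fun t => _) = (fun t => F (row_mx ((psi t)%:M : 'rV_1) (\row_i phi i t)))).
  by apply => i; rewrite /phi'; case: (fintype.split (i : 'I_(1 + m))) => j.
by apply/funext => t /=; rewrite row_mx_row.
Qed.

Lemma jmeas_section d (T : measurableType d) m (G : T -> 'rV[R]_m -> \bar R) x :
  jmeas G -> bmeas (G x).
Proof. by move=> mG d' T' phi mphi; apply: (mG d' T' (fun=> x) phi). Qed.

Lemma jmeas_slice d (T : measurableType d) m (G : T -> 'rV[R]_m -> \bar R) v :
  jmeas G -> measurable_fun setT (G ^~ v).
Proof.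
move=> mG; have := mG d T id (fun i _ => v ord0 i) (@measurable_id _ _ _).
rewrite (_ : \row_i v ord0 i = v); first by apply.
by apply/rowP => i; rewrite mxE.
Qed.

Lemma iter_integral_translate m (w : 'rV[R]_m) (F : 'rV[R]_m -> \bar R) :
  bmeas F -> (forall x, 0 <= F x) ->
  iter_integral (fun x => F (x + w)%R) = iter_integral F.
Proof.
elim: m w F => [|m IH] w F mF F0 /=; first by congr F; apply/rowP => -[].
have mG := bmeas_cons mF.
have mI := measurable_iter_integral mG (fun x v => F0 _).
pose w1 : R := w ord0 ord0.
transitivity (\int[mu]_x iter_integral (fun v : 'rV_m =>
    F (row_mx ((1 * x + w1)%R%:M : 'rV_1) v))).
  apply: eq_integral => x _.
  pose w2 : 'rV[R]_m := \row_i w ord0 (lift ord0 i).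
  transitivity (iter_integral (fun v : 'rV_m =>
    F (row_mx ((1 * x + w1)%R%:M : 'rV_1) (v + w2)%R))); last first.
    apply: (IH w2 (fun v : 'rV_m => F (row_mx ((1 * x + w1)%R%:M : 'rV_1) v))) => [|v //].
    exact: (jmeas_section _ mG).
  apply: eq_iter_integral => v; congr F.
  apply/rowP => i; rewrite [LHS]mxE; case: (unliftP ord0 i) => [j|] ->.
    by rewrite !row_consS !mxE.
  by rewrite !row_cons0 mul1r.
rewrite (ge0_integral_affine w1 (oner_neq0 R) mI).
  by rewrite normr1 invr1 mul1e.
by move=> x; apply: iter_integral_ge0.
Qed.

(** The factor k is left unspecified instead of being computed as a determinant; for unitary
    matrices it is found by testing on the unit ball. *)
Definition cov_good m (A : 'M[R]_m) := exists2 k : R, (0 < k)%R &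
  forall F : 'rV[R]_m -> \bar R, bmeas F -> (forall x, 0 <= F x) ->
    iter_integral (fun x => F (x *m A)) = k%:E * iter_integral F.

Lemma cov_good_mul m (A B : 'M[R]_m) : cov_good A -> cov_good B -> cov_good (A *m B).
Proof.
move=> [k k0 kA] [l l0 lB]; exists (k * l)%R; first exact: mulr_gt0.
move=> F mF F0; rewrite EFinM -muleA -lB // -kA //; last exact: bmeas_mul.
by apply: eq_iter_integral => x; rewrite mulmxA.
Qed.

Lemma cov_good_inner m (u : 'rV[R]_m) :
  @cov_good (1 + m) (block_mx 1%:M u 0 1%:M).
Proof.
exists 1%R => // F mF F0; rewrite mul1e /=.
have mG := bmeas_cons mF.
apply: eq_integral => x _.
transitivity (iter_integral (fun v : 'rV_m => F (row_mx (x%:M : 'rV_1) (v + x *: u)%R))).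
  apply: eq_iter_integral => v; congr F.
  by rewrite mul_row_block !mulmx1 mulmx0 addr0 mul_scalar_mx addrC.
apply: (@iter_integral_translate m (x *: u)%R (fun v => F (row_mx _ v))) => [|v //].
exact: (jmeas_section _ mG).
Qed.

Lemma cov_good_outer m (l : 'cV[R]_m) :
  @cov_good (1 + m) (block_mx 1%:M 0 l 1%:M).
Proof.
exists 1%R => // F mF F0; rewrite mul1e /=.
have mG := bmeas_cons mF.
have mG' := bmeas_cons (bmeas_mul ((block_mx 1%:M 0 l 1%:M) : 'M[R]_(1 + m)) mF).
rewrite (iter_integral_swap mG') // (iter_integral_swap mG) //.
apply: eq_iter_integral => v.
pose c : R := (v *m l) ord0 ord0.
transitivity (\int[mu]_x F (row_mx ((1 * x + c)%R%:M : 'rV_1) v)).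
  apply: eq_integral => x _; congr F.
  rewrite mul_row_block !mulmx1 mulmx0 add0r mul1r; congr (row_mx _ _).
  by apply/rowP => i; rewrite ord1 mxE [X in (X + _)%R]mxE [RHS]mxE eqxx !mulr1n.
rewrite (ge0_integral_affine c (oner_neq0 R) (jmeas_slice v mG)) //.
by rewrite normr1 invr1 mul1e.
Qed.

Lemma cov_good_diag m (a : R) (S : 'M[R]_m) : a != 0%R -> cov_good S ->
  @cov_good (1 + m) (block_mx a%:M 0 0 S).
Proof.
move=> a0 [k k0 kS]; exists (k * `|a|^-1)%R.
  by rewrite mulr_gt0 // invr_gt0 normr_gt0.
move=> F mF F0 /=; have mG := bmeas_cons mF.
have mI := measurable_iter_integral mG (fun x v => F0 _).
transitivity (\int[mu]_x (k%:E * iter_integral (fun v : 'rV_m =>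
    F (row_mx ((a * x + 0)%R%:M : 'rV_1) v)))).
  apply: eq_integral => x _; rewrite -kS; last by move=> v; apply: F0.
    apply: eq_iter_integral => v; congr F.
    rewrite mul_row_block !mulmx0 add0r addr0; congr (row_mx _ _).
    by rewrite addr0 mul_scalar_mx scale_scalar_mx mulrC.
  exact: (jmeas_section _ mG).
rewrite ge0_integralZl //; first last.
- by rewrite lee_fin ltW.
- by move=> x _; apply: iter_integral_ge0.
- exact: (measurableT_comp mI (measurable_affine a 0)).
rewrite (ge0_integral_affine 0 a0 mI); last by move=> x; apply: iter_integral_ge0.
by rewrite muleA -EFinM.
Qed.

(** Gaussian elimination: a matrix with nonzero corner entry is a lower shear times a block diagonal
    matrix times an upper shear, and induction handles the Schur complement. *)
Lemma cov_unit m (A : 'M[R]_m) : A \in unitmx -> cov_good A.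
Proof.
elim: m A => [|m IH] A uA.
  exists 1%R => // F mF F0 /=; rewrite mul1e; congr F; by apply/rowP => -[].
have key (B : 'M[R]_(1 + m)) : B \in unitmx -> ulsubmx B ord0 ord0 != 0%R -> cov_good B.
  move=> uB; set a := ulsubmx B ord0 ord0 => a0.
  have aE : ulsubmx B = a%:M by apply/matrixP => i j; rewrite !ord1 [RHS]mxE eqxx mulr1n.
  pose u := (a^-1 *: ursubmx B)%R; pose l := (a^-1 *: dlsubmx B)%R.
  pose S := (drsubmx B - l *m ursubmx B)%R.
  have BE : B = (block_mx 1%:M 0 l 1%:M : 'M[R]_(1 + m)) *m
      ((block_mx a%:M 0 0 S : 'M[R]_(1 + m)) *m (block_mx 1%:M u 0 1%:M : 'M[R]_(1 + m))).
    rewrite !mulmx_block !(mul0mx, mulmx0, mulmx1, mul1mx, addr0, add0r).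
    rewrite -[LHS](@submxK _ 1 m 1 m) aE; congr block_mx.
    - by rewrite mul_scalar_mx /u scalerA mulfV // scale1r.
    - by rewrite mul_mx_scalar /l scalerA mulfV // scale1r.
    - by rewrite mul_scalar_mx /u scalerA mulfV // scale1r /S addrC subrK.
  have uS : S \in unitmx.
    move: uB; rewrite BE !unitmx_mul => /andP [_ /andP [+ _]].
    by rewrite !unitmxE det_lblock unitrM => /andP [].
  rewrite BE; apply: cov_good_mul; first exact: cov_good_outer.
  by apply: cov_good_mul; [apply: cov_good_diag => //; apply: IH|apply: cov_good_inner].
have [a0|] := eqVneq (ulsubmx (A : 'M[R]_(1 + m)) ord0 ord0) 0%R; last exact: key.
(* A zero corner is repaired by adding to the first column another column whose entry in the first
   row is nonzero. *)
have [j uj] : exists j, ursubmx (A : 'M[R]_(1 + m)) ord0 j != 0%R.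
  apply: contrapT => /forallNP h.
  have r0 : row ord0 A = 0%R.
    apply/rowP => i; rewrite !mxE; case: (unliftP ord0 i) => [j|] ->.
      have := h j; rewrite !mxE => /negP/negPn/eqP => <-; congr (A _ _); exact: val_inj.
    by move: a0; rewrite !mxE => <-; congr (A _ _); exact: val_inj.
  have : delta_mx ord0 ord0 *m A = 0%R :> 'rV_m.+1 by rewrite -rowE.
  move=> /(congr1 (fun x => x *m invmx A)); rewrite mulmxK // mul0mx.
  by move=> /rowP /(_ ord0) /eqP; rewrite !mxE !eqxx oner_eq0.
pose l : 'cV[R]_m := delta_mx j ord0.
pose L (s : R) : 'M[R]_(1 + m) := block_mx 1%:M 0 (s *: l)%R 1%:M.
have LL : L 1%R *m L (-1)%R = 1%:M.
  rewrite /L mulmx_block !(mul0mx, mulmx0, mulmx1, mul1mx, addr0, add0r).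
  by rewrite scale1r scaleN1r addrN -scalar_mx_block.
have [uL _] := mulmx1_unit LL.
have -> : A = (A *m L 1%R) *m L (-1)%R by rewrite -mulmxA LL mulmx1.
apply: cov_good_mul; last exact: cov_good_outer.
apply: key; first by rewrite unitmx_mul uA.
have H (B : 'M[R]_(1 + m)) : ulsubmx (B *m L 1%R) = (ulsubmx B + ursubmx B *m l)%R.
  by rewrite -{1}[B]submxK /L mulmx_block block_mxKul mulmx1 scale1r.
rewrite (H A) mxE a0 add0r.
by rewrite -colE mxE.
Qed.

End LinearChangeOfVariables.

(** * Sphere integrals: invariance, bounds and positivity *)

Section SphereIntegral.
Variable R : realType.
Local Notation C := R[i].
Local Open Scope sesquilinear_scope.

Definition nrm2 N (X : 'cV[C]_N) : R :=
  \sum_k (complex.Re (X k 0) ^+ 2 + complex.Im (X k 0) ^+ 2).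

Lemma ReM (x y : C) : complex.Re (x * y) =
  complex.Re x * complex.Re y - complex.Im x * complex.Im y.
Proof. by case: x y => [a b] [c d]. Qed.

Lemma ImM (x y : C) : complex.Im (x * y) =
  complex.Re x * complex.Im y + complex.Im x * complex.Re y.
Proof. by case: x y => [a b] [c d]. Qed.

Lemma ReD (x y : C) : complex.Re (x + y) = complex.Re x + complex.Re y.
Proof. by case: x y => [a b] [c d]. Qed.

Lemma ImD (x y : C) : complex.Im (x + y) = complex.Im x + complex.Im y.
Proof. by case: x y => [a b] [c d]. Qed.

Lemma ReJ (x : C) : complex.Re (x^*) = complex.Re x.
Proof. by case: x => [a b]. Qed.

Lemma ImJ (x : C) : complex.Im (x^*) = - complex.Im x.
Proof. by case: x => [a b]. Qed.

Lemma complex_ext (x y : C) : complex.Re x = complex.Re y ->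
  complex.Im x = complex.Im y -> x = y.
Proof. by case: x y => [a b] [c d] /= -> ->. Qed.

Lemma Re_sum I (s : seq I) (F : I -> C) :
  complex.Re (\sum_(i <- s) F i) = \sum_(i <- s) complex.Re (F i).
Proof. by elim/big_rec2: _ => // i x y _; rewrite ReD => ->. Qed.

Lemma Im_sum I (s : seq I) (F : I -> C) :
  complex.Im (\sum_(i <- s) F i) = \sum_(i <- s) complex.Im (F i).
Proof. by elim/big_rec2: _ => // i x y _; rewrite ImD => ->. Qed.

Lemma Re_normc_sqr (x : C) : complex.Re `|x| ^+ 2 =
  complex.Re x ^+ 2 + complex.Im x ^+ 2.
Proof. by rewrite normc_def /= sqr_sqrtr // addr_ge0 ?sqr_ge0. Qed.

Lemma nrm2E N (X : 'cV[C]_N) : (nrm2 X)%:C%C = (X^t* *m X) 0 0.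
Proof.
rewrite mxE; apply: complex_ext; rewrite /= ?Re_sum ?Im_sum.
  apply: eq_bigr => k _; rewrite !mxE ReM ReJ ImJ; ring.
rewrite big1 // => k _; rewrite !mxE ImM ReJ ImJ; ring.
Qed.

Lemma nrm2_ge0 N (X : 'cV[C]_N) : 0 <= nrm2 X.
Proof. by apply: sumr_ge0 => k _; rewrite addr_ge0 ?sqr_ge0. Qed.

Lemma nrm2_unitary N (g : 'M[C]_N) X : g \is unitarymx -> nrm2 (g *m X) = nrm2 X.
Proof.
move=> gU; suff : (nrm2 (g *m X))%:C%C = (nrm2 X)%:C%C by case.
rewrite !nrm2E trmx_mul map_mxM -mulmxA (mulmxA _ g).
by rewrite -(invmx_unitary gU) mulVmx ?unitarymx_unit // mul1mx.
Qed.

Definition re_coords N (X : 'cV[C]_N) : 'rV[R]_(N + N) :=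
  row_mx (\row_k complex.Re (X k 0)) (\row_k complex.Im (X k 0)).

Lemma of_real_coordsK N : cancel (@of_real_coords R N) (@re_coords N).
Proof.
move=> x; rewrite /re_coords -[RHS]hsubmxK; congr row_mx;
  by apply/rowP => k; rewrite !mxE.
Qed.

Lemma re_coordsK N : cancel (@re_coords N) (@of_real_coords R N).
Proof.
move=> X; apply/colP => k; rewrite mxE /re_coords row_mxKl row_mxKr !mxE.
by case: (X k 0).
Qed.

Lemma of_real_coordsZ N (a : R) (x : 'rV[R]_(N + N)) :
  of_real_coords (a *: x) = a%:C%C *: of_real_coords x.
Proof.
apply/colP => k; rewrite !mxE; apply: complex_ext; rewrite ?ReM ?ImM /=; ring.
Qed.

Lemma euclid_normE N (x : 'rV[R]_(N + N)) :
  euclid_norm x = Num.sqrt (nrm2 (of_real_coords x)).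
Proof.
rewrite /euclid_norm /nrm2 big_split_ord [in RHS]big_split /=.
by congr (Num.sqrt (_ + _)); apply: eq_bigr => k _; rewrite !mxE.
Qed.

Lemma euclid_normZ m (a : R) (x : 'rV[R]_m) : 0 <= a ->
  euclid_norm (a *: x) = a * euclid_norm x.
Proof.
move=> a0; rewrite /euclid_norm.
under eq_bigr do rewrite mxE exprMn.
by rewrite -mulr_sumr sqrtrM ?sqr_ge0 // sqrtr_sqr ger0_norm.
Qed.

Lemma le_coord_euclid_norm m (x : 'rV[R]_m) i : `|x ord0 i| <= euclid_norm x.
Proof.
rewrite -sqrtr_sqr ler_sqrt ?sumr_ge0 // => [|j _]; last exact: sqr_ge0.
rewrite (bigD1 i)//= lerDl sumr_ge0 // => j _; exact: sqr_ge0.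
Qed.

Lemma euclid_norm_eq0 m (x : 'rV[R]_m) : (euclid_norm x == 0) = (x == 0).
Proof.
apply/idP/eqP => [/eqP x0|->]; last first.
  by rewrite /euclid_norm big1 ?sqrtr0 // => i _; rewrite mxE expr0n.
apply/rowP => i; rewrite mxE; apply/eqP; rewrite -normr_eq0 eq_le normr_ge0 andbT.
by rewrite -x0 le_coord_euclid_norm.
Qed.

Lemma euclid_norm_ge0 m (x : 'rV[R]_m) : 0 <= euclid_norm x.
Proof. exact: sqrtr_ge0. Qed.

Lemma euclid_norm_normalized m (x : 'rV[R]_m) : x != 0 ->
  euclid_norm ((euclid_norm x)^-1 *: x) = 1.
Proof.
move=> x0; rewrite euclid_normZ ?invr_ge0 ?euclid_norm_ge0 // mulVf //.
by rewrite euclid_norm_eq0.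
Qed.

Lemma of_real_coords_eq0 N (x : 'rV[R]_(N + N)) : (of_real_coords x == 0) = (x == 0).
Proof.
apply/eqP/eqP => [x0|->]; last by apply/colP => k; rewrite !mxE.
rewrite -[x]of_real_coordsK x0 /re_coords; apply/rowP => k; rewrite !mxE.
by case: splitP => j _; rewrite !mxE.
Qed.

(** Real coordinates are row vectors, so left multiplication by g becomes right multiplication by
    the real form of its transpose. *)
Definition real_mx N (g : 'M[C]_N) : 'M[R]_(N + N) :=
  let P := map_mx (@complex.Re R) g^T in let Q := map_mx (@complex.Im R) g^T in
  block_mx P Q (- Q) P.

Lemma real_mxE N (g : 'M[C]_N) x :
  of_real_coords (x *m real_mx g) = g *m of_real_coords x.
Proof.
rewrite /real_mx /= -{1}[x]hsubmxK mul_row_block; apply/colP => k.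
rewrite mxE row_mxKl row_mxKr; apply: complex_ext; rewrite /= !mxE.
  rewrite Re_sum -big_split; apply: eq_bigr => j _.
  by rewrite !mxE ReM /=; ring.
rewrite Im_sum -big_split; apply: eq_bigr => j _.
by rewrite !mxE ImM /=; ring.
Qed.

Lemma real_mx_unit N (g : 'M[C]_N) : g \in unitmx -> real_mx g \in unitmx.
Proof.
move=> gU; suff : real_mx g *m real_mx (invmx g) = 1%:M by move=> /mulmx1_unit [].
apply/row_matrixP => i; rewrite !rowE mulmx1.
apply: (can_inj (@of_real_coordsK N)).
by rewrite mulmxA !real_mxE mulKmx.
Qed.

Lemma euclid_norm_unitary N (g : 'M[C]_N) x : g \is unitarymx ->
  euclid_norm (x *m real_mx g) = euclid_norm x.
Proof. by move=> gU; rewrite !euclid_normE real_mxE nrm2_unitary. Qed.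

Definition ball_fun N (h : 'cV[C]_N -> R) (x : 'rV[R]_(N + N)) : \bar R :=
  if euclid_norm x <= 1 then (h (of_real_coords ((euclid_norm x)^-1 *: x)))%:E
  else 0%E.

Lemma sphere_integralE N (h : 'cV[C]_N -> R) :
  sphere_integral h = ((N + N)%:R%:E * iter_integral (ball_fun h))%E.
Proof. by []. Qed.

Lemma ball_fun_ge0 N (h : 'cV[C]_N -> R) x : (forall X, 0 <= h X) ->
  (0 <= ball_fun h x)%E.
Proof. by move=> h0; rewrite /ball_fun; case: ifP; rewrite ?lee_fin. Qed.

Definition hmeas N (h : 'cV[C]_N -> R) := forall d (T : measurableType d)
  (phi : 'I_(N + N) -> T -> R), (forall i, measurable_fun setT (phi i)) ->
  measurable_fun setT (fun t => h (of_real_coords (\row_i phi i t))).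

Lemma measurable_euclid_norm m d (T : measurableType d) (phi : 'I_m -> T -> R) :
  (forall i, measurable_fun setT (phi i)) ->
  measurable_fun setT (fun t => euclid_norm (\row_i phi i t)).
Proof.
move=> mphi; rewrite /euclid_norm.
apply: (measurableT_comp (f := @Num.sqrt R)).
  apply: continuous_measurable_fun; exact: sqrt_continuous.
rewrite (_ : (fun t => _) = (fun t => \sum_i (phi i t) ^+ 2)); last first.
  by apply/funext => t; apply: eq_bigr => i _; rewrite mxE.
by apply: measurable_sum => i; apply: measurable_funX.
Qed.

Lemma bmeas_ball_fun N (h : 'cV[C]_N -> R) : hmeas h -> bmeas (ball_fun h).
Proof.
move=> mh d T phi mphi; rewrite /ball_fun.
have mn := measurable_euclid_norm mphi.
apply: measurable_fun_ifT.
- exact: measurable_fun_ler.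
- apply/measurable_EFinP.
  (* The real power -1 is measurable and agrees with the inverse on nonnegative reals, 0
     included. *)
  have := mh d T (fun i t => (euclid_norm (\row_i phi i t)) `^ (-1) * phi i t).
  rewrite (_ : (fun t => _) = (fun t =>
    h (of_real_coords ((euclid_norm (\row_i phi i t))^-1 *: \row_i phi i t)))).
    apply=> i; apply: measurable_funM => //.
    by apply: (measurableT_comp (measurable_powR _)).
  apply/funext => t; congr (h (of_real_coords _)); apply/rowP => i.
  by rewrite !mxE powR_inv1 // euclid_norm_ge0.
- exact: measurable_cst.
Qed.

Lemma iter_integral_ball N : exists2 c : R, 0 < c &
  iter_integral (ball_fun (fun _ : 'cV[C]_N => 1)) = c%:E.
Proof.
have u : (iter_integral (ball_fun (fun _ : 'cV[C]_N => 1%R)) <= (1 * 2 ^+ (N + N))%:E)%E.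
  apply: iter_integral_le_box => // [x|x|x i xi].
  - exact: ball_fun_ge0.
  - by rewrite /ball_fun; case: ifP; rewrite ?lee_fin.
  - rewrite /ball_fun ifF //; apply: contraTF xi => xn; rewrite -leNgt.
    exact: le_trans (le_coord_euclid_norm _ _) xn.
(* On the cube of half-side 1/(2N + 1) the sum of the 2N squares is at most 1. *)
have l : ((1 * (2 * (N + N).+1%:R^-1) ^+ (N + N))%:E <=
    iter_integral (ball_fun (fun _ : 'cV[C]_N => 1%R)))%E.
  apply: (iter_integral_ge_box (x0 := 0)) => // [x|x xi].
  - exact: ball_fun_ge0.
  - rewrite /ball_fun ifT // -[leRHS]sqrtr1 ler_sqrt //.
    have k1 : 1 <= (N + N).+1%:R :> R by rewrite ler1n.
    apply: (@le_trans _ _ (\sum_(i < N + N) (N + N).+1%:R^-1)).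
      apply: ler_sum => i _; have := xi i; rewrite mxE subr0 => h.
      rewrite -real_normK ?num_real // expr2; apply: (@le_trans _ _ (`|x 0 i| * 1)).
        rewrite ler_wpM2l // (le_trans (ltW h)) // invf_le1 //; exact: lt_le_trans k1.
      by rewrite mulr1 ltW.
    rewrite sumr_const card_ord -[_ *+ _]mulr_natr mulrC ler_pdivrMr ?mul1r ?ler_nat //.
case: (iter_integral _) u l => [c| |] //= u l; exists c => //.
move: l; rewrite lee_fin; apply: lt_le_trans; rewrite mul1r exprn_gt0 // mulr_gt0 // invr_gt0 //.
Qed.

(** The constant of the change of variables is the same for all functions, and the unit ball,
    invariant and of finite positive volume, forces it to be 1. *)
Lemma sphere_integral_unitary N (g : 'M[C]_N) (h : 'cV[C]_N -> R) :
  g \is unitarymx -> hmeas h -> (forall X, 0 <= h X) ->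
  sphere_integral (fun X => h (g *m X)) = sphere_integral h.
Proof.
move=> gU mh h0; rewrite !sphere_integralE; congr (_ * _)%E.
have bE (f : 'cV[C]_N -> R) x :
    ball_fun (fun X => f (g *m X)) x = ball_fun f (x *m real_mx g).
  by rewrite /ball_fun euclid_norm_unitary // scalemxAl real_mxE.
have [k k0 kE] := cov_unit (real_mx_unit (unitarymx_unit gU)).
have [c c0 cE] := iter_integral_ball N.
have k1 : k = 1.
  have mB : bmeas (ball_fun (fun _ : 'cV[C]_N => 1)).
    by apply: bmeas_ball_fun => d T phi _; apply: measurable_cst.
  have pB x : (0 <= ball_fun (fun _ : 'cV[C]_N => 1%R) x)%E by apply: ball_fun_ge0.
  have := kE _ mB pB.
  rewrite (_ : (fun x => ball_fun _ (x *m _)) = ball_fun (fun _ : 'cV[C]_N => 1)).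
    rewrite cE -EFinM => -[] e.
    by apply: (mulIf (lt0r_neq0 c0)); rewrite mul1r.
  by apply/funext => x; rewrite -(bE (fun=> 1)).
rewrite (eq_iter_integral (bE h)) kE ?k1 ?mul1e //; first exact: bmeas_ball_fun.
by move=> x; apply: ball_fun_ge0.
Qed.

(** The condition at 0 is there because x = 0 normalises to 0, which is not a unit vector. *)
Lemma sphere_integral_le N (h : 'cV[C]_N -> R) (c : R) : 0 <= c ->
  (forall X, 0 <= h X) -> h 0 = 0 -> (forall X, nrm2 X = 1 -> h X <= c) ->
  (sphere_integral h <= ((N + N)%:R * (c * 2 ^+ (N + N)))%:E)%E.
Proof.
move=> c0 h0 h00 hc; rewrite sphere_integralE EFinM lee_wpmul2l ?lee_fin //.
apply: iter_integral_le_box => // [x|x|x i xi].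
- exact: ball_fun_ge0.
- rewrite /ball_fun; case: ifP => _; rewrite lee_fin //.
  have [->|x0] := eqVneq x 0.
    by rewrite scaler0 (_ : of_real_coords 0 = 0) ?h00 //; apply/eqP; rewrite of_real_coords_eq0.
  apply: hc; have := euclid_norm_normalized x0; rewrite euclid_normE => e.
  by rewrite -[LHS]sqr_sqrtr ?nrm2_ge0 // e expr1n.
- rewrite /ball_fun ifF //; apply: contraTF xi => xn; rewrite -leNgt.
  exact: le_trans (le_coord_euclid_norm _ _) xn.
Qed.

(** The origin is sampled only at x = 0, hence only where the outermost coordinate vanishes, a null
    set. *)
Lemma sphere_integral_off0 N (h : 'cV[C]_N -> R) : (0 < N)%N ->
  (forall X, X != 0 -> h X = 0) -> sphere_integral h = 0%E.
Proof.
move=> N0 h0; rewrite sphere_integralE.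
suff H : forall m (F : 'rV[R]_m -> \bar R), (0 < m)%N ->
    (forall x, x != 0 -> F x = 0%E) -> iter_integral F = 0%E.
  rewrite H ?addn_gt0 ?N0 ?mule0 // => x x0; rewrite /ball_fun; case: ifP => // _.
  rewrite h0 // of_real_coords_eq0 scaler_eq0 invr_eq0 euclid_norm_eq0.
  by rewrite (negbTE x0).
move=> [//|m] F _ F0 /=.
rewrite -[RHS](integral_set1 (fun x => iter_integral (fun v : 'rV_m =>
  F (row_mx (x%:M : 'rV_1) v))) 0) [RHS]integral_mkcond.
apply: eq_integral => x _; rewrite patchE; case: ifPn => // x0.
rewrite (_ : (fun v : 'rV_m => F (row_mx (x%:M : 'rV_1) v)) = fun=> 0%E).
  by rewrite iter_integral0.
apply/funext => v; apply: F0; apply: contraNneq x0 => /rowP /(_ ord0).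
by rewrite row_cons0 mxE => ->; rewrite inE.
Qed.

Lemma cvg_sumr (T I : Type) (F : set_system T) {FF : Filter F} (s : seq I)
    (f : I -> T -> R) (a : I -> R) :
  (forall i, f i x @[x --> F] --> a i) ->
  \sum_(i <- s) f i x @[x --> F] --> \sum_(i <- s) a i.
Proof. by move=> fa; apply: cvg_big => //; exact: add_continuous. Qed.

Lemma continuous_euclid_norm m (y : 'rV[R]_m) :
  euclid_norm x @[x --> y] --> euclid_norm y.
Proof.
apply: (@cvg_comp _ _ _ (fun x : 'rV[R]_m => \sum_i x 0 i ^+ 2) Num.sqrt); last exact: sqrt_continuous.
apply: (@cvg_sumr _ _ (nbhs y) (nbhs_filter y)) => i.
by apply: (@cvgM _ _ (nbhs y) (nbhs_filter y)); exact: coord_continuous.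
Qed.

Lemma sphere_integral_gt0 N (h : 'cV[C]_N -> R) (x0 : 'rV[R]_(N + N)) :
  (0 < N)%N -> (forall X, 0 <= h X) -> euclid_norm x0 = 1 ->
  {for x0, continuous (fun x => h (of_real_coords x))} ->
  0 < h (of_real_coords x0) -> (0 < sphere_integral h)%E.
Proof.
(* Halfway along the ray a full neighbourhood lies inside the unit ball and normalises to points
   close to x0. *)
move=> N0 h0 n1 hc hx0; pose y0 := 2^-1 *: x0.
have ny0 : euclid_norm y0 = 2^-1 by rewrite euclid_normZ ?n1 ?mulr1 // invr_ge0.
have ey0 : (euclid_norm y0)^-1 *: y0 = x0.
  by rewrite ny0 /y0 scalerA invrK mulfV ?scale1r ?pnatr_eq0.
pose c := h (of_real_coords x0) / 2.
have c0 : 0 < c by rewrite /c; lra.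
have nc := @continuous_euclid_norm _ y0.
have near1 : \forall y \near y0, euclid_norm y < 1.
  by apply: (cvgr_lt _ nc); rewrite ny0; lra.
have pc : (fun y => (euclid_norm y)^-1 *: y) @ y0 --> x0.
  suff : (fun y => (euclid_norm y)^-1 *: y) @ y0 --> (euclid_norm y0)^-1 *: y0.
    by rewrite ey0.
  apply: (@cvgZ _ _ _ (nbhs y0) (nbhs_filter y0)); last exact: cvg_id.
  apply: (@cvgV _ _ (nbhs y0) (nbhs_filter y0) (@euclid_norm R _)).
    by rewrite ny0 invr_eq0 pnatr_eq0.
  exact: nc.
have near2 : \forall y \near y0,
    c < h (of_real_coords ((euclid_norm y)^-1 *: y)).
  have hy := cvg_comp _ _ pc hc.
  by apply: (cvgr_gt _ hy); rewrite /c; lra.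
have : \forall y \near y0, (euclid_norm y < 1) /\
    c < h (of_real_coords ((euclid_norm y)^-1 *: y)).
  by near=> y; split; near: y.
move=> /nbhs_ballP [eta /= eta0 He].
rewrite sphere_integralE mule_gt0 ?lte_fin ?ltr0n ?addn_gt0 ?N0 //.
apply: lt_le_trans (iter_integral_ge_box (x0 := y0) (ltW c0) eta0 _ _).
- by rewrite lte_fin mulr_gt0 // exprn_gt0 // mulr_gt0.
- by move=> x; apply: ball_fun_ge0.
- move=> x xi; have [] := He x.
    by split=> // i j; rewrite ord1 /ball /= -opprB normrN.
  by move=> l g; rewrite /ball_fun (ltW l) lee_fin ltW.
Unshelve. all: by end_near.
Qed.

End SphereIntegral.

(** * From polynomials to the principal series *)

Section Smoothness.
Variables (R : realType) (V : normedModType R) (D : set V).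
Hypothesis oD : open D.
Implicit Types (f g : V -> R) (k : nat).

Lemma Ck_eq k f g : (forall x, D x -> f x = g x) -> Ck k D f -> Ck k D g.
Proof.
have nfg f1 g1 x : (forall x, D x -> f1 x = g1 x) -> D x -> {near x, f1 =1 g1}.
  by move=> fg Dx; apply: filterS fg _; exact: open_nbhs_nbhs.
elim: k f g => [|k IH] f g fg /= hf.
  move=> x Dx; have := hf x Dx; rewrite /prop_for /continuous_at -fg //.
  by apply: cvg_trans; apply: near_eq_cvg; apply: nfg.
move=> v; have [df cf] := hf v; split=> [x Dx|].
  by apply: near_eq_derivable (df x Dx); exact: nfg.
by apply: IH cf => x Dx; apply: near_eq_derive; exact: nfg.
Qed.

Lemma derive_line f x v : 'D_v f x = 'D_1 (fun h : R => f (h *: v + x)) 0.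
Proof.
rewrite /derive; set g1 := fun h => h^-1 *: _; set g2 := fun h => h^-1 *: _.
suff -> : g1 = g2 by [].
by rewrite funeqE /g1 /g2 => h /=; rewrite addr0 scale0r add0r [_%:A]mulr1.
Qed.

Lemma is_derive_comp (phi : R -> R) (dphi : R) f x v : derivable f x v ->
  is_derive (f x) 1 phi dphi -> is_derive x v (phi \o f) (dphi * 'D_v f x).
Proof.
move=> /derivable1P df [dp vp]; split.
  apply/derivable1P/derivable1_diffP.
  apply: (@differentiable_comp _ _ _ _ (fun h : R => f (h *: v + x)) phi).
    exact/derivable1_diffP.
  by rewrite scale0r add0r; apply/derivable1_diffP.
rewrite !derive_line -!derive1E.
set l := fun h : R => f (h *: v + x); have l0 : l 0 = f x by rewrite /l scale0r add0r.
have := @derive1_comp _ l phi 0 df; rewrite l0 => /(_ dp) ->.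
by rewrite derive1E vp.
Qed.

(** At order k.+1, [Ck] speaks of directional derivatives only, which does not include continuity of
    f. Keeping all orders up to k supplies the undifferentiated factors in the Leibniz rule. *)
Definition CK k f := forall j, (j <= k)%N -> Ck j D f.

Lemma CK_smooth f : (forall k, CK k f) -> smooth_on D f.
Proof. by move=> cf k; apply: (cf k). Qed.

Lemma smooth_CK k f : smooth_on D f -> CK k f.
Proof. by move=> cf j _. Qed.

Lemma CK_pred k f : CK k.+1 f -> CK k f.
Proof. by move=> cf j jk; apply: cf; apply: leqW. Qed.

Lemma CK_eq k f g : (forall x, D x -> f x = g x) -> CK k f -> CK k g.
Proof. by move=> fg cf j jk; apply: Ck_eq fg _; apply: cf. Qed.

Lemma CKS k f : CK k.+1 f <-> (CK 0 f /\
  forall v, (forall x, D x -> derivable f x v) /\ CK k ('D_v f)).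
Proof.
split=> [cf|[c0 cf] [|j] jk].
- split=> [[|//] _|v]; first exact: (cf 0%N).
  split; first by have /(_ v)[] := cf 1%N isT.
  by move=> j jk; have /(_ v)[] := cf j.+1 jk.
- exact: c0.
- by move=> v; have [df cdf] := cf v; split=> //; apply: cdf.
Qed.

Lemma CK_cst k a : CK k (fun=> a).
Proof.
elim: k a => [|k IH] a; first by move=> [|//] _ x _; exact: cvg_cst.
apply/CKS; split=> [[|//] _ x _|v]; first exact: cvg_cst.
split=> [x _|]; first exact: derivable_cst.
by apply: CK_eq (IH 0) => x _; rewrite derive_cst.
Qed.

Lemma CKD k f g : CK k f -> CK k g -> CK k (fun x => f x + g x).
Proof.
elim: k f g => [|k IH] f g.
  by move=> /(_ 0%N isT) cf /(_ 0%N isT) cg [|//] _ x Dx; apply: cvgD; [apply: cf|apply: cg].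
move=> /CKS[cf df] /CKS[cg dg]; apply/CKS; split=> [[|//] _ x Dx|v].
  by apply: cvgD; [apply: (cf 0%N)|apply: (cg 0%N)].
have [dfv cfv] := df v; have [dgv cgv] := dg v; split=> [x Dx|].
  by apply: derivableD; [apply: dfv|apply: dgv].
by apply: CK_eq (IH _ _ cfv cgv) => x Dx; rewrite deriveD //; [apply: dfv|apply: dgv].
Qed.

Lemma CKM k f g : CK k f -> CK k g -> CK k (fun x => f x * g x).
Proof.
elim: k f g => [|k IH] f g.
  by move=> /(_ 0%N isT) cf /(_ 0%N isT) cg [|//] _ x Dx; apply: cvgM; [apply: cf|apply: cg].
move=> Cf Cg; have /CKS[cf df] := Cf; have /CKS[cg dg] := Cg.
apply/CKS; split=> [[|//] _ x Dx|v].
  by apply: cvgM; [apply: (cf 0%N)|apply: (cg 0%N)].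
have [dfv cfv] := df v; have [dgv cgv] := dg v; split=> [x Dx|].
  by apply: derivableM; [apply: dfv|apply: dgv].
apply: CK_eq (CKD (IH _ _ (CK_pred Cf) cgv) (IH _ _ (CK_pred Cg) cfv)) => x Dx.
by rewrite deriveM //; [apply: dfv|apply: dgv].
Qed.

(** The sequence of successive derivatives [phi] is carried along: differentiating phi i after f
    gives phi i.+1 after f times the derivative of f, so the induction on k shifts i. *)
Lemma CK_comp (Q : set R) (phi : nat -> R -> R) k f i :
  (forall i y, Q y -> is_derive y 1 (phi i) (phi i.+1 y)) ->
  (forall x, D x -> Q (f x)) -> CK k f -> CK k (phi i \o f).
Proof.
move=> dphi fQ; elim: k f i fQ => [|k IH] f i fQ Cf.
  case=> // _ x Dx; apply: cvg_comp; first exact: (Cf 0%N).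
  have [dp _] := dphi i _ (fQ _ Dx).
  exact: (differentiable_continuous ((derivable1_diffP _ _).1 dp)).
have /CKS[cf df] := Cf.
apply/CKS; split=> [[|//] _ x Dx|v].
  apply: cvg_comp; first exact: (Cf 0%N).
  have [dp _] := dphi i _ (fQ _ Dx).
  exact: (differentiable_continuous ((derivable1_diffP _ _).1 dp)).
have [dfv cfv] := df v.
have H x (Dx : D x) := is_derive_comp (dfv x Dx) (dphi i _ (fQ x Dx)).
split=> [x Dx|]; first by have [] := H x Dx.
apply: CK_eq (CKM (IH _ i.+1 fQ (CK_pred Cf)) cfv) => x Dx.
by have [_ ->] := H x Dx.
Qed.

Lemma smooth_cst a : smooth_on D (fun=> a).
Proof. by apply: CK_smooth => k; apply: CK_cst. Qed.

Lemma smoothD f g : smooth_on D f -> smooth_on D g -> smooth_on D (fun x => f x + g x).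
Proof. by move=> cf cg; apply: CK_smooth => k; apply: CKD; apply: smooth_CK. Qed.

Lemma smoothM f g : smooth_on D f -> smooth_on D g -> smooth_on D (fun x => f x * g x).
Proof. by move=> cf cg; apply: CK_smooth => k; apply: CKM; apply: smooth_CK. Qed.

Lemma smooth_eq f g : (forall x, D x -> f x = g x) -> smooth_on D f -> smooth_on D g.
Proof. by move=> fg cf k; apply: Ck_eq (cf k). Qed.

Lemma smoothN f : smooth_on D f -> smooth_on D (fun x => - f x).
Proof.
move=> cf; apply: smooth_eq (smoothM (smooth_cst (-1)) cf) => x _; exact: mulN1r.
Qed.

Lemma smooth_sum (I : Type) (s : seq I) (F : I -> V -> R) :
  (forall i, smooth_on D (F i)) -> smooth_on D (fun x => \sum_(i <- s) F i x).
Proof.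
move=> cF; elim: s => [|i s IH].
  by apply: smooth_eq (smooth_cst 0) => x _; rewrite big_nil.
by apply: smooth_eq (smoothD (cF i) IH) => x _; rewrite big_cons.
Qed.

Lemma smooth_expR f : smooth_on D f -> smooth_on D (fun x => expR (f x)).
Proof.
move=> cf; apply: CK_smooth => k.
by apply: (@CK_comp setT (fun _ => expR) k f 0).
Qed.

Lemma smooth_cos_sin f : smooth_on D f ->
  smooth_on D (fun x => cos (f x)) /\ smooth_on D (fun x => sin (f x)).
Proof.
move=> cf.
pose phi i y : R := nth 0 [:: cos y; - sin y; - cos y; sin y] (i %% 4).
have dphi i (y : R) : setT y -> is_derive y 1 (phi i) (phi i.+1 y).
  move=> _; rewrite /phi (_ : i.+1 %% 4 = (i %% 4).+1 %% 4)%N; last by rewrite -addn1 -[in RHS]addn1 modnDml.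
  have : (i %% 4 < 4)%N by rewrite ltn_mod.
  by move: (i %% 4)%N => [|[|[|[|//]]]] _ /=; apply: is_derive_eq; rewrite ?opprK.
split; apply: CK_smooth => k.
  by apply: (CK_comp 0 dphi) => //; exact: smooth_CK.
by apply: (CK_comp 3 dphi) => //; exact: smooth_CK.
Qed.

Lemma smooth_ln f : (forall x, D x -> 0 < f x) -> smooth_on D f ->
  smooth_on D (fun x => ln (f x)).
Proof.
move=> f0 cf.
pose phi i y : R := if i is i'.+1 then (-1) ^+ i' * i'`!%:R * y^-1 ^+ i'.+1 else ln y.
have dphi i (y : R) : [set y : R | 0 < y] y -> is_derive y 1 (phi i) (phi i.+1 y).
  move=> /= y0; case: i => [|i] /=.
    by apply: is_derive_eq; [exact: is_derive1_ln|rewrite fact0 !mul1r expr1].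
  have yn0 : y != 0 by rewrite gt_eqF.
  have dV : is_derive y 1 (fun y : R => y^-1) (- y^-1 ^+ 2).
    split; first exact: derivableV.
    by rewrite deriveV // derive_id -exprVn [LHS]mulr1.
  have -> : phi i.+1 = ((-1) ^+ i * i`!%:R : R) \*: ((fun y : R => y^-1) ^+ i.+1).
    by apply/funext => z; rewrite /phi exprfctE.
  have dX := is_deriveX i.+1 dV; have dZ := is_deriveZ ((-1) ^+ i * i`!%:R : R) dX.
  apply: (is_derive_eq dZ).
  rewrite /GRing.scale /= factS natrM.
  have -> : (-1) ^+ i.+1 = - (-1) ^+ i :> R by rewrite exprS mulN1r.
  have -> : y^-1 ^+ i.+2 = y^-1 ^+ i * y^-1 ^+ 2 by rewrite -exprD addn2.
  by move: (y^-1 ^+ i) (y^-1 ^+ 2) ((-1) ^+ i : R) => a b c; ring.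
by apply: CK_smooth => k; apply: (CK_comp 0 dphi) => //; exact: smooth_CK.
Qed.

End Smoothness.

Section Conjugation.
Variable C : numClosedFieldType.
Implicit Types x y : C.

Lemma conjcD x y : (x + y)^* = x^* + y^*.
Proof. exact: rmorphD. Qed.

Lemma conjcB x y : (x - y)^* = x^* - y^*.
Proof. exact: rmorphB. Qed.

Lemma conjcN x : (- x)^* = - x^*.
Proof. exact: rmorphN. Qed.

Lemma conjcM x y : (x * y)^* = x^* * y^*.
Proof. exact: rmorphM. Qed.

Lemma conjcV x : (x^-1)^* = (x^*)^-1.
Proof. exact: fmorphV. Qed.

Lemma conjc_nat k : k%:R^* = k%:R :> C.
Proof. exact: rmorph_nat. Qed.

Lemma half_sum_i x y : y = 2^-1 * (x + y) + 'i * (2^-1 * 'i * (x - y)).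
Proof.
have -> : 'i * (2^-1 * 'i * (x - y)) = 'i ^+ 2 * (2^-1 * (x - y)) by ring.
by rewrite sqrCi; field.
Qed.

Lemma half_sum_Ni x y : y = 2^-1 * (y + x) + 'i * (2^-1 * - 'i * (y - x)).
Proof.
have -> : 'i * (2^-1 * - 'i * (y - x)) = - 'i ^+ 2 * (2^-1 * (y - x)) by ring.
by rewrite sqrCi; field.
Qed.

(** The vectors (J conj X, X) are a real form of the space of pairs (U, V). With W = -JU, so that U
    = JW, take A = (V + conj W)/2 and B = (V - conj W)/(2i). *)
Lemma conj_comb N (J : 'M[C]_N) (U V : 'cV[C]_N) : J *m J = - 1%:M ->
  exists A B : 'cV[C]_N, V = A + 'i *: B /\
    U = J *m map_mx Num.conj A + 'i *: (J *m map_mx Num.conj B).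
Proof.
move=> JJ; pose W := - (J *m U).
have JW : J *m W = U by rewrite /W mulmxN mulmxA JJ mulNmx mul1mx opprK.
clearbody W; pose A := 2^-1 *: (V + map_mx Num.conj W).
pose B := (2^-1 * - 'i) *: (V - map_mx Num.conj W); exists A, B.
have cA : map_mx Num.conj A = 2^-1 *: (map_mx Num.conj V + W).
  apply/colP => k; rewrite !mxE; move: (W k 0) (V k 0) => w v.
  by rewrite conjcM conjcD conjCK conjcV conjc_nat.
have cB : map_mx Num.conj B = (2^-1 * 'i) *: (map_mx Num.conj V - W).
  apply/colP => k; rewrite !mxE; move: (W k 0) (V k 0) => w v.
  by rewrite !conjcM conjcB conjcN conjCi opprK conjcV conjc_nat conjCK.
split; apply/colP => k.
  by rewrite /A /B !mxE; exact: half_sum_Ni.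
rewrite cA cB -!scalemxAr mulmxDr mulmxBr JW; move: (J *m _) => s.
by rewrite !mxE; exact: half_sum_i.
Qed.

Lemma mxDZ m p (A B : 'M[C]_(m, p)) c i j : (A + c *: B) i j = A i j + c * B i j.
Proof. by rewrite !mxE. Qed.

End Conjugation.

Section InnerProduct.
Variables (C : numClosedFieldType) (H : lmodType C) (ip : {dot H for Num.conj}).
Implicit Types (u v w : H) (a : C).

Lemma ipDl u v w : ip (u + v) w = ip u w + ip v w.
Proof. exact: linearDl. Qed.

Lemma ipDr u v w : ip u (v + w) = ip u v + ip u w.
Proof. exact: linearDr. Qed.

Lemma ipZl a u v : ip (a *: u) v = a * ip u v.
Proof. exact: linearZl_LR. Qed.

Lemma ipZr a u v : ip u (a *: v) = a^* * ip u v.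
Proof. exact: linearZr_LR. Qed.

Lemma ipC u v : ip u v = (ip v u)^*.
Proof. by rewrite hermC expr0 mul1r. Qed.

Lemma ip0l u : ip 0 u = 0.
Proof. exact: linear0l. Qed.

Lemma ipBl u v w : ip (u - v) w = ip u w - ip v w.
Proof. exact: linearBl. Qed.

Lemma ipBr u v w : ip u (v - w) = ip u v - ip u w.
Proof. exact: linearBr. Qed.

Lemma ip_suml I (s : seq I) (P : pred I) (f : I -> H) v :
  ip (\sum_(i <- s | P i) f i) v = \sum_(i <- s | P i) ip (f i) v.
Proof. exact: linear_sumlz. Qed.

Lemma ip_sumr I (s : seq I) (P : pred I) (f : I -> H) v :
  ip v (\sum_(i <- s | P i) f i) = \sum_(i <- s | P i) ip v (f i).
Proof. exact: linear_sumr. Qed.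

Lemma ip_polarization u v u' v' :
  (forall a b, ip (a *: u + b *: v) (a *: u + b *: v) =
               ip (a *: u' + b *: v') (a *: u' + b *: v')) ->
  ip u v = ip u' v'.
Proof.
move=> h.
have E a b x y : ip (a *: x + b *: y) (a *: x + b *: y) =
    a * a^* * ip x x + a * b^* * ip x y + b * a^* * ip y x + b * b^* * ip y y.
  by rewrite !ipDl !ipDr !ipZl !ipZr; ring.
have h1 := h 1 0; have h2 := h 0 1; have h3 := h 1 1; have h4 := h 1 'i.
move: h1 h2 h3 h4; rewrite !E !conjC0 !conjC1 conjCi !mul0r !mulr0 !mul1r !mul0r !add0r !addr0.
move=> h1 h2; rewrite h1 h2 => h3 h4.
have e3 : ip u v + ip v u = ip u' v' + ip v' u'.
  by apply: (addrI (ip u' u')); apply: (addIr (ip v' v')); rewrite !addrA; exact: h3.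
have e4 : - 'i * ip u v + 'i * ip v u = - 'i * ip u' v' + 'i * ip v' u'.
  apply: (addrI (ip u' u')); apply: (addIr ('i * - 'i * ip v' v')).
  by move: h4; rewrite !mulr1 !addrA.
have i0 : 'i != 0 :> C by exact: neq0Ci.
have e5 : - ip u v + ip v u = - ip u' v' + ip v' u'.
  by apply: (mulfI i0); rewrite !mulrDr !mulrN -!mulNr.
have : ip u v *+ 2 = ip u' v' *+ 2.
  have -> : ip u v *+ 2 = (ip u v + ip v u) - (- ip u v + ip v u) by ring.
  by rewrite e3 e5; ring.
by rewrite -[LHS]mulr_natr -[RHS]mulr_natr => /mulIf; apply; rewrite pnatr_eq0.
Qed.

End InnerProduct.

(** * Polynomials in (J conj X, X) as elements of the principal series *)

Section ExtendedFunctions.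
Variables (R : realType) (n' : nat).
Local Notation C := R[i].
Local Notation n := n'.+1.
Local Notation N := (n + n)%N.
Local Notation E := 'M[C]_(N, 2).
Implicit Types (X : 'cV[C]_N) (F : E -> C).

Definition rad m (X : 'cV[C]_m) : R := Num.sqrt (nrm2 X).

Lemma rad_coords m (x : 'rV[R]_(m + m)) : rad (of_real_coords x) = euclid_norm x.
Proof. by rewrite euclid_normE. Qed.

Lemma rad_gt0 m (X : 'cV[C]_m) : (0 < rad X) = (X != 0).
Proof.
rewrite -[X]re_coordsK rad_coords of_real_coords_eq0 -euclid_norm_eq0.
by rewrite lt_neqAle eq_sym euclid_norm_ge0 andbT.
Qed.

Lemma rad_sqr m (X : 'cV[C]_m) : rad X ^+ 2 = nrm2 X.
Proof. by rewrite sqr_sqrtr // nrm2_ge0. Qed.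

Lemma nrm2_gt0 m (X : 'cV[C]_m) : (0 < nrm2 X) = (X != 0).
Proof. by rewrite -sqrtr_gt0 rad_gt0. Qed.

Lemma nrm2Z m (a : C) (X : 'cV[C]_m) : nrm2 (a *: X) = complex.Re `|a| ^+ 2 * nrm2 X.
Proof.
rewrite /nrm2 mulr_sumr; apply: eq_bigr => k _.
by rewrite Re_normc_sqr !mxE ReM ImM; ring.
Qed.

Lemma Re_normc_ge0 (a : C) : 0 <= complex.Re `|a|.
Proof. by rewrite normc_def /= sqrtr_ge0. Qed.

Lemma normc_real (a : C) : (complex.Re `|a|)%:C%C = `|a|.
Proof. by rewrite normc_def. Qed.

Lemma Re_normc_gt0 (a : C) : (0 < complex.Re `|a|) = (a != 0).
Proof. by rewrite -normr_gt0 -(normc_real a) ltcR. Qed.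

Lemma radZ m (a : C) (X : 'cV[C]_m) : rad (a *: X) = complex.Re `|a| * rad X.
Proof. by rewrite /rad nrm2Z sqrtrM ?sqr_ge0 // sqrtr_sqr ger0_norm ?Re_normc_ge0. Qed.

Lemma rad_unitary m (g : 'M[C]_m) (X : 'cV[C]_m) : g \is unitarymx -> rad (g *m X) = rad X.
Proof. by move=> gU; rewrite /rad nrm2_unitary. Qed.

Lemma cpowM (r r' : R) (s : C) : 0 < r -> 0 < r' ->
  cpow (r * r') s = cpow r s * cpow r' s.
Proof.
move=> r0 r0'; rewrite /cpow lnM ?posrE // !mulrDr expRD cosD sinD.
by apply: complex_ext; rewrite ?ReM ?ImM /=; ring.
Qed.

Lemma cpowD (r : R) (s s' : C) : cpow r (s + s') = cpow r s * cpow r s'.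
Proof.
rewrite /cpow ReD ImD !mulrDl expRD cosD sinD.
by apply: complex_ext; rewrite ?ReM ?ImM /=; ring.
Qed.

Lemma cpowNn (r : R) (d : nat) : 0 < r -> cpow r (- d%:R) = (r%:C%C ^+ d)^-1.
Proof.
move=> r0; have -> : - d%:R = (- d%:R : R)%:C%C by rewrite raddfN /= rmorph_nat.
rewrite /cpow [complex.Re _]/= [complex.Im _]/= mul0r cos0 sin0 mulr1 mulr0.
rewrite mulNr expRN expRM_natl lnK ?posrE //.
by rewrite -rmorphXn /= -fmorphV.
Qed.

Lemma cpow1 (s : C) : cpow 1 s = 1.
Proof.
by apply: complex_ext; rewrite /cpow ln1 !mulr0 expR0 cos0 sin0 /= mul1r.
Qed.

Lemma cpow0 (s : C) : cpow 0 s = 1.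
Proof.
by apply: complex_ext; rewrite /cpow ln0 // !mulr0 expR0 cos0 sin0 /= mul1r.
Qed.

Definition pairmx X : E :=
  \matrix_(i, j) if j == 0 then (Jmx C n *m map_mx Num.conj X) i 0 else X i 0.

Lemma pairmx0E X i : pairmx X i 0 = (Jmx C n *m map_mx Num.conj X) i 0.
Proof. by rewrite mxE. Qed.

Lemma pairmx1E X i : pairmx X i 1 = X i 0.
Proof. by rewrite mxE. Qed.

Lemma col_pairmx X :
  col 0 (pairmx X) = Jmx C n *m map_mx Num.conj X /\ col 1 (pairmx X) = X.
Proof. by split; apply/colP => i; rewrite !mxE. Qed.

(** Unitarity turns the relation g^T J g = J into this one, which is what makes J conj X transform
    like X. *)
Lemma conj_SpK g : SpK g -> Jmx C n *m map_mx Num.conj g = g *m Jmx C n.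
Proof.
move=> /SpKP[gU /(congr1 (map_mx Num.conj))].
rewrite !map_mxM Jmx_conj => /(congr1 (fun B => g *m B)).
by rewrite !mulmxA gU mul1mx.
Qed.

Lemma pairmx_mul g X : SpK g -> pairmx (g *m X) = g *m pairmx X.
Proof.
move=> gK; apply/matrixP => i j; rewrite [RHS]mxE; have [->|->] := ord2P j.
  rewrite pairmx0E map_mxM mulmxA conj_SpK // -mulmxA mxE.
  by apply: eq_bigr => k _; rewrite pairmx0E.
by rewrite pairmx1E mxE; apply: eq_bigr => k _; rewrite pairmx1E.
Qed.

Lemma pairmxZ a X : pairmx (a *: X) = pairmx X *m dg a^* a.
Proof.
apply/matrixP => i j; rewrite mul_mx_diag [RHS]mxE; have [->|->] := ord2P j.
  by rewrite !pairmx0E map_mxZ -scalemxAr !mxE mulrC.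
by rewrite !pairmx1E !mxE mulrC.
Qed.

Lemma omega_pairmx X : omega (col 0 (pairmx X)) (col 1 (pairmx X)) = (nrm2 X)%:C%C.
Proof.
have [-> ->] := col_pairmx X; rewrite omegaE nrm2E trmx_mul -mulmxA.
by rewrite Jmx_tr mulmxN mulNmx -mulmxA (mulmxA (Jmx C n)) Jmx_sqr mulNmx mul1mx mulmxN opprK map_trmx.
Qed.

Variable mu : C.

(** The radial factor corrects the degree d into -mu - N and equals 1 on the unit sphere, where the
    function is thus the polynomial itself. *)
Definition ext (d : nat) F X : C := cpow (rad X) (- mu - N%:R - d%:R) * F (pairmx X).

(** Radius 0, where [cpow] takes the value 1, is included because sphere integrals also sample the
    origin. *)
Lemma ext_normalized d F X : rad X = 0 \/ rad X = 1 -> ext d F X = F (pairmx X).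
Proof. by rewrite /ext => -[] ->; rewrite ?cpow0 ?cpow1 mul1r. Qed.

(** Scaling X by z scales the columns of [pairmx X] by conj z and z, so bidegree (a, b) contributes
    |z|^(a+b), which the radial factor cancels, and the phase [z]^(b-a). *)
Lemma ext_homogeneous a b (delta : int) F z X : bideg a b F -> a%:Z - b%:Z = delta ->
  z != 0 -> X != 0 -> ext (a + b) F (z *: X) =
    cpow (complex.Re `|z|) (- mu - N%:R) * (z / `|z|) ^ (- delta) * ext (a + b) F X.
Proof.
move=> bF ab z0 X0; rewrite /ext radZ cpowM ?Re_normc_gt0 ?rad_gt0 //.
rewrite pairmxZ bF cpowD cpowNn ?Re_normc_gt0 // normc_real.
set c := cpow _ _; set e := cpow _ _; set f := F _.
have nz : `|z| != 0 by rewrite normr_eq0.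
have -> : z^* = `|z| ^+ 2 / z by rewrite normCK mulrAC mulfV ?mul1r.
have -> : (z / `|z|) ^ (- delta) = (`|z| / z) ^+ a * (z / `|z|) ^+ b.
  rewrite -ab opprB expfzDr ?mulf_neq0 ?invr_eq0 // mulrC.
  rewrite -exprnN -exprnP; congr (_ * _).
  by rewrite -exprVn invf_div.
have -> : (`|z| ^+ (a + b))^-1 = `|z|^-1 ^+ a * `|z|^-1 ^+ b by rewrite !exprVn exprD invfM.
have -> : (`|z| ^+ 2 / z) ^+ a = `|z| ^+ a * (`|z| / z) ^+ a.
  by rewrite -exprMn expr2 !mulrA.
have -> : (z / `|z|) ^+ b = z ^+ b * `|z|^-1 ^+ b by rewrite exprMn.
have -> : c * (`|z|^-1 ^+ a * `|z|^-1 ^+ b) * e * (`|z| ^+ a * (`|z| / z) ^+ a * z ^+ b * f) =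
  (`|z|^-1 ^+ a * `|z| ^+ a) * (c * ((`|z| / z) ^+ a * (z ^+ b * `|z|^-1 ^+ b)) * (e * f)) by ring.
by rewrite -exprMn mulVf // expr1n mul1r.
Qed.

Lemma open_neq0 m : open [set x : 'rV[R]_m | x != 0].
Proof.
rewrite (_ : [set _ | _] = ~` [set 0]); first exact/closed_openC/accessible_closed_set1/hausdorff_accessible/norm_hausdorff.
by apply/seteqP; split=> x /= /eqP.
Qed.

Lemma csmooth_cst c : smooth_off0 (fun _ : 'cV[C]_N => c).
Proof. by split; apply: smooth_cst; exact: open_neq0. Qed.

Lemma csmoothD f g : smooth_off0 f -> smooth_off0 g ->
  smooth_off0 (fun X : 'cV[C]_N => f X + g X).
Proof.
move=> [f1 f2] [g1 g2]; have o := @open_neq0 (N + N).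
split.
  by apply: (smooth_eq o _ (smoothD o f1 g1)) => x _; rewrite ReD.
by apply: (smooth_eq o _ (smoothD o f2 g2)) => x _; rewrite ImD.
Qed.

Lemma csmoothM f g : smooth_off0 f -> smooth_off0 g ->
  smooth_off0 (fun X : 'cV[C]_N => f X * g X).
Proof.
move=> [f1 f2] [g1 g2]; have o := @open_neq0 (N + N).
split.
  apply: (smooth_eq o _ (smoothD o (smoothM o f1 g1) (smoothN o (smoothM o f2 g2)))) => x _.
  by rewrite ReM.
apply: (smooth_eq o _ (smoothD o (smoothM o f1 g2) (smoothM o f2 g1))) => x _.
by rewrite ImM.
Qed.

Lemma csmooth_eq f g : f =1 g -> smooth_off0 f -> smooth_off0 (g : 'cV[C]_N -> C).
Proof. by move=> /funext ->. Qed.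

Lemma csmooth_sum (I : Type) (s : seq I) (F : I -> 'cV[C]_N -> C) :
  (forall i, smooth_off0 (F i)) -> smooth_off0 (fun X => \sum_(i <- s) F i X).
Proof.
move=> sF; elim: s => [|i s IH].
  by apply: csmooth_eq (csmooth_cst 0) => X; rewrite big_nil.
by apply: csmooth_eq (csmoothD (sF i) IH) => X; rewrite big_cons.
Qed.

Lemma smooth_coord m (k : 'I_m) :
  smooth_on [set x : 'rV[R]_m | x != 0] (fun x : 'rV[R]_m => x ord0 k).
Proof.
have o := @open_neq0 m.
have dc (x v : 'rV[R]_m) : is_derive x v (fun x : 'rV[R]_m => x ord0 k) (v ord0 k).
  apply: DeriveDef.
    apply/cvg_ex; exists (v ord0 k).
    apply: (cvg_trans (near_eq_cvg _) (cvg_cst _)).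
    near=> h; rewrite /= !mxE addrK /GRing.scale /= mulrA mulVf ?mul1r //.
    by near: h; exact: nbhs_dnbhs_neq.
  rewrite /derive; apply: cvg_lim => //.
  apply: (cvg_trans (near_eq_cvg _) (cvg_cst _)).
  near=> h; rewrite /= !mxE addrK /GRing.scale /= mulrA mulVf ?mul1r //.
  by near: h; exact: nbhs_dnbhs_neq.
case=> [|j] /=; first by move=> x _; exact: coord_continuous.
move=> v; split=> [x _|]; first by have [] := dc x v.
apply: (Ck_eq o (f := fun=> v ord0 k)) => [x _|]; first by have [_ ->] := dc x v.
exact: (smooth_cst o).
Unshelve. all: by end_near. Qed.

Lemma csmooth_coord k : smooth_off0 (fun X : 'cV[C]_N => X k 0).
Proof.
have o := @open_neq0 (N + N).
split; [apply: (smooth_eq o _ (smooth_coord (lshift N k)))|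
        apply: (smooth_eq o _ (smooth_coord (rshift N k)))];
by move=> x _; rewrite !mxE.
Qed.

Lemma csmooth_conj f : smooth_off0 f -> smooth_off0 (fun X : 'cV[C]_N => (f X)^*).
Proof.
move=> [f1 f2]; have o := @open_neq0 (N + N); split.
  by apply: (smooth_eq o _ f1) => x _; rewrite ReJ.
by apply: (smooth_eq o _ (smoothN o f2)) => x _; rewrite ImJ.
Qed.

Lemma csmooth_pairmx i j : smooth_off0 (fun X => pairmx X i j).
Proof.
case: (eqVneq j 0) => [->|j0]; last first.
  by apply: csmooth_eq (csmooth_coord i) => X; rewrite mxE (negbTE j0).
apply: (@csmooth_eq (fun X => \sum_k Jmx C n i k * (X k 0)^*)) => [X|].
  by rewrite pairmx0E mxE; apply: eq_bigr => k _; congr (_ * _); rewrite mxE.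
apply: csmooth_sum => k; apply: csmoothM; first exact: csmooth_cst.
exact: csmooth_conj (csmooth_coord k).
Qed.

Lemma csmooth_hom d F : hom d F -> smooth_off0 (fun X => F (pairmx X)).
Proof.
elim: d F => [F [c Fc]|d IH F [G [hG FE]]].
  by apply: csmooth_eq (csmooth_cst c) => X; rewrite Fc.
apply: (@csmooth_eq (fun X => \sum_k pairmx X k.1 k.2 * G k (pairmx X))) => [X|].
  by rewrite FE.
apply: csmooth_sum => k; apply: csmoothM; first exact: csmooth_pairmx.
exact: IH (hG k).
Qed.

Lemma csmooth_cpow s : smooth_off0 (fun X : 'cV[C]_N => cpow (rad X) s).
Proof.
have o := @open_neq0 (N + N).
have sl : smooth_on [set x : 'rV[R]_(N + N) | x != 0]
    (fun x => ln (rad (of_real_coords x))).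
  (* The logarithm of |X| is half that of the sum of squares, which spares the square root. *)
  have sq : smooth_on [set x : 'rV[R]_(N + N) | x != 0]
      (fun x => \sum_i x ord0 i * x ord0 i).
    by apply: (smooth_sum o) => i; apply: (smoothM o); exact: smooth_coord.
  have q0 (x : 'rV[R]_(N + N)) : x != 0 -> 0 < \sum_i x ord0 i * x ord0 i.
    move=> x0; have : 0 < euclid_norm x.
      by rewrite lt_neqAle eq_sym euclid_norm_eq0 x0 euclid_norm_ge0.
    by rewrite sqrtr_gt0; under eq_bigr do rewrite expr2.
  apply: (smooth_eq o _ (smoothM o (smooth_cst o 2^-1) (smooth_ln o q0 sq))) => x x0.
  have r0 : 0 < rad (of_real_coords x) by rewrite rad_gt0 of_real_coords_eq0.
  rewrite rad_coords in r0 *.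
  have -> : \sum_i x ord0 i * x ord0 i = euclid_norm x ^+ 2.
    rewrite sqr_sqrtr; first by under [RHS]eq_bigr do rewrite expr2.
    by apply: sumr_ge0 => i _; rewrite sqr_ge0.
  by rewrite lnXn // mulr2n; field.
have [c1 s1] := smooth_cos_sin o (smoothM o (smooth_cst o (complex.Im s)) sl).
have e1 := smooth_expR o (smoothM o (smooth_cst o (complex.Re s)) sl).
by split; [apply: (smooth_eq o _ (smoothM o e1 c1))|apply: (smooth_eq o _ (smoothM o e1 s1))].
Qed.

Lemma ext_Vinfty a b (delta : int) F : hom (a + b) F -> bideg a b F ->
  a%:Z - b%:Z = delta -> Vinfty mu delta (ext (a + b) F).
Proof.
move=> hF bF ab; split; first exact: csmoothM (csmooth_cpow _) (csmooth_hom hF).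
by move=> z X z0 X0; apply: ext_homogeneous.
Qed.

End ExtendedFunctions.

Section SphereMeasurability.
Variables (R : realType) (n' : nat).
Local Notation C := R[i].
Local Notation n := n'.+1.
Local Notation N := (n + n)%N.
Local Notation E := 'M[C]_(N, 2).
Implicit Types (F G : E -> C).

Definition cmeas (f : 'cV[C]_N -> C) :=
  hmeas (fun X => complex.Re (f X)) /\ hmeas (fun X => complex.Im (f X)).

Lemma cmeas_eq f g : f =1 g -> cmeas f -> cmeas g.
Proof. by move=> /funext ->. Qed.

Lemma cmeas_cst c : cmeas (fun=> c).
Proof. by split=> d T phi mphi; exact: measurable_cst. Qed.

Lemma cmeasD f g : cmeas f -> cmeas g -> cmeas (fun X => f X + g X).
Proof.
move=> [f1 f2] [g1 g2]; split=> d T phi mphi.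
  under eq_fun do rewrite ReD.
  by apply: measurable_funD; [exact: f1|exact: g1].
under eq_fun do rewrite ImD.
by apply: measurable_funD; [exact: f2|exact: g2].
Qed.

Lemma cmeasM f g : cmeas f -> cmeas g -> cmeas (fun X => f X * g X).
Proof.
move=> [f1 f2] [g1 g2]; split=> d T phi mphi.
  under eq_fun do rewrite ReM.
  by apply: measurable_funB; apply: measurable_funM; [exact: f1|exact: g1|exact: f2|exact: g2].
under eq_fun do rewrite ImM.
by apply: measurable_funD; apply: measurable_funM; [exact: f1|exact: g2|exact: f2|exact: g1].
Qed.

Lemma cmeas_sum (I : Type) (s : seq I) (f : I -> 'cV[C]_N -> C) :
  (forall i, cmeas (f i)) -> cmeas (fun X => \sum_(i <- s) f i X).
Proof.
move=> sF; elim: s => [|i s IH].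
  by apply: cmeas_eq (cmeas_cst 0) => X; rewrite big_nil.
by apply: cmeas_eq (cmeasD (sF i) IH) => X; rewrite big_cons.
Qed.

Lemma cmeas_coord k : cmeas (fun X : 'cV[C]_N => X k 0).
Proof.
split=> d T phi mphi.
  by under eq_fun do rewrite !mxE /=; exact: mphi.
by under eq_fun do rewrite !mxE /=; exact: mphi.
Qed.

Lemma cmeas_conj f : cmeas f -> cmeas (fun X => (f X)^*).
Proof.
move=> [f1 f2]; split=> d T phi mphi.
  by under eq_fun do rewrite ReJ; exact: f1.
by under eq_fun do rewrite ImJ; apply: measurableT_comp => //; exact: f2.
Qed.

Lemma cmeas_pairmx i j : cmeas (fun X => pairmx X i j).
Proof.
have [->|->] := ord2P j; last first.
  by apply: cmeas_eq (cmeas_coord i) => X; rewrite pairmx1E.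
apply: (@cmeas_eq (fun X => \sum_k Jmx C n i k * (X k 0)^*)) => [X|].
  by rewrite pairmx0E mxE; apply: eq_bigr => k _; congr (_ * _); rewrite mxE.
apply: cmeas_sum => k; apply: cmeasM; first exact: cmeas_cst.
exact: cmeas_conj (cmeas_coord k).
Qed.

Lemma cmeas_hom d F : hom d F -> cmeas (fun X => F (pairmx X)).
Proof.
elim: d F => [F [c Fc]|d IH F [G [hG FE]]].
  by apply: cmeas_eq (cmeas_cst c) => X; rewrite Fc.
apply: (@cmeas_eq (fun X => \sum_k pairmx X k.1 k.2 * G k (pairmx X))) => [X|].
  by rewrite FE.
apply: cmeas_sum => k; apply: cmeasM; first exact: cmeas_pairmx.
exact: IH (hG k).
Qed.

Definition sqmod (z : C) : R := complex.Re z ^+ 2 + complex.Im z ^+ 2.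

Lemma sqmod_ge0 z : 0 <= sqmod z.
Proof. by rewrite addr_ge0 ?sqr_ge0. Qed.

Lemma sqmod_eq0 z : (sqmod z == 0) = (z == 0).
Proof.
by rewrite /sqmod -Re_normc_sqr sqrf_eq0 -[RHS]normr_eq0 -normc_real eq_complex eqxx andbT.
Qed.

Lemma l2_sphereE f : l2_sphere f = sphere_integral (fun X : 'cV[C]_N => sqmod (f X)).
Proof. by []. Qed.

Lemma hmeas_sqmod f : cmeas f -> hmeas (fun X => sqmod (f X)).
Proof.
move=> [f1 f2] d T phi mphi.
by apply: measurable_funD; apply: measurable_funX; [exact: f1|exact: f2].
Qed.

Lemma sphere_integral_eq (h h' : 'cV[C]_N -> R) :
  (forall X, rad X = 0 \/ rad X = 1 -> h X = h' X) ->
  sphere_integral h = sphere_integral h'.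
Proof.
move=> hh'; rewrite !sphere_integralE; congr (_ * _)%E; apply: eq_iter_integral => x.
rewrite /ball_fun; case: ifP => // _; rewrite hh' // rad_coords.
have [->|x0] := eqVneq x 0; last by right; exact: euclid_norm_normalized.
by left; apply/eqP; rewrite euclid_norm_eq0 scaler0.
Qed.

Lemma pairmx_comb (Z : E) : exists A B : 'cV[C]_N, Z = pairmx A + 'i *: pairmx B.
Proof.
have [A [B [AB cAB]]] := conj_comb (col 0 Z) (col 1 Z) (Jmx_sqr C n).
exists A, B; apply/matrixP => i j; rewrite mxDZ; have [->|->] := ord2P j.
  by rewrite !pairmx0E -mxDZ -cAB mxE.
by rewrite !pairmx1E -mxDZ -AB mxE.
Qed.

Lemma pairmxD (X Y : 'cV[C]_N) (t : R) : pairmx (X + t%:C%C *: Y) = pairmx X + t%:C%C *: pairmx Y.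
Proof.
apply/matrixP => i j; rewrite mxDZ; have [->|->] := ord2P j.
  rewrite !pairmx0E map_mxD map_mxZ mulmxDr -scalemxAr mxDZ.
  by congr (_ + _ * _); apply: complex_ext; rewrite /= ?oppr0.
by rewrite !pairmx1E mxDZ.
Qed.

(** On the line through pairmx A in the direction pairmx B, F is a polynomial that vanishes at
    natural parameters, hence also at i, and every Z has the form pairmx A + i pairmx B. The
    obstacle is that nothing is known at X = 0. *)
Lemma hom_pairmx_eq0 d F : hom d F -> (forall X, X != 0 -> F (pairmx X) = 0) ->
  forall Z, F Z = 0.
Proof.
move=> hF F0.
have P A B : (forall k : nat, A + (k%:R : R)%:C%C *: B != 0) ->
    forall t, F (pairmx A + t *: pairmx B) = 0.
  move=> AB t; have [p [_ pE _ _]] := hom_line (pairmx A) (pairmx B) hF.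
  suff p0 : p = 0 by rewrite pE p0 horner0.
  apply: (poly_eq0_seq (x := fun k : nat => k%:R)); first exact: natr_inj.
  move=> k; rewrite -pE -(F0 _ (AB k)) pairmxD; congr (F (_ + _ *: _)).
  by rewrite rmorph_nat.
move=> Z; have [A [B ->]] := pairmx_comb Z.
(* If A + k0 B = 0, then Z = (i - k0) pairmx B lies on the line B + tB, whose natural points are
   nonzero unless B = 0. If B = 0, then Z = 0 is reached at t = -1 on such a line through a constant
   vector. *)
have [AB|/existsNP[k0 /negP]] := pselect (forall k : nat, A + (k%:R : R)%:C%C *: B != 0).
  exact: P.
rewrite negbK addr_eq0 => /eqP AE.
have [B0|B0] := eqVneq B 0.
  rewrite AE B0 !scaler0 oppr0.
  have D0 : (const_mx 1 : 'cV[C]_N) != 0.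
    by apply/eqP => /matrixP/(_ ord0 0)/eqP; rewrite !mxE oner_eq0.
  have := P (const_mx 1 : 'cV[C]_N) (const_mx 1) _ (-1); rewrite scaleN1r subrr => <-.
    rewrite (_ : pairmx 0 = 0) ?scaler0 ?addr0 //.
    by rewrite -[0 in LHS](scale0r (0 : 'cV[C]_N)) pairmxZ; apply/matrixP => i j; rewrite mul_mx_diag !mxE conjC0; case: ifP; rewrite mulr0.
  move=> k; rewrite -[X in X + _]scale1r -scalerDl scaler_eq0 (negbTE D0) orbF.
  by rewrite rmorph_nat nat1r pnatr_eq0.
have := P B B _ ('i - k0%:R - 1).
rewrite -[X in X + _]scale1r -scalerDl addrCA subrr addr0 => <-.
  rewrite AE -scaleNr -raddfN -[X in X + _]add0r.
  have /= := pairmxD 0 B (- k0%:R).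
  rewrite !add0r => ->.
  rewrite (_ : pairmx 0 = 0) ?add0r.
    by rewrite -scalerDl raddfN /= rmorph_nat addrC.
  by rewrite -[0 in LHS](scale0r (0 : 'cV[C]_N)) pairmxZ; apply/matrixP => i j; rewrite mul_mx_diag !mxE conjC0; case: ifP; rewrite mulr0.
move=> k; rewrite -[X in X + _]scale1r -scalerDl scaler_eq0 (negbTE B0) orbF.
by rewrite rmorph_nat nat1r pnatr_eq0.
Qed.

End SphereMeasurability.

(** * Embedding of bihomogeneous polynomials into the Hilbert space *)

Section Embedding.
Variables (R : realType) (n' : nat) (mu : R[i]) (delta : int).
Local Notation C := R[i].
Local Notation n := n'.+1.
Local Notation N := (n + n)%N.
Local Notation E := 'M[C]_(N, 2).
Variable P : @degenerate_principal_series R n mu delta.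
Local Notation ip := (dps_ip P).
Local Notation inj := (@dps_inj _ _ _ _ P).
Local Notation act := (@dps_act _ _ _ _ P).
Local Notation Vinf := (@Vinfty R n mu delta).
Implicit Types (F G : E -> C) (f : 'cV[C]_N -> C).

Lemma Vinfty_lin c f g : Vinf f -> Vinf g -> Vinf (fun X => c * f X + g X).
Proof.
move=> [sf hf] [sg hg]; split.
  by apply: csmoothD => //; apply: csmoothM => //; exact: csmooth_cst.
by move=> a X a0 X0; rewrite hf // hg // mulrDr mulrCA.
Qed.

Lemma Vinfty0 : Vinf (fun=> 0).
Proof. by split; [exact: csmooth_cst|move=> a X _ _; rewrite mulr0]. Qed.

Lemma Vinfty_eq f g : (forall X, X != 0 -> f X = g X) -> Vinf f -> Vinf g.
Proof.
move=> fg [[s1 s2] hf]; have o := @open_neq0 R (N + N); split.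
  split; [apply: (smooth_eq o _ s1)|apply: (smooth_eq o _ s2)];
    by move=> x x0; rewrite fg // of_real_coords_eq0.
by move=> a X a0 X0; rewrite -!fg ?hf // scaler_eq0 (negbTE a0).
Qed.

Lemma ip_dps_inj f : Vinf f -> exists2 r : R, l2_sphere f = r%:E & ip (inj f) (inj f) = r%:C%C.
Proof.
move=> Vf; exists (complex.Re `|inj f| ^+ 2); first by rewrite dps_inj_norm.
rewrite -dps_normE rmorphXn /=; congr (_ ^+ 2).
by apply: complex_ext => //=; have := normr_ge0 (inj f); rewrite lecE /= => /andP[/eqP ->].
Qed.

Lemma dps_inj_eq0 f : Vinf f -> l2_sphere f = 0%E -> inj f = 0.
Proof.
move=> Vf; have [r -> rE] := ip_dps_inj Vf; case=> r0.
by apply/eqP; rewrite -(dnorm_eq0 ip) rE r0.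
Qed.

(** The difference is supported at the origin, so its norm on the sphere is 0. *)
Lemma dps_inj_ext f g : Vinf f -> (forall X, X != 0 -> f X = g X) -> inj f = inj g.
Proof.
move=> Vf fg; have Vg := Vinfty_eq fg Vf.
have V := Vinfty_lin (-1) Vg Vf.
suff : inj (fun X => -1 * g X + f X) = 0.
  rewrite dps_inj_linear // scaleN1r addrC => /eqP; rewrite subr_eq0 => /eqP //.
apply: dps_inj_eq0 => //; apply: sphere_integral_off0 => [|X X0]; first by rewrite addn_gt0.
by rewrite fg // mulN1r addNr /= expr0n addr0.
Qed.

Lemma dps_inj_bound : exists2 K : R, 0 < K & forall f c, 0 <= c -> Vinf f ->
  (forall X, nrm2 X = 1 -> sqmod (f X) <= c) -> ip (inj f) (inj f) <= (K * c)%:C%C.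
Proof.
exists ((N + N)%:R * 2 ^+ (N + N)); first by rewrite mulr_gt0 ?exprn_gt0 // ltr0n addn_gt0.
move=> f c c0 Vf fc.
(* Resetting the value at 0, as [sphere_integral_le] demands, does not change the vector. *)
pose f0 X := if X == 0 then 0 else f X.
have ff0 X : X != 0 -> f X = f0 X by rewrite /f0 => /negbTE ->.
have Vf0 := Vinfty_eq ff0 Vf.
rewrite (dps_inj_ext Vf ff0); have [r rE ->] := ip_dps_inj Vf0.
rewrite lecR -lee_fin -rE l2_sphereE -mulrA [2 ^+ _ * c]mulrC.
apply: sphere_integral_le => // [X||X X1]; first exact: sqmod_ge0.
  by rewrite /f0 eqxx /sqmod /= expr0n addr0.
rewrite -ff0 ?fc // -nrm2_gt0 X1 //.
Qed.

Definition bihom a b F := hom (a + b) F /\ bideg a b F.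

Lemma bihomP a b c F G : bihom a b F -> bihom a b G -> bihom a b (fun Z => c * F Z + G Z).
Proof.
move=> [hF bF] [hG bG]; split; first exact: homP.
by move=> x y Z; rewrite bF bG mulrDr mulrCA.
Qed.

Lemma bihom0 a b : bihom a b (fun=> 0).
Proof. by split; [exact: hom0|move=> x y Z; rewrite mulr0]. Qed.

Lemma bihom_mulmx a b F g : bihom a b F -> bihom a b (fun Z => F (g *m Z)).
Proof.
move=> [hF bF]; split; last by move=> x y Z; rewrite mulmxA bF.
exact: (hom_lin (mulmx g) hF).
Qed.

Variables (a b : nat).
Hypothesis ab : a%:Z - b%:Z = delta.

Definition iota F := inj (ext mu (a + b) F).

Lemma bihom_Vinfty F : bihom a b F -> Vinf (ext mu (a + b) F).
Proof. by move=> [hF bF]; exact: ext_Vinfty. Qed.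

Lemma iota_lin c F G : bihom a b F -> bihom a b G ->
  iota (fun Z => c * F Z + G Z) = c *: iota F + iota G.
Proof.
move=> hF hG; rewrite -dps_inj_linear; try exact: bihom_Vinfty.
by congr inj; apply/funext => X; rewrite /ext mulrDr mulrCA.
Qed.

Lemma iota0 : iota (fun=> 0) = 0.
Proof.
have := iota_lin (-1) (bihom0 a b) (bihom0 a b).
rewrite scaleN1r addNr => <-; congr iota; apply/funext => Z; rewrite mulr0 addr0 //.
Qed.

Lemma iota_sum (I : Type) (s : seq I) (c : I -> C) (F : I -> E -> C) :
  (forall i, bihom a b (F i)) ->
  bihom a b (fun Z => \sum_(i <- s) c i * F i Z) /\
  iota (fun Z => \sum_(i <- s) c i * F i Z) = \sum_(i <- s) c i *: iota (F i).
Proof.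
move=> hF; elim: s => [|i s [hs IH]].
  rewrite (_ : (fun _ => _) = fun=> 0); first by rewrite big_nil iota0; split=> //; exact: bihom0.
  by apply/funext => Z; rewrite big_nil.
rewrite (_ : (fun Z => _) = fun Z => c i * F i Z + \sum_(i <- s) c i * F i Z).
  by rewrite big_cons iota_lin // IH; split=> //; exact: bihomP.
by apply/funext => Z; rewrite big_cons.
Qed.

Lemma iota_act g F : SpK g -> bihom a b F ->
  act g (iota F) = iota (fun Z => F (invmx g *m Z)).
Proof.
move=> gK hF; rewrite /iota dps_actE; [|exact: SpK_SpC|exact: bihom_Vinfty].
have gK' : SpK (invmx g) by rewrite (SpK_invmx gK); exact: (SpK_inv gK).
congr inj; apply/funext => X; rewrite /ext pairmx_mul // rad_unitary //.
by have [] := gK'.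
Qed.

Lemma iota_norm F : bihom a b F -> exists2 r : R,
  sphere_integral (fun X => sqmod (F (pairmx X))) = r%:E & ip (iota F) (iota F) = r%:C%C.
Proof.
move=> hF; have [r rE ipE] := ip_dps_inj (bihom_Vinfty hF); exists r => //.
by rewrite -rE; apply: sphere_integral_eq => X X1; rewrite ext_normalized.
Qed.

(** Equivariance of [pairmx] turns the substitution into one on the sphere, where the integral is
    invariant under unitary matrices. *)
Lemma iota_norm_inv g F : SpK g -> bihom a b F ->
  ip (iota (fun Z => F (g *m Z))) (iota (fun Z => F (g *m Z))) = ip (iota F) (iota F).
Proof.
move=> gK hF; have [r rE ->] := iota_norm hF.
have [r' + ->] := iota_norm (bihom_mulmx g hF).
under eq_fun do rewrite -pairmx_mul //.
rewrite (sphere_integral_unitary (h := fun X => sqmod (F (pairmx X)))).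
- by rewrite rE => -[->].
- by have [] := gK.
- by apply: hmeas_sqmod; have [hd _] := hF; exact: cmeas_hom hd.
- by move=> X; exact: sqmod_ge0.
Qed.

Lemma iota_ip_inv g F G : SpK g -> bihom a b F -> bihom a b G ->
  ip (iota (fun Z => F (g *m Z))) (iota (fun Z => G (g *m Z))) = ip (iota F) (iota G).
Proof.
move=> gK hF hG; apply: ip_polarization => x y.
have h F1 G1 : bihom a b F1 -> bihom a b G1 ->
    x *: iota F1 + y *: iota G1 = iota (fun Z => x * F1 Z + (y * G1 Z + 0)).
  move=> h1 h2; rewrite (iota_lin x h1 (bihomP y h2 (bihom0 a b))).
  by rewrite (iota_lin y h2 (bihom0 a b)) iota0 addr0.
rewrite !h //; try exact: bihom_mulmx.
exact: (iota_norm_inv gK (bihomP x hF (bihomP y hG (bihom0 a b)))).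
Qed.

(** A vanishing norm kills the continuous function |F|^2 on the sphere; the bidegree then kills F at
    all pairs (J conj X, X) with X nonzero, and these determine F. *)
Lemma iota_eq0 F : bihom a b F -> iota F = 0 -> forall Z, F Z = 0.
Proof.
move=> hF F0; have [r rE] := iota_norm hF; rewrite F0 ip0l => -[r0].
have [hd bF] := hF.
have F1 X : rad X = 1 -> F (pairmx X) = 0.
  move=> X1; apply/eqP; rewrite -sqmod_eq0; apply: contraT => Xn0.
  suff : (0 < sphere_integral (fun X => sqmod (F (pairmx X))))%E.
    by rewrite rE -r0 ltxx.
  apply: (sphere_integral_gt0 (x0 := re_coords X)).
  - by rewrite addn_gt0.
  - by move=> Y; exact: sqmod_ge0.
  - by rewrite -rad_coords re_coordsK.
  - have [/(_ 0%N) c1 /(_ 0%N) c2] := csmooth_hom hd.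
    have x0 : re_coords X != 0.
      by rewrite -of_real_coords_eq0 re_coordsK -rad_gt0 X1.
    have {}c1 := c1 _ x0; have {}c2 := c2 _ x0.
    apply: (@cvgD _ _ _ (nbhs (re_coords X)) (nbhs_filter _)).
      by apply: (@cvgM _ _ (nbhs (re_coords X)) (nbhs_filter _)); exact: c1.
    by apply: (@cvgM _ _ (nbhs (re_coords X)) (nbhs_filter _)); exact: c2.
  - by rewrite re_coordsK lt_neqAle eq_sym Xn0 sqmod_ge0.
apply: (hom_pairmx_eq0 hd) => X X0.
have r0' : 0 < rad X by rewrite rad_gt0.
have -> : X = (rad X)%:C%C *: ((rad X)^-1%:C%C *: X).
  by rewrite scalerA -rmorphM /= mulfV ?gt_eqF // scale1r.
rewrite pairmxZ bF F1 ?mulr0 // -[X in _ *: X]re_coordsK -of_real_coordsZ rad_coords.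
rewrite -[X in rad X]re_coordsK rad_coords euclid_norm_normalized //.
by rewrite -of_real_coords_eq0 re_coordsK.
Qed.

End Embedding.

(** * Density *)

Section BernoulliApproximation.
Variables (R : realType) (m : nat).
Implicit Types (x y : 'rV[R]_m) (G : 'rV[R]_m -> R).

Definition bsign (b : bool) : R := if b then 1 else -1.

(* Product law of k independent signs of mean x_j for each coordinate j, and
   the vector of empirical means of a sample. *)
Definition bweight k x (w : {ffun 'I_m * 'I_k -> bool}) : R :=
  \prod_i ((1 + bsign (w i) * x 0 i.1) / 2).

Definition bmean k (w : {ffun 'I_m * 'I_k -> bool}) : 'rV[R]_m :=
  \row_j (k%:R^-1 * \sum_l bsign (w (j, l))).

(** The multivariate Bernstein operator on the cube [-1, 1]^m, written as an expectation; it is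
    polynomial in x because the weights are. *)
Definition bernoulli k G x : R := \sum_w bweight (k := k) x w * G (bmean w).

Lemma sum_ffun_bool (I : finType) (F : I -> bool -> R) :
  \sum_(w : {ffun I -> bool}) \prod_i F i (w i) = \prod_i (F i true + F i false).
Proof.
rewrite -(bigA_distr_bigA (fun i b => F i b)).
by apply: eq_bigr => i _; rewrite big_bool.
Qed.

Lemma sum_bweight k x : \sum_w bweight (k := k) x w = 1.
Proof.
rewrite /bweight (sum_ffun_bool (fun i b => (1 + bsign b * x 0 i.1) / 2)).
by apply: big1 => i _; rewrite /bsign; field.
Qed.

Lemma bweight_ge0 k x w : (forall j, `|x 0 j| <= 1) -> 0 <= bweight (k := k) x w.
Proof.
move=> x1; apply: prodr_ge0 => i _; rewrite divr_ge0 //.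
by have := x1 i.1; rewrite ler_norml /bsign; case: (w i); lra.
Qed.

(** Independence: the sum over sign patterns factors over the indices, and for distinct l and l' a
    centred factor of mean zero appears. *)
Lemma bweight_cov k x j l l' :
  \sum_w bweight (k := k) x w * ((bsign (w (j, l)) - x 0 j) * (bsign (w (j, l')) - x 0 j))
  = if l == l' then 1 - x 0 j ^+ 2 else 0.
Proof.
pose F (i : 'I_m * 'I_k) b : R := (1 + bsign b * x 0 i.1) / 2 *
  ((if i == (j, l) then bsign b - x 0 j else 1) *
   (if i == (j, l') then bsign b - x 0 j else 1)).
transitivity (\sum_(w : {ffun 'I_m * 'I_k -> bool}) \prod_i F i (w i)).
  apply: eq_bigr => w _; rewrite big_split [X in _ = _ * X]big_split /=.
  by rewrite -!big_mkcond !big_pred1_eq.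
rewrite sum_ffun_bool (bigD1 (j, l)) //= {}/F.
have [<-|ll'] := eqVneq l l'.
  rewrite big1 => [|i ij]; last by rewrite (negbTE ij) /bsign; field.
  by rewrite eqxx /bsign; field.
have jl : ((j, l) == (j, l')) = false by rewrite xpair_eqE eqxx (negbTE ll').
by rewrite eqxx jl /bsign; rewrite [X in X * _](_ : _ = 0) ?mul0r //; field.
Qed.

Lemma bweight_var k x j : (0 < k)%N ->
  \sum_w bweight (k := k) x w * (bmean w 0 j - x 0 j) ^+ 2 = (1 - x 0 j ^+ 2) / k%:R.
Proof.
move=> k0; have kn0 : k%:R != 0 :> R by rewrite pnatr_eq0 -lt0n.
have E w : (bmean w 0 j - x 0 j) ^+ 2 =
    k%:R^-1 ^+ 2 * \sum_(l < k) \sum_(l' < k)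
      ((bsign (w (j, l)) - x 0 j) * (bsign (w (j, l')) - x 0 j)).
  rewrite -big_distrlr /= -expr2 -exprMn; congr (_ ^+ 2).
  by rewrite mxE sumrB sumr_const card_ord -mulr_natl; field.
under eq_bigr do rewrite E mulrCA big_distrr /=.
rewrite -big_distrr exchange_big /=.
under [X in _ * X]eq_bigr => l _.
  under eq_bigr do rewrite big_distrr /=.
  rewrite exchange_big /=.
  under eq_bigr do rewrite bweight_cov.
  rewrite -big_mkcond /= (big_pred1 l) => [|i]; last by rewrite /= eq_sym.
  over.
by rewrite sumr_const card_ord -mulr_natl; field.
Qed.

(** Chebyshev's argument: take the expectation of the quadratic majorant and bound each variance (1
    - x_j^2)/k by 1/k. *)
Lemma bernoulli_approx k G x (e c : R) : (0 < k)%N -> (forall j, `|x 0 j| <= 1) ->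
  0 <= c -> (forall y, `|G y - G x| <= e + c * \sum_j (y 0 j - x 0 j) ^+ 2) ->
  `|bernoulli k G x - G x| <= e + c * m%:R / k%:R.
Proof.
move=> k0 x1 c0 Gx; have w0 w := bweight_ge0 (k := k) w x1.
have -> : bernoulli k G x - G x = \sum_w bweight (k := k) x w * (G (bmean w) - G x).
  under [RHS]eq_bigr do rewrite mulrBr.
  by rewrite sumrB -mulr_suml sum_bweight mul1r.
apply: (le_trans (ler_norm_sum _ _ _)).
apply: (@le_trans _ _ (\sum_w (bweight (k := k) x w * e +
    c * \sum_j bweight (k := k) x w * (bmean w 0 j - x 0 j) ^+ 2))).
  apply: ler_sum => w _; rewrite normrM ger0_norm // -mulr_sumr mulrCA -mulrDr.
  by apply: ler_wpM2l.
rewrite big_split /= -mulr_suml sum_bweight mul1r lerD2l -mulr_sumr -mulrA.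
apply: ler_wpM2l => //; rewrite exchange_big /=.
apply: (@le_trans _ _ (\sum_(j < m) k%:R^-1)); last by rewrite sumr_const card_ord mulr_natl.
apply: ler_sum => j _; rewrite bweight_var //.
rewrite ler_pdivrMr ?ltr0n // mulVf ?pnatr_eq0 -?lt0n //.
by have := sqr_ge0 (x 0 j); lra.
Qed.

Definition usphere := [set x : 'rV[R]_m | euclid_norm x = 1].

Lemma compact_usphere : compact usphere.
Proof.
apply: bounded_closed_compact.
  exists 1; split; first exact: num_real.
  move=> M M1 x xS; rewrite /Num.norm /= mx_normrE.
  apply/bigmax_leP; split; first by apply: le_trans (ltW M1).
  move=> [i j] _ /=; rewrite ord1; apply: le_trans (ltW M1); rewrite -xS.
  exact: le_coord_euclid_norm.
apply: (@preimage_closed _ _ (@euclid_norm R m) [set 1]).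
  by move=> x _; exact: continuous_euclid_norm.
exact: closed_eq.
Qed.

(** Uniform continuity on the compact sphere with y allowed off the sphere, since empirical means
    need not be unit vectors. *)
Lemma usphere_modulus G (e : R) : 0 < e ->
  (forall x, usphere x -> G y @[y --> x] --> G x) ->
  exists2 d, 0 < d & forall x y, usphere x -> (forall j, `|y 0 j - x 0 j| < d) ->
    `|G y - G x| <= e.
Proof.
move=> e0 cG.
have := (compact_near_coveringP usphere).1 compact_usphere R (0 : R)^'+
  (fun d x => forall y, (forall j, `|y 0 j - x 0 j| < d) -> `|G y - G x| <= e) _.
case=> [x xS|d /= d0 Hd].
  have /nbhs_ballP [r /= r0 Hr] : \forall y \near x, `|G y - G x| < e / 2.
    have /cvgrPdist_lt /(_ (e / 2)) := cG x xS.
    by under eq_near do rewrite distrC; apply; rewrite divr_gt0.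
  near=> x' d => y /= yx'.
  have x'x : ball x (r / 2) x' by near: x'; apply: nbhsx_ballx; rewrite divr_gt0.
  have dr : d < r / 2 by near: d; apply: nbhs_right_lt; rewrite divr_gt0.
  have hx' : `|G x' - G x| < e / 2.
    by apply: Hr; apply: le_ball x'x; lra.
  have hy : `|G y - G x| < e / 2.
    apply: Hr; split=> // i j; rewrite ord1; have [_ /(_ ord0 j)] := x'x.
    rewrite /ball /= => h1; have h2 := yx' j.
    have -> : x 0 j - y 0 j = (x 0 j - x' 0 j) + (x' 0 j - y 0 j) by ring.
    apply: le_lt_trans (ler_normD _ _) _; rewrite distrC in h2.
    by have := ltrD h1 h2; lra.
  have -> : G y - G x' = (G y - G x) - (G x' - G x) by ring.
  by apply: le_trans (ler_normB _ _) _; lra.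
exists (d / 2); first by rewrite divr_gt0.
move=> x y xS yx; apply: (Hd (d / 2)) => //=.
- by rewrite sub0r normrN ger0_norm; lra.
- by lra.
Unshelve. all: by end_near. Qed.

Lemma usphere_bounded G : (forall x, usphere x -> G y @[y --> x] --> G x) ->
  exists2 M, 0 <= M & forall x, usphere x -> `|G x| <= M.
Proof.
move=> cG.
have := (compact_near_coveringP usphere).1 compact_usphere R +oo
  (fun M x => `|G x| <= M) _.
case=> [x xS|M /= [Mr HM]].
  near=> x' M; apply: (@le_trans _ _ (`|G x| + 1)).
    have : `|G x - G x'| < 1 by near: x'; move/cvgrPdist_lt: (cG x xS); apply.
    have := ler_normB (G x) (G x - G x'); rewrite opprB addrC subrK; lra.
  by rewrite /=; near: M; exact: nbhs_pinfty_ge.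
exists (Num.max 0 (M + 1)); first by rewrite le_max lexx.
move=> x xS; apply: (le_trans (HM (M + 1) _ x xS)); first by rewrite ltrDl.
by rewrite le_max lexx orbT.
Unshelve. all: by end_near. Qed.

Lemma usphere_approx G (e : R) : 0 < e ->
  (forall x, usphere x -> G y @[y --> x] --> G x) ->
  (forall y, y != 0 -> G y = G ((euclid_norm y)^-1 *: y)) ->
  exists2 k, (0 < k)%N & forall x, usphere x -> `|bernoulli k G x - G x| <= e.
Proof.
move=> e0 cG hG; have e20 : 0 < e / 2 by rewrite divr_gt0.
have [d d0 Hd] := usphere_modulus e20 cG.
have [M' M0' HM'] := usphere_bounded cG.
(* G is constant along rays, so its bound on the sphere holds everywhere except at 0, where G is
   arbitrary. *)
pose M : R := M' + `|G 0|; have M0 : 0 <= M by rewrite addr_ge0.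
have HM y : `|G y| <= M.
  have [->|y0] := eqVneq y 0; first by rewrite lerDr.
  rewrite hG // (le_trans (HM' _ _)) ?lerDl //; exact: euclid_norm_normalized.
(* If some coordinate differs by at least d, then c |y - x|^2 is at least 2M and dominates |G y - G
   x|. The integer k is then chosen so that c m / k <= e/2. *)
pose c := 2 * M / d ^+ 2; have c0 : 0 <= c by rewrite divr_ge0 ?sqr_ge0 // mulr_ge0.
pose k := (Num.truncn (2 * c * m%:R / e)).+1.
have k0 : 0 < k%:R :> R by rewrite ltr0n.
exists k => // x xS.
have x1 j : `|x 0 j| <= 1 by rewrite -xS; exact: le_coord_euclid_norm.
apply: (@le_trans _ _ (e / 2 + c * m%:R / k%:R)); last first.
  have : 2 * c * m%:R / e < k%:R by exact: truncnS_gt.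
  rewrite ltr_pdivrMr // => h.
  suff : c * m%:R / k%:R <= e / 2 by lra.
  by rewrite ler_pdivrMr //; lra.
apply: bernoulli_approx => // y.
have S0 : 0 <= \sum_j (y 0 j - x 0 j) ^+ 2 by apply: sumr_ge0 => j _; exact: sqr_ge0.
have [yx|/existsNP [j /negP]] := pselect (forall j, `|y 0 j - x 0 j| < d).
  by apply: le_trans (Hd x y xS yx) _; rewrite lerDl mulr_ge0.
rewrite -leNgt => dj; apply: (@le_trans _ _ (2 * M)).
  by apply: le_trans (ler_normB _ _) _; have := HM y; have := HM x; lra.
apply: (@le_trans _ _ (c * d ^+ 2)).
  by rewrite /c divfK // sqrf_eq0 gt_eqF.
suff : c * d ^+ 2 <= c * \sum_j (y 0 j - x 0 j) ^+ 2 by lra.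
apply: ler_wpM2l => //; rewrite (bigD1 j) //= -[(y 0 j - _) ^+ 2]real_normK ?num_real //.
apply: (@le_trans _ _ (`|y 0 j - x 0 j| ^+ 2)).
  by rewrite lerXn2r // nnegrE // ltW.
by rewrite lerDl; apply: sumr_ge0 => i _; exact: sqr_ge0.
Qed.

End BernoulliApproximation.

Section RootsOfUnity.
Variable C : numClosedFieldType.

Lemma prim_root_exists M : (0 < M)%N -> exists z : C, M.-primitive_root z.
Proof.
move=> M0; pose p : {poly C} := 'X^M - 1; have [r Dp] := closed_field_poly_normal p.
rewrite (monicP _) ?monicXnsubC // scale1r in Dp.
have rn1 : all M.-unity_root r by apply/allP => z; rewrite -root_prod_XsubC -Dp.
have sz_r : (M < (size r).+1)%N by rewrite -(size_prod_XsubC r id) -Dp size_XnsubC.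
have [|z] := hasP (cyclic.has_prim_root M0 rn1 _ sz_r); last by exists z.
by rewrite -separable.separable_prod_XsubC -Dp cyclotomic.separable_Xn_sub_1 // pnatr_eq0 -lt0n.
Qed.

Lemma norm_prim_root M (z : C) : M.-primitive_root z -> `|z| = 1.
Proof.
move=> zM; have M0 := prim_order_gt0 zM.
apply/eqP; rewrite -(@pexpr_eq1 _ _ M) //; first by rewrite -normrX (prim_expr_order zM) normr1.
Qed.

Lemma prim_root_sum M (z : C) (d : int) : M.-primitive_root z -> (`|d| < M)%N ->
  \sum_(k < M) (z ^ d) ^+ k = if d == 0 then M%:R else 0.
Proof.
move=> zM dM; have [->|d0] := eqVneq d 0.
  under eq_bigr do rewrite expr0z expr1n.
  by rewrite sumr_const card_ord.
have w1 : z ^ d != 1.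
  apply/negP => zd; have {zd} : z ^+ `|d| = 1.
    case: d zd {dM d0} => k; first by rewrite -exprnP => /eqP.
    by rewrite NegzE -exprnN invr_eq1 => /eqP.
  move/eqP; rewrite -(prim_order_dvd zM) => /dvdn_leq.
  by rewrite absz_gt0 d0 leqNgt dM => /(_ isT).
apply: (mulfI (x := z ^ d - 1)); first by rewrite subr_eq0.
rewrite -subrX1 mulr0 [_ ^+ M]exprnP exprz_exp mulrC -exprz_exp -exprnP.
by rewrite (prim_expr_order zM) exp1rz subrr.
Qed.

Lemma norm_expz_unit (z : C) (d : int) : `|z| = 1 -> `|z ^ d| = 1.
Proof.
move=> z1; case: d => d; last by rewrite NegzE -exprnN normfV normrX z1 expr1n invr1.
by rewrite -exprnP normrX z1 expr1n.
Qed.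

Lemma expz_unit (z : C) (a b : nat) : `|z| = 1 -> z^* ^+ a * z ^+ b = z ^ (b%:Z - a%:Z).
Proof.
move=> z1; have z0 : z != 0 by rewrite -normr_gt0 z1.
have -> : z^* = z^-1 by rewrite -[RHS]mulr1 -(expr1n _ 2) -z1 normCK mulKf.
by rewrite expfzDr // -exprnP -exprnN mulrC exprVn.
Qed.

Lemma expz_unit_pow (z : C) (d : int) (a b k : nat) : `|z| = 1 ->
  (z ^ d) ^+ k * ((z ^+ k)^* ^+ a * z ^+ k ^+ b) = (z ^ (d + (b%:Z - a%:Z))) ^+ k.
Proof.
move=> z1; have z0 : z != 0 by rewrite -normr_gt0 z1.
rewrite expz_unit ?normrX ?z1 ?expr1n // [in RHS]expfzDr // exprMn; congr (_ * _).
by rewrite exprnP exprz_exp mulrC -exprz_exp.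
Qed.

Lemma expz_unit_cancel (z : C) (d : int) (k : nat) : `|z| = 1 ->
  (z ^ d) ^+ k * (z ^+ k) ^ (- d) = 1.
Proof.
move=> z1; have z0 : z != 0 by rewrite -normr_gt0 z1.
by rewrite exprnP exprz_exp [z ^+ k]exprnP exprz_exp -expfzDr // mulrN mulrC subrr.
Qed.

End RootsOfUnity.

(** * Polynomials on the sphere and extraction of the phase delta *)

Section SphericalPolynomials.
Variables (R : realType) (n' : nat).
Local Notation C := R[i].
Local Notation n := n'.+1.
Local Notation N := (n + n)%N.
Local Notation E := 'M[C]_(N, 2).
Implicit Types (q f : 'cV[C]_N -> C) (F G : E -> C).

(* Polynomial functions of X and its conjugate, as sums of bihomogeneous
   functions of the pair (J conj X, X). *)
Definition pol q := exists (T : finType) (a b : T -> nat) (F : T -> E -> C),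
  (forall t, bihom (a t) (b t) (F t)) /\ forall X, q X = \sum_t F t (pairmx X).

Lemma pol_eq q f : q =1 f -> pol q -> pol f.
Proof. by move=> /funext ->. Qed.

Lemma pol_bihom a b F : bihom a b F -> pol (fun X => F (pairmx X)).
Proof.
move=> hF; exists unit, (fun=> a), (fun=> b), (fun=> F); split=> // X.
by rewrite big_const card_unit /= addr0.
Qed.

Lemma pol_cst c : pol (fun=> c).
Proof.
apply: (@pol_bihom 0 0 (fun=> c)); split; first by exists c.
by move=> x y Z; rewrite !expr0 !mul1r.
Qed.

Lemma polD q f : pol q -> pol f -> pol (fun X => q X + f X).
Proof.
move=> [T [a [b [F [hF qE]]]]] [T' [a' [b' [F' [hF' fE]]]]].
exists (T + T')%type, (fun s => match s with inl t => a t | inr t => a' t end),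
  (fun s => match s with inl t => b t | inr t => b' t end),
  (fun s => match s with inl t => F t | inr t => F' t end).
by split=> [[]|X] //; rewrite qE fE big_sumType.
Qed.

Lemma bihom_mul a b a' b' F G : bihom a b F -> bihom a' b' G ->
  bihom (a + a') (b + b') (fun Z => F Z * G Z).
Proof.
move=> [hF bF] [hG bG]; split; first by rewrite addnACA; exact: hom_mul.
by move=> x y Z; rewrite bF bG !exprD; move: (F Z) (G Z) => u v;
   rewrite mulrACA [X in X * _]mulrACA.
Qed.

Lemma polM q f : pol q -> pol f -> pol (fun X => q X * f X).
Proof.
move=> [T [a [b [F [hF qE]]]]] [T' [a' [b' [F' [hF' fE]]]]].
exists (T * T')%type, (fun s => a s.1 + a' s.2)%N, (fun s => b s.1 + b' s.2)%N,
  (fun s Z => F s.1 Z * F' s.2 Z).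
split=> [s|X]; first exact: bihom_mul.
by rewrite qE fE big_distrlr /= pair_bigA.
Qed.

Lemma pol_sum I (s : seq I) (F : I -> 'cV[C]_N -> C) : (forall i, pol (F i)) ->
  pol (fun X => \sum_(i <- s) F i X).
Proof.
move=> hF; elim: s => [|i s IH].
  by apply: pol_eq (pol_cst 0) => X; rewrite big_nil.
by apply: pol_eq (polD (hF i) IH) => X; rewrite big_cons.
Qed.

Lemma pol_prod I (s : seq I) (F : I -> 'cV[C]_N -> C) : (forall i, pol (F i)) ->
  pol (fun X => \prod_(i <- s) F i X).
Proof.
move=> hF; elim: s => [|i s IH].
  by apply: pol_eq (pol_cst 1) => X; rewrite big_nil.
by apply: pol_eq (polM (hF i) IH) => X; rewrite big_cons.
Qed.

Lemma pol_coord k : pol (fun X => X k 0).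
Proof.
apply: (@pol_eq (fun X => pairmx X k 1)) => [X|]; first by rewrite pairmx1E.
apply: (@pol_bihom 0 1 (fun Z => Z k 1)); split; first exact: hom_entry.
by move=> x y Z; rewrite mul_mx_diag !mxE /= expr0 mul1r mulrC.
Qed.

Lemma pol_conj_coord k : pol (fun X => (X k 0)^*).
Proof.
apply: (@pol_eq (fun X => \sum_j - Jmx C n k j * pairmx X j 0)) => [X|].
  have -> : (X k 0)^* = (- Jmx C n *m col 0 (pairmx X)) k 0.
    rewrite (col_pairmx X).1 mulmxA mulNmx Jmx_sqr opprK mul1mx mxE //.
  rewrite [RHS]mxE; apply: eq_bigr => j _.
  by rewrite [in RHS]mxE [col 0 _ _ _]mxE.
apply: pol_sum => j; apply: polM; first exact: pol_cst.
apply: (@pol_bihom 1 0 (fun Z => Z j 0)); split; first exact: hom_entry.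
by move=> x y Z; rewrite mul_mx_diag !mxE /= expr0 mulr1 mulrC.
Qed.

Lemma pol_re_coords i : pol (fun X => (re_coords X ord0 i)%:C%C).
Proof.
have half (x y : R) : (x%:C%C : C) = 2^-1 * (Complex x y + Complex x (- y)).
  rewrite (_ : 2^-1 = (2^-1 : R)%:C%C); last by rewrite fmorphV rmorph_nat.
  by apply: complex_ext; rewrite /= ?mul0r; field.
have halfi (x y : R) : (y%:C%C : C) = Complex 0 (- 2^-1) * (Complex x y + -1 * Complex x (- y)).
  by apply: complex_ext; rewrite /= ?mul0r; field.
rewrite -(splitK i); case: (fintype.split i) => j /=.
  apply: (@pol_eq (fun X => 2^-1 * (X j 0 + (X j 0)^*))) => [X|].
    rewrite /re_coords row_mxEl mxE; move: (X j 0) => -[x y]; exact: esym (half x y).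
  apply: polM; first exact: pol_cst.
  by apply: polD; [exact: pol_coord|exact: pol_conj_coord].
apply: (@pol_eq (fun X => Complex 0 (- 2^-1) * (X j 0 + -1 * (X j 0)^*))) => [X|].
  rewrite /re_coords row_mxEr mxE; move: (X j 0) => -[x y]; exact: esym (halfi x y).
apply: polM; first exact: pol_cst.
apply: polD; first exact: pol_coord.
apply: polM; [exact: pol_cst|exact: pol_conj_coord].
Qed.

Lemma pol_bernoulli k (G : 'rV[R]_(N + N) -> R) : pol (fun X => (bernoulli k G (re_coords X))%:C%C).
Proof.
pose q (X : 'cV[C]_N) : C := \sum_(w : {ffun 'I_(N + N) * 'I_k -> bool})
  (\prod_i ((1 + (bsign R (w i))%:C%C * (re_coords X ord0 i.1)%:C%C) * (2^-1 : R)%:C%C))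
  * (G (bmean R w))%:C%C.
apply: (@pol_eq q) => [X|].
  rewrite /q /bernoulli /bweight rmorph_sum; apply: eq_bigr => w _.
  rewrite rmorphM rmorph_prod; congr (_ * _); apply: eq_bigr => i _.
  by rewrite rmorphM rmorphD rmorphM.
apply: pol_sum => w; apply: polM; last exact: pol_cst.
apply: pol_prod => i; apply: polM; last exact: pol_cst.
apply: polD; first exact: pol_cst.
by apply: polM; [exact: pol_cst|exact: pol_re_coords].
Qed.

(** The mean of z^delta F(zX) over M-th roots of unity z keeps exactly the bidegrees with a - b =
    delta. It fixes f, which already has this phase, and cannot increase the uniform error on the
    sphere. *)
Lemma pol_average (delta : int) (T : finType) (a b : T -> nat) (F : T -> E -> C) f (e : C) :
  (forall t, bihom (a t) (b t) (F t)) ->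
  (forall z X, `|z| = 1 -> X != 0 -> f (z *: X) = z ^ (- delta) * f X) ->
  (forall X, rad X = 1 -> `|\sum_t F t (pairmx X) - f X| <= e) ->
  forall X, rad X = 1 ->
    `|\sum_(t | (a t)%:Z - (b t)%:Z == delta) F t (pairmx X) - f X| <= e.
Proof.
move=> hF hf he X X1.
have X0 : X != 0 by rewrite -rad_gt0 X1.
(* Larger than every |delta + b t - a t|, so that a nonzero exponent is never a multiple of M. *)
pose M := (\sum_t (a t + b t) + `|delta|).+1%N.
have [z zM] := prim_root_exists C (ltn0Sn (\sum_t (a t + b t) + `|delta|)).
rewrite -/M in zM; have z1 := norm_prim_root zM.
have z0 : z != 0 by rewrite -normr_gt0 z1.
have Mn0 : M%:R != 0 :> C by rewrite pnatr_eq0.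
have zk1 k : `|z ^+ k| = 1 by rewrite normrX z1 expr1n.
have Ft t k : (z ^ delta) ^+ k * F t (pairmx (z ^+ k *: X)) =
    (z ^ (delta + ((b t)%:Z - (a t)%:Z))) ^+ k * F t (pairmx X).
  have [_ bF] := hF t; rewrite pairmxZ bF mulrA; congr (_ * _).
  exact: expz_unit_pow.
have ft k : (z ^ delta) ^+ k * f (z ^+ k *: X) = f X.
  by rewrite hf // mulrA expz_unit_cancel // mul1r.
have key : M%:R * (\sum_(t | (a t)%:Z - (b t)%:Z == delta) F t (pairmx X) - f X) =
    \sum_(k < M) (z ^ delta) ^+ k * (\sum_t F t (pairmx (z ^+ k *: X)) - f (z ^+ k *: X)).
  under [RHS]eq_bigr do rewrite mulrBr ft mulr_sumr.
  rewrite sumrB sumr_const card_ord mulrBr [M%:R * f X]mulr_natl; congr (_ - _).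
  rewrite exchange_big /= mulr_sumr [LHS]big_mkcond /=; apply: eq_bigr => t _.
  under [RHS]eq_bigr do rewrite Ft.
  rewrite -mulr_suml prim_root_sum //.
    have -> : (delta + ((b t)%:Z - (a t)%:Z) == 0) = ((a t)%:Z - (b t)%:Z == delta).
      by rewrite -opprB subr_eq0 eq_sym.
    by case: ifP => // _; rewrite mul0r.
  rewrite /M ltnS [in X in (_ <= X)%N](bigD1 t) //=; move: (a t) (b t) => u v; lia.
have : `|M%:R * (\sum_(t | (a t)%:Z - (b t)%:Z == delta) F t (pairmx X) - f X)| <= M%:R * e.
  rewrite key; apply: (le_trans (ler_norm_sum _ _ _)).
  apply: (@le_trans _ _ (\sum_(k < M) e)); last by rewrite sumr_const card_ord mulr_natl.
  apply: ler_sum => k _; rewrite normrM normrX.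
  have -> : `|z ^ delta| = 1.
    exact: norm_expz_unit.
  rewrite expr1n mul1r; apply: he.
  by rewrite radZ zk1 /= mul1r.
by rewrite normrM ger0_norm // ler_pM2l // ltr0n.
Qed.

End SphericalPolynomials.

Section Density.
Variables (R : realType) (n' : nat) (mu : R[i]) (delta : int).
Local Notation C := R[i].
Local Notation n := n'.+1.
Local Notation N := (n + n)%N.
Local Notation E := 'M[C]_(N, 2).
Variable P : @degenerate_principal_series R n mu delta.
Local Notation ip := (dps_ip P).
Local Notation inj := (@dps_inj _ _ _ _ P).
Local Notation Vinf := (@Vinfty R n mu delta).

Lemma cvg_normalize m (y : 'rV[R]_m) : y != 0 ->
  (euclid_norm x)^-1 *: x @[x --> y] --> (euclid_norm y)^-1 *: y.
Proof.
move=> y0; apply: (@cvgZ _ _ _ (nbhs y) (nbhs_filter y)); last exact: cvg_id.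
apply: (@cvgV _ _ (nbhs y) (nbhs_filter y) (@euclid_norm R _)).
  by rewrite euclid_norm_eq0.
exact: continuous_euclid_norm.
Qed.

(** Real and imaginary parts, extended from the sphere as constants along rays, are approximated
    separately within e/2. *)
Lemma Vinfty_approx f (e : R) : Vinf f -> 0 < e ->
  exists (T : finType) (a b : T -> nat) (F : T -> E -> C),
    (forall t, bihom (a t) (b t) (F t)) /\
    (forall X, rad X = 1 -> `|\sum_t F t (pairmx X) - f X| <= e%:C%C).
Proof.
move=> [[s1 s2] hf] e0.
have appr (r : C -> R) :
    smooth_on [set x : 'rV[R]_(N + N) | x != 0] (fun x => r (f (of_real_coords x))) ->
    exists2 q, pol q & forall X, rad X = 1 ->
      exists2 u : R, q X = u%:C%C & `|u - r (f X)| <= e / 2.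
  move=> sr; pose G x := r (f (of_real_coords ((euclid_norm x)^-1 *: x))).
  have [|x xS|y y0|k k0 Hk] := @usphere_approx R (N + N) G (e / 2).
  - by rewrite divr_gt0.
  - have x0 : x != 0 by rewrite -euclid_norm_eq0 xS oner_eq0.
    have cx := cvg_normalize x0.
    have n0 : (euclid_norm x)^-1 *: x != 0 by rewrite xS invr1 scale1r.
    exact: (cvg_comp _ _ cx (sr 0%N _ n0)).
  - by rewrite /G (euclid_norm_normalized y0) invr1 scale1r.
  exists (fun X => (bernoulli k G (re_coords X))%:C%C); first exact: pol_bernoulli.
  move=> X X1; exists (bernoulli k G (re_coords X)) => //.
  have XS : usphere (re_coords X) by rewrite /usphere /= -rad_coords re_coordsK.
  have := Hk _ XS; rewrite /G [euclid_norm _]XS invr1 scale1r re_coordsK //.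
have [q1 p1 H1] := appr _ s1; have [q2 p2 H2] := appr _ s2.
have [T [a [b [F [hF qE]]]]] : pol (fun X => q1 X + 'i%C * q2 X).
  by apply: polD => //; apply: polM => //; exact: pol_cst.
exists T, a, b, F; split=> // X X1; rewrite -qE.
have [u -> hu] := H1 X X1; have [v -> hv] := H2 X X1.
have -> : u%:C%C + 'i%C * v%:C%C - f X =
    (u - complex.Re (f X))%:C%C + 'i%C * (v - complex.Im (f X))%:C%C.
  by move: (f X) => -[x y]; apply: complex_ext => /=; ring.
apply: (le_trans (ler_normD _ _)); rewrite normrM normCi mul1r.
have normR (x : R) : `|x%:C%C| = `|x|%:C%C :> C.
  by rewrite normc_def /= expr0n addr0 sqrtr_sqr.
by rewrite !normR -rmorphD lecR; lra.
Qed.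

Lemma Vinfty_sum (T : Type) (s : seq T) (Q : pred T) (G : T -> 'cV[C]_N -> C) :
  (forall t, Q t -> Vinf (G t)) ->
  Vinf (fun X => \sum_(t <- s | Q t) G t X) /\
  inj (fun X => \sum_(t <- s | Q t) G t X) = \sum_(t <- s | Q t) inj (G t).
Proof.
move=> hG; elim: s => [|t s [VS IH]].
  rewrite (_ : (fun _ => _) = fun=> 0).
    rewrite big_nil; split; first exact: Vinfty0.
    apply: dps_inj_eq0; first exact: Vinfty0.
    by apply: sphere_integral_off0 => [|X _]; rewrite ?addn_gt0 //= expr0n addr0.
  by apply/funext => X; rewrite big_nil.
case Qt : (Q t); last first.
  by rewrite big_cons Qt (_ : (fun _ => _) = fun X => \sum_(t <- s | Q t) G t X) //;
     apply/funext => X; rewrite big_cons Qt.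
rewrite big_cons Qt (_ : (fun _ => _) = fun X => 1 * G t X + \sum_(t <- s | Q t) G t X).
  by split; [apply: Vinfty_lin => //; exact: hG|rewrite dps_inj_linear ?scale1r ?IH //; exact: hG].
by apply/funext => X; rewrite big_cons Qt mul1r.
Qed.

Lemma iota_dense f (e : R) : Vinf f -> 0 < e ->
  exists (T : finType) (a b : T -> nat) (F : T -> E -> C),
    (forall t, bihom (a t) (b t) (F t)) /\
    let d := inj f - \sum_(t | (a t)%:Z - (b t)%:Z == delta) iota P (a t) (b t) (F t) in
    ip d d < e%:C%C.
Proof.
move=> Vf e0; have [K K0 HK] := dps_inj_bound P.
(* The minimum with 1 gives e1^2 <= e1, which bounds the squared error; the other bound gives K e1
   <= e/2. *)
pose e1 := Num.min 1 (e / (2 * K)).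
have e10 : 0 < e1 by rewrite lt_min ltr01 divr_gt0 // mulr_gt0.
have [T [a [b [F [hF HF]]]]] := Vinfty_approx Vf e10.
exists T, a, b, F; split=> //.
have hf (z : C) X : `|z| = 1 -> X != 0 -> f (z *: X) = z ^ (- delta) * f X.
  move=> z1 X0; have [_ ->] := Vf; rewrite ?z1 // -?normr_gt0 ?z1 //.
  by rewrite [complex.Re 1]/= cpow1 mul1r divr1.
have Hd := pol_average hF hf HF.
have VG t : (a t)%:Z - (b t)%:Z == delta -> Vinf (ext mu (a t + b t) (F t)).
  by move=> /eqP ab; exact: bihom_Vinfty.
have [VS injS] := Vinfty_sum (index_enum T) VG.
rewrite /= -injS.
have -> : inj f - inj (fun X => \sum_(t | (a t)%:Z - (b t)%:Z == delta) ext mu (a t + b t) (F t) X) =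
    inj (fun X => -1 * \sum_(t | (a t)%:Z - (b t)%:Z == delta) ext mu (a t + b t) (F t) X + f X).
  by rewrite dps_inj_linear // scaleN1r addrC.
apply: (@le_lt_trans _ _ (K * e1)%:C%C); last first.
  rewrite ltcR; apply: (@le_lt_trans _ _ (e / 2)); last by lra.
  by rewrite mulrC -ler_pdivlMr // -mulrA -invfM ge_min lexx orbT.
apply: HK; [exact: ltW|exact: Vinfty_lin|move=> X X1].
have rX : rad X = 1 by rewrite /rad X1 sqrtr1.
rewrite (eq_bigr (fun t => F t (pairmx X))) => [|t _]; last first.
  by rewrite ext_normalized //; right.
have := Hd X rX; rewrite distrC mulN1r [X in sqmod X]addrC.
move: (f X - _) => z hz; rewrite /sqmod -Re_normc_sqr.
have {hz} : complex.Re `|z| <= e1 by rewrite -lecR normc_real.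
have := Re_normc_ge0 z; move: (complex.Re _) => r r0 re.
apply: (@le_trans _ _ (e1 * 1)); last by rewrite mulr1.
rewrite expr2 ler_pM // (le_trans re) // ge_min lexx //.
Qed.

End Density.

(** * Irreducible subrepresentations *)

Section Schur.
Variables (C : numClosedFieldType) (n : nat).
Implicit Types (V W : unitary_rep C n).

Definition rep_hom V W (A : 'M[C]_(rep_dim W, rep_dim V)) :=
  forall g, SpK g -> A *m rep_mx V g = rep_mx W g *m A.

Lemma schur_inj V W (A : 'M[C]_(rep_dim W, rep_dim V)) : irreducible_rep V ->
  rep_hom A -> A = 0 \/ forall v : 'cV_(rep_dim V), A *m v = 0 -> v = 0.
Proof.
move=> [_ iV] hA; pose f : 'Hom('cV[C]_(rep_dim V), 'cV[C]_(rep_dim W)) := linfun (mulmx A).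
have kE v : (v \in lker f) = (A *m v == 0) by rewrite memv_ker lfunE.
case: (iV (lker f)) => [g gK v|k0|kT].
- by rewrite !kE => /eqP v0; rewrite mulmxA hA // -mulmxA v0 mulmx0.
- by right=> v /eqP; rewrite -kE k0 memv0 => /eqP.
- left; apply/trmx_inj/row_matrixP => i; rewrite trmx0 row0 -tr_col colE.
  by apply/eqP; rewrite -trmx0 (inj_eq trmx_inj) -kE kT memvf.
Qed.

Lemma schur_surj V W (A : 'M[C]_(rep_dim W, rep_dim V)) : irreducible_rep W ->
  rep_hom A -> A = 0 \/ forall w : 'cV_(rep_dim W), exists v, w = A *m v.
Proof.
move=> [_ iW] hA; pose f : 'Hom('cV[C]_(rep_dim V), 'cV[C]_(rep_dim W)) := linfun (mulmx A).
case: (iW (limg f)) => [g gK w /memv_imgP [v _ ->]|k0|kT].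
- by rewrite lfunE /= mulmxA -hA // -mulmxA; apply/memv_imgP;
    exists (rep_mx V g *m v); rewrite ?memvf // lfunE.
- left; apply/trmx_inj/row_matrixP => i; rewrite trmx0 row0 -tr_col colE.
  apply/eqP; rewrite -trmx0 (inj_eq trmx_inj) -memv0 -k0; apply/memv_imgP.
  by exists (delta_mx i 0); rewrite ?memvf // lfunE.
- right=> w; have : w \in limg f by rewrite kT memvf.
  by case/memv_imgP => v _ ->; exists v; rewrite lfunE.
Qed.

Lemma eigenvector_exists d (M : 'M[C]_d) : (0 < d)%N ->
  exists c (v : 'cV[C]_d), v != 0 /\ M *m v = c *: v.
Proof.
move=> d0; have : size (char_poly M^T) != 1%N by rewrite size_char_poly eqSS -lt0n.
case/closed_rootP => c; rewrite -eigenvalue_root_char => /eigenvalueP [v vM v0].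
exists c, v^T; rewrite -trmx0 (inj_eq trmx_inj); split=> //.
by rewrite -[M]trmxK -trmx_mul vM linearZ.
Qed.

Lemma rep_hom_lin V W (A B : 'M[C]_(rep_dim W, rep_dim V)) c :
  rep_hom A -> rep_hom B -> rep_hom (A + c *: B).
Proof.
by move=> hA hB g gK; rewrite mulmxDl mulmxDr -scalemxAl -scalemxAr hA ?hB.
Qed.

(** B is onto. For a right inverse B' of B and an eigenvector v of B'A with eigenvalue c, A v = B B'
    A v = c B v, so A - cB is not injective and vanishes. *)
Lemma schur_scalar V W (A B : 'M[C]_(rep_dim W, rep_dim V)) :
  irreducible_rep V -> irreducible_rep W -> rep_hom A -> rep_hom B -> B != 0 ->
  exists c, A = c *: B.
Proof.
move=> iV iW hA hB B0.
have [/eqP|Bs] := schur_surj iW hB; first by rewrite (negbTE B0).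
have [B' B'E] : exists B' : 'M[C]_(rep_dim V, rep_dim W), B *m B' = 1%:M.
  have [b bE] := choice (fun j => Bs (delta_mx j 0)).
  exists (\matrix_(i, j) b j i 0); apply/trmx_inj/row_matrixP => j.
  rewrite -!tr_col; congr (_^T); rewrite !colE -mulmxA -colE mul1mx bE.
  by congr (_ *m _); apply/colP => i; rewrite !mxE.
have [c [v [v0 vE]]] := eigenvector_exists (B' *m A) iV.1.
exists c; apply/eqP; rewrite -subr_eq0 -scaleNr.
have [->//|inj] := schur_inj iV (rep_hom_lin (- c) hA hB).
move: v0; rewrite (inj v) ?eqxx //.
by rewrite mulmxDl -scalemxAl scaleNr scalemxAr -vE !mulmxA B'E mul1mx subrr.
Qed.

Lemma lex_lt_irr (la nu : 'I_n -> int) : lex_lt nu la -> lex_lt la nu -> False.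
Proof.
move=> [i [ie il]] [j [je jl]].
case: (ltngtP i j) => [ij|ji|/val_inj e].
- by have := je i ij; move: il => /[swap] ->; rewrite ltxx.
- by have := ie j ji; move: jl => /[swap] ->; rewrite ltxx.
- by subst j; have := lt_trans il jl; rewrite ltxx.
Qed.

Lemma schur_weight V W (A : 'M[C]_(rep_dim W, rep_dim V)) la :
  irreducible_rep V -> irreducible_rep W -> rep_hom A -> A != 0 ->
  is_weight V la <-> is_weight W la.
Proof.
move=> iV iW hA A0.
have [/eqP|Ai] := schur_inj iV hA; first by rewrite (negbTE A0).
have [/eqP|As] := schur_surj iW hA; first by rewrite (negbTE A0).
have tK (t : 'rV[C]_n) : (forall k, `|t 0 k| = 1) -> SpK (torus_mx t).
  by move=> t1; exact: torus_SpK.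
split=> [[v v0 vE]|[w w0 wE]].
  exists (A *m v); first by apply: contra_neq v0; exact: Ai.
  by move=> t t1; rewrite mulmxA -(hA _ (tK t t1)) -mulmxA vE // -scalemxAr.
have [v wv] := As w; exists v; first by apply: contra_neq w0; rewrite wv => ->; rewrite mulmx0.
move=> t t1; apply/eqP; rewrite -subr_eq0; apply/eqP/Ai.
by rewrite mulmxBr mulmxA (hA _ (tK t t1)) -mulmxA -wv wE // -scalemxAr -wv subrr.
Qed.

(** A nonzero homomorphism of irreducibles transports weights both ways, so each highest weight
    dominates the other lexicographically. *)
Lemma schur_highest V W (A : 'M[C]_(rep_dim W, rep_dim V)) la nu :
  irreducible_rep V -> irreducible_rep W -> rep_hom A -> A != 0 ->
  highest_weight V la -> highest_weight W nu -> la =1 nu.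
Proof.
move=> iV iW hA A0 [wV mV] [wW mW].
have wVW l := schur_weight l iV iW hA A0.
case: (mW la ((wVW la).1 wV)) => // l1.
case: (mV nu ((wVW nu).2 wW)) => [e k|l2]; first by rewrite e.
by case: (lex_lt_irr l1 l2).
Qed.

End Schur.

Section LinearIndependence.
Variable C : fieldType.

Lemma row_relation (I : finType) r (c : 'M[C]_(r, #|I|)) : (#|I| < r)%N ->
  exists2 x : 'rV[C]_r, x != 0 & x *m c = 0.
Proof.
move=> Ir; have : kermx c != 0.
  by rewrite -mxrank_eq0 mxrank_ker subn_eq0 -ltnNge (leq_ltn_trans (rank_leq_col c)).
case/rowV0Pn => x xk x0; exists x => //; exact/sub_kermxP.
Qed.

(** Points are added one at a time: a nonzero x in the kernel of the current evaluation matrix gives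
    a nonzero combination of the B i, and any point where it does not vanish raises the rank. *)
Lemma eval_points (T : Type) r (B : 'I_r -> T -> C) :
  (forall x : 'rV[C]_r, (forall t, \sum_i x 0 i * B i t = 0) -> x = 0) ->
  exists p : 'I_r -> T, \matrix_(i, k) B i (p k) \in unitmx.
Proof.
move=> Bi; suff : forall k, (k <= r)%N ->
    exists p : 'I_k -> T, row_free ((\matrix_(l, i) B i (p l)) : 'M[C]_(k, r)).
  case/(_ r (leqnn r)) => p; rewrite row_free_unit -unitmx_tr => pU; exists p.
  by rewrite (_ : (\matrix_(i, k) _) = (\matrix_(l, i) B i (p l))^T) //;
     apply/matrixP => i j; rewrite !mxE.
elim=> [|k IH] kr.
  exists (fun i : 'I_0 => match notF (valP i) with end).
  by rewrite -row_leq_rank.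
have [p pf] := IH (ltnW kr); set M := (\matrix_(l, i) B i (p l)) in pf.
have : cokermx M != 0.
  by rewrite -mxrank_eq0 mxrank_coker subn_eq0 -ltnNge (leq_ltn_trans (rank_leq_row M)).
move=> /eqP/matrixP/existsNP[i0] /existsNP[j0]; rewrite [X in _ <> X]mxE => Mij.
pose x : 'rV[C]_r := (col j0 (cokermx M))^T.
have Mx : M *m x^T = 0 by rewrite trmxK colE mulmxA mulmx_coker mul0mx.
have [t xt] : exists t, \sum_i x 0 i * B i t != 0.
  apply: contrapT => /forallNP h; apply: Mij.
  have /rowP/(_ i0) : x = 0 by apply: Bi => t; have /negP/negPn/eqP := h t.
  by rewrite [LHS]mxE [LHS]mxE [RHS]mxE.
exists (fun l : 'I_k.+1 => if unlift ord_max l is Some l' then p l' else t).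
apply: inj_row_free => v v0.
have vE i : \sum_(l < k) v 0 (lift ord_max l) * M l i + v 0 ord_max * B i t = 0.
  have := congr1 (fun m : 'rV_r => m 0 i) v0; rewrite mxE big_ord_recr /= !mxE.
  rewrite unlift_none => e; rewrite -[RHS]e; congr (_ + _); apply: eq_bigr => l _; rewrite !mxE.
  have -> : widen_ord (leqnSn k) l = lift ord_max l by apply: val_inj; rewrite /= /bump leqNgt ltn_ord.
  by rewrite liftK.
have vm : v 0 ord_max = 0.
  have : \sum_i x 0 i * (\sum_(l < k) v 0 (lift ord_max l) * M l i + v 0 ord_max * B i t) = 0.
    by apply: big1 => i _; rewrite vE mulr0.
  under eq_bigr do rewrite mulrDr mulr_sumr.
  rewrite big_split exchange_big /= big1 => [|l _].
    under eq_bigr do rewrite mulrCA.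
    by rewrite add0r -mulr_sumr => /eqP; rewrite mulf_eq0 (negbTE xt) orbF => /eqP.
  have := congr1 (fun m : 'cV_k => m l 0) Mx; rewrite [LHS]mxE [RHS]mxE => e.
  transitivity (v 0 (lift ord_max l) * 0); last exact: mulr0.
  rewrite -[in RHS]e mulr_sumr; apply: eq_bigr => i _.
  by rewrite [x^T _ _]mxE mulrCA [M l i * _]mulrC.
have vl : \row_l v 0 (lift ord_max l) *m M = 0.
  apply/rowP => i; rewrite !mxE -[RHS](vE i) vm mul0r addr0.
  by apply: eq_bigr => l _; rewrite mxE.
have vl0 := row_free_inj pf (etrans vl (esym (mul0mx _ M))).
apply/rowP => l; case: (unliftP ord_max l) => [l' ->|->]; rewrite mxE //.
by have := congr1 (fun m : 'rV_k => m 0 l') vl0; rewrite !mxE.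
Qed.

End LinearIndependence.

Section HomogeneousSpan.
Variables (C : numFieldType) (N r : nat).
Local Notation E := 'M[C]_(N, r).

Lemma hom_span d : exists (I : finType) (B : I -> E -> C),
  forall F, hom d F -> exists c : I -> C, forall Z, F Z = \sum_i c i * B i Z.
Proof.
elim: d => [|d [I [B IH]]].
  exists unit, (fun _ _ => 1) => F [c Fc]; exists (fun=> c) => Z.
  by rewrite big_const card_unit /= addr0 mulr1.
exists ('I_N * 'I_r * I)%type, (fun k (Z : E) => Z k.1.1 k.1.2 * B k.2 Z) => F [G [hG FE]].
have [c cE] := choice (fun k => IH _ (hG k)).
exists (fun k => c k.1 k.2) => Z; rewrite FE.
rewrite (eq_bigr (fun k : 'I_N * 'I_r => \sum_i c k i * (Z k.1 k.2 * B i Z))).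
  by rewrite pair_bigA.
by move=> k _; rewrite cE mulr_sumr; apply: eq_bigr => i _; rewrite mulrCA.
Qed.

End HomogeneousSpan.

(** * Orthonormal bases of spaces of bihomogeneous polynomials *)

Section OrthonormalBases.
Variables (R : realType) (n' : nat) (mu : R[i]) (delta : int).
Local Notation C := R[i].
Local Notation n := n'.+1.
Local Notation N := (n + n)%N.
Local Notation E := 'M[C]_(N, 2).
Variable P : @degenerate_principal_series R n mu delta.
Local Notation ip := (dps_ip P).
Variables (a b : nat).
Hypothesis ab : a%:Z - b%:Z = delta.
Local Notation iota := (iota P a b).
Implicit Types (F G : E -> C) (W : set (E -> C)).

Definition onf W r (B : 'I_r -> E -> C) := (forall i, W (B i)) /\
  forall i j, ip (iota (B i)) (iota (B j)) = (i == j)%:R.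

Definition onb W r (B : 'I_r -> E -> C) := onf W B /\
  forall F, W F -> forall Z, F Z = \sum_i ip (iota F) (iota (B i)) * B i Z.

Lemma ip_iota_sum W r (B : 'I_r -> E -> C) (c : 'I_r -> C) j :
  W `<=` bihom a b -> onf W B ->
  ip (iota (fun Z => \sum_i c i * B i Z)) (iota (B j)) = c j.
Proof.
move=> Wb [WB Bon].
have [_ ->] := iota_sum P ab (index_enum _) c (fun i => Wb _ (WB i)).
rewrite ip_suml (bigD1 j) //= ipZl Bon eqxx mulr1 big1 ?addr0 // => i ij.
by rewrite ipZl Bon (negbTE ij) mulr0.
Qed.

Lemma onf_indep W r (B : 'I_r -> E -> C) (c : 'I_r -> C) :
  W `<=` bihom a b -> onf W B -> (forall Z, \sum_i c i * B i Z = 0) ->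
  forall i, c i = 0.
Proof.
move=> Wb oB c0 i; rewrite -(ip_iota_sum c i Wb oB).
rewrite (_ : (fun Z => _) = fun=> 0); last exact/funext.
by rewrite iota0 // ip0l.
Qed.

(** Take an orthonormal family of maximal length, bounded because homogeneous functions of fixed
    degree have a finite spanning set. A nonzero remainder of F after projection, once normalised,
    would lengthen it. *)
Lemma onb_exists W : subsp W -> W `<=` bihom a b ->
  exists r (B : 'I_r -> E -> C), onb W B.
Proof.
move=> sW Wb; have [I [D HD]] := @hom_span C N 2 (a + b).
have bound r (B : 'I_r -> E -> C) : onf W B -> (r <= #|I|)%N.
  move=> oB; rewrite leqNgt; apply/negP => Ir.
  have [c cE] := choice (fun i => HD _ (Wb _ (oB.1 i)).1).
  have [x x0 xc] := row_relation (\matrix_(i, k) c i (enum_val k)) Ir.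
  case/negP: x0; apply/eqP/rowP => i; rewrite mxE.
  apply: (onf_indep Wb oB (c := fun i => x 0 i)) => Z.
  under eq_bigr do rewrite cE mulr_sumr.
  rewrite exchange_big /= big1 // => t _.
  have := congr1 (fun m : 'rV_#|I| => m 0 (enum_rank t)) xc.
  rewrite [LHS]mxE [RHS]mxE => e.
  transitivity (0 * D t Z); last exact: mul0r.
  rewrite -[in RHS]e mulr_suml.
  by apply: eq_bigr => k _; rewrite mxE enum_rankK mulrA.
have ex : exists r, `[< exists B : 'I_r -> E -> C, onf W B >].
  exists 0%N; apply/asboolP; exists (fun _ _ => 0); split=> i; first exact: sW.1.
  by case: i.
have bd r : `[< exists B : 'I_r -> E -> C, onf W B >] -> (r <= #|I|)%N.
  by move=> /asboolP [B oB]; exact: bound oB.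
case: (ex_maxnP ex bd) => r /asboolP [B oB] rmax.
exists r, B; split=> // F WF.
pose G Z := -1 * (\sum_i ip (iota F) (iota (B i)) * B i Z) + F Z.
have WS : W (fun Z => \sum_i ip (iota F) (iota (B i)) * B i Z).
  exact: (subsp_sum _ _ sW oB.1).
have WG : W G by apply: sW.2.
suff G0 Z : G Z = 0 by move=> Z; apply/eqP; rewrite -subr_eq0 addrC -mulN1r; apply/eqP/G0.
apply: (iota_eq0 (P := P) ab (Wb _ WG)).
apply: contrapT => /eqP Gn0.
have g0 : 0 < ip (iota G) (iota G) by rewrite (dnorm_gt0 ip).
pose s := (sqrtC (ip (iota G) (iota G)))^-1.
have GB j : ip (iota G) (iota (B j)) = 0.
  rewrite /G (iota_lin P ab _ (Wb _ WS) (Wb _ WF)) ipDl ipZl.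
  by rewrite (ip_iota_sum _ _ Wb oB) mulN1r addNr.
have iG : iota (fun Z => s * G Z) = s *: iota G.
  have -> : (fun Z => s * G Z) = (fun Z => s * G Z + 0).
    by apply/funext => Y; rewrite addr0.
  by rewrite (iota_lin P ab s (Wb _ WG) (bihom0 _ _ a b)) iota0 // addr0.
suff : `[< exists B' : 'I_r.+1 -> E -> C, onf W B' >] by move/rmax; rewrite ltnn.
apply/asboolP.
exists (fun i => if unlift ord_max i is Some j then B j else fun Z => s * G Z).
split=> [i|i j].
  by case: unliftP => [k _|_]; [exact: oB.1|exact: subspZ].
case: (unliftP ord_max i) => [k ->|->]; case: (unliftP ord_max j) => [l ->|->].
- by rewrite oB.2 (inj_eq lift_inj).
- by rewrite iG ipZr ipC GB conjC0 mulr0 eq_sym (negbTE (neq_lift _ _)).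
- by rewrite iG ipZl GB mulr0 (negbTE (neq_lift _ _)).
rewrite iG ipZl ipZr eqxx /s.
have s0 : 0 <= (sqrtC (ip (iota G) (iota G)))^-1 by rewrite invr_ge0 sqrtC_ge0 ltW.
rewrite (geC0_conj s0) mulrA -expr2 exprVn sqrtCK mulVf // gt_eqF //.
Qed.

End OrthonormalBases.

Section MatrixContinuity.
Variable C : numClosedFieldType.
Local Open Scope sesquilinear_scope.

Lemma continuous_mx (T : topologicalType) m p (f : T -> 'M[C]_(m, p)) :
  (forall i j, continuous (fun x => f x i j : C)) -> continuous f.
Proof.
move=> cf x A /= [Q HQ QA].
have : \forall y \near x, forall ij : 'I_m * 'I_p, Q ij.1 ij.2 (f y ij.1 ij.2).
  by apply: filter_forall => -[i j] /=; apply: cf; exact: HQ.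
by apply: filterS => y Qy; apply: QA => i j; exact: (Qy (i, j)).
Qed.

Lemma continuous_sum (T : topologicalType) (I : Type) (s : seq I) (f : I -> T -> C) :
  (forall i, continuous (f i)) -> continuous (fun x => \sum_(i <- s) f i x : C).
Proof. by move=> cf x; apply: cvg_big => [|i _]; [exact: add_continuous|exact: cf]. Qed.

Lemma continuous_conj : continuous (fun z : C => z^* : C).
Proof.
move=> z; apply/(@cvgrPdist_lt _ _ _ _ (nbhs_filter z)) => e e0; near=> y.
rewrite -conjcB norm_conjC; near: y.
by move/(@cvgrPdist_lt _ _ _ _ (nbhs_filter z)) : (@cvg_id _ (nbhs z)); apply.
Unshelve. all: by end_near. Qed.

Lemma continuous_hom N r d (F : 'M[C]_(N, r) -> C) : hom d F -> continuous F.
Proof.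
elim: d F => [F [c Fc] x|d IH F [G [hG FE]]].
  by rewrite (_ : F = fun=> c); [exact: cst_continuous|exact/funext].
rewrite (_ : F = fun Z => \sum_k Z k.1 k.2 * G k Z); last exact/funext.
apply: continuous_sum => k x; apply: (@cvgM _ _ (nbhs x) (nbhs_filter x)).
  exact: coord_continuous.
exact: IH (hG k) x.
Qed.

(** On [SpK] the inverse is the conjugate transpose, which is continuous on all matrices. *)
Lemma continuous_hom_tconj N r d (F : 'M[C]_(N, r) -> C) Z : hom d F ->
  continuous (fun g : 'M[C]_N => F (g^t* *m Z)).
Proof.
move=> hF g.
apply: (@continuous_comp _ _ _ (fun g : 'M[C]_N => g^t* *m Z) F); last first.
  exact: (continuous_hom hF).
apply: continuous_mx => {}i {}j h.
rewrite (_ : (fun _ => _) = fun g : 'M[C]_N => \sum_l (g l i)^* * Z l j); last first.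
  by apply/funext => x; rewrite mxE; apply: eq_bigr => l _; rewrite !mxE.
apply: continuous_sum => l x; apply: (@cvgM _ _ (nbhs x) (nbhs_filter x)); last exact: cvg_cst.
apply: (@continuous_comp _ _ _ (fun g : 'M[C]_N => g l i) (fun z : C => z^* : C)).
  exact: coord_continuous.
exact: continuous_conj.
Qed.

(* The matrix coefficients are linear combinations of values at fixed points. *)
Lemma coef_continuous N r m d (B : 'I_r -> 'M[C]_(N, m) -> C) (D : set 'M[C]_N)
    (rho : 'M[C]_N -> 'M[C]_r) : (forall j, hom d (B j)) ->
  (forall x : 'rV[C]_r, (forall Z, \sum_i x 0 i * B i Z = 0) -> x = 0) ->
  (forall g j Z, D g -> B j (g^t* *m Z) = \sum_i rho g i j * B i Z) ->
  {within D, continuous rho}.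
Proof.
move=> hB Bi rhoE; have [p pU] := eval_points Bi.
set M := \matrix_(i, k) _ in pU.
pose Q (g : 'M[C]_N) : 'M[C]_r := \matrix_(k, j) B j (g^t* *m p k).
apply: (@subspace_eq_continuous _ _ _ (fun g => invmx M^T *m Q g)).
  move=> g /set_mem gD; rewrite /from_subspace.
  have -> : Q g = M^T *m rho g.
    apply/matrixP => k j; rewrite mxE rhoE // mxE.
    by apply: eq_bigr => i _; rewrite !mxE mulrC.
  by rewrite mulKmx // unitmx_tr.
apply: continuous_subspaceT; apply: continuous_mx => i j.
rewrite (_ : (fun _ => _) = fun g => \sum_k invmx M^T i k * B j (g^t* *m p k)); last first.
  by apply/funext => g; rewrite mxE; apply: eq_bigr => k _; rewrite [Q g _ _]mxE.
apply: continuous_sum => k g; apply: (@cvgM _ _ (nbhs g) (nbhs_filter g)); first exact: cvg_cst.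
exact: (@continuous_hom_tconj N m d (B j) (p k) (hB j) g).
Qed.

End MatrixContinuity.

(** * The unitary representation carried by a stable subspace *)

Section SubRepresentation.
Variables (R : realType) (n' : nat) (mu : R[i]) (delta : int).
Local Notation C := R[i].
Local Notation n := n'.+1.
Local Notation N := (n + n)%N.
Local Notation E := 'M[C]_(N, 2).
Local Open Scope sesquilinear_scope.
Variable P : @degenerate_principal_series R n mu delta.
Local Notation ip := (dps_ip P).
Local Notation act := (@dps_act _ _ _ _ P).
Variables (a b : nat).
Hypothesis ab : a%:Z - b%:Z = delta.
Local Notation iota := (iota P a b).
Variables (W : set (E -> C)) (r : nat) (B : 'I_r -> E -> C).
Hypotheses (sW : subsp W) (kW : kstab W) (Wb : W `<=` bihom a b) (oB : onb P a b W B).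

Definition sub_mx (g : 'M[C]_N) : 'M[C]_r :=
  \matrix_(i, j) ip (act g (iota (B j))) (iota (B i)).

Definition sub_fun (v : 'cV[C]_r) (Z : E) : C := \sum_i v i 0 * B i Z.

Definition sub_emb (v : 'cV[C]_r) := iota (sub_fun v).

Lemma sub_funW v : W (sub_fun v).
Proof. exact: (subsp_sum _ _ sW oB.1.1). Qed.

Lemma sub_fun_bihom v : bihom a b (sub_fun v).
Proof. exact: Wb (sub_funW v). Qed.

Lemma sub_fun_lin c v w Z : sub_fun (c *: v + w) Z = c * sub_fun v Z + sub_fun w Z.
Proof.
rewrite /sub_fun mulr_sumr -big_split; apply: eq_bigr => i _.
by rewrite !mxE mulrDl mulrA.
Qed.

Lemma ip_sub_emb v i : ip (sub_emb v) (iota (B i)) = v i 0.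
Proof. exact: (ip_iota_sum ab _ _ Wb oB.1). Qed.

Lemma sub_emb_inj v : (forall Z, sub_fun v Z = 0) -> v = 0.
Proof.
move=> v0; apply/colP => i; rewrite mxE.
exact: (onf_indep ab Wb oB.1 (c := fun i => v i 0)).
Qed.

Lemma sub_embE v : sub_emb v = \sum_i v i 0 *: iota (B i).
Proof.
by have [_] := iota_sum P ab (index_enum _) (fun i => v i 0) (fun i => Wb (oB.1.1 i)).
Qed.

Lemma sub_emb_lin : linear sub_emb.
Proof.
move=> c v w; rewrite /sub_emb -(iota_lin P ab _ (sub_fun_bihom v) (sub_fun_bihom w)).
by rewrite (_ : sub_fun _ = fun Z => c * sub_fun v Z + sub_fun w Z) //;
   apply/funext => Z; exact: sub_fun_lin.
Qed.

Lemma ip_sub_emb2 v w : ip (sub_emb v) (sub_emb w) = \sum_i v i 0 * (w i 0)^*.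
Proof.
rewrite [X in ip _ X]sub_embE ip_sumr; apply: eq_bigr => i _.
by rewrite ipZr ip_sub_emb mulrC.
Qed.

Lemma SpK_invmx' g : SpK g -> SpK (invmx g : 'M[C]_N).
Proof. by move=> gK; rewrite (SpK_invmx gK); exact: (SpK_inv gK). Qed.

Lemma sub_fun_surj F : W F -> exists v, F = sub_fun v.
Proof.
move=> WF; exists (\col_i ip (iota F) (iota (B i))); apply/funext => Z.
by rewrite (oB.2 _ WF); apply: eq_bigr => i _; rewrite mxE.
Qed.

Lemma sub_mx_basis g j : SpK g ->
  (fun Z => B j (invmx g *m Z)) = sub_fun (col j (sub_mx g)).
Proof.
move=> gK; apply/funext => Z.
rewrite (oB.2 _ (kW (SpK_invmx' gK) (oB.1.1 j))); apply: eq_bigr => i _.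
by rewrite !mxE (iota_act P ab gK (Wb (oB.1.1 j))).
Qed.

Lemma sub_fun_act g v : SpK g ->
  (fun Z => sub_fun v (invmx g *m Z)) = sub_fun (sub_mx g *m v).
Proof.
move=> gK; apply/funext => Z; rewrite {1}/sub_fun.
under eq_bigr => j _ do rewrite [B j _](congr1 (@^~ Z) (sub_mx_basis j gK)) /sub_fun mulr_sumr.
rewrite exchange_big /=; apply: eq_bigr => i _; rewrite mxE mulr_suml.
by apply: eq_bigr => j _; rewrite !mxE mulrA [v j 0 * _]mulrC.
Qed.

Lemma sub_emb_act g v : SpK g -> sub_emb (sub_mx g *m v) = act g (sub_emb v).
Proof.
move=> gK; rewrite /sub_emb (iota_act P ab gK (sub_fun_bihom v)).
by rewrite -(sub_fun_act v gK).
Qed.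

Lemma sub_fun_inj v w : sub_fun v = sub_fun w -> v = w.
Proof.
move=> vw; apply/eqP; rewrite -subr_eq0 addrC -scaleN1r; apply/eqP/sub_emb_inj => Z.
by rewrite sub_fun_lin vw mulN1r addNr.
Qed.

Lemma sub_mx_mul g h : SpK g -> SpK h -> sub_mx (g *m h) = sub_mx g *m sub_mx h.
Proof.
move=> gK hK; apply/matrixP => i j.
have : sub_fun (sub_mx (g *m h) *m delta_mx j 0) = sub_fun (sub_mx g *m sub_mx h *m delta_mx j 0).
  rewrite -mulmxA -(sub_fun_act _ (SpK_mul gK hK)) -(sub_fun_act _ gK) -(sub_fun_act _ hK).
  apply/funext => Z.
  have -> : invmx (g *m h) = invmx h *m invmx g.
    rewrite (SpK_invmx (SpK_mul gK hK)) (SpK_invmx gK) (SpK_invmx hK).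
    by rewrite trmx_mul map_mxM.
  by rewrite mulmxA.
by move/sub_fun_inj; rewrite -!colE => /colP/(_ i); rewrite mxE [RHS]mxE.
Qed.

Lemma sub_mx1 : sub_mx 1%:M = 1%:M.
Proof.
apply/matrixP => i j.
have : sub_fun (sub_mx 1%:M *m delta_mx j 0) = sub_fun (1%:M *m delta_mx j 0).
  rewrite -sub_fun_act; last exact: SpK_1.
  by apply/funext => Z; rewrite invmx1 !mul1mx.
by move/sub_fun_inj; rewrite -!colE => /colP/(_ i); rewrite mxE [RHS]mxE.
Qed.

Lemma sub_mx_unitary g : SpK g -> sub_mx g \is unitarymx.
Proof.
move=> gK; apply/unitarymxP; apply: mulmx1C; apply/matrixP => i j.
have Bd k : B k = sub_fun (delta_mx k 0).
  apply/funext => Z; rewrite /sub_fun (bigD1 k) //= mxE !eqxx mul1r big1 ?addr0 // => l lk.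
  by rewrite mxE (negbTE lk) mul0r.
have e k : iota (fun Z => B k (invmx g *m Z)) = sub_emb (col k (sub_mx g)).
  by rewrite sub_mx_basis.
have := iota_ip_inv P ab (SpK_invmx' gK) (Wb (oB.1.1 j)) (Wb (oB.1.1 i)).
rewrite !e oB.1.2 ip_sub_emb2 eq_sym => h.
rewrite [RHS]mxE -[RHS]h mxE; apply: eq_bigr => k _; rewrite !mxE mulrC //.
Qed.

Lemma sub_is_rep : is_unitary_rep sub_mx.
Proof.
split; [exact: sub_mx1|exact: sub_mx_mul|exact: sub_mx_unitary|].
apply: (coef_continuous (B := B)) => [j|x x0|g j Z gK].
- exact: (Wb (oB.1.1 j)).1.
- apply/trmx_inj; rewrite trmx0; apply: sub_emb_inj => Z; rewrite -[RHS](x0 Z).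
  by apply: eq_bigr => i _; rewrite mxE.
- rewrite -(SpK_invmx gK) [LHS](congr1 (@^~ Z) (sub_mx_basis j gK)) /sub_fun.
  by apply: eq_bigr => i _; rewrite mxE.
Qed.

Definition sub_rep : unitary_rep C n := UnitaryRep sub_is_rep.

Lemma sub_rep_intertwiner : intertwiner (V := sub_rep) act sub_emb.
Proof. by split; [exact: sub_emb_lin|move=> g gK v; exact: sub_emb_act]. Qed.

Lemma sub_rep_irreducible : (exists F, W F /\ exists Z, F Z != 0) ->
  (forall W', subsp W' -> kstab W' -> W' `<=` W ->
     (forall F, W' F -> forall Z, F Z = 0) \/ W `<=` W') ->
  irreducible_rep sub_rep.
Proof.
move=> [F [WF [Z FZ]]] irr; split.
  rewrite lt0n; apply/negP => /eqP /= r0.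
  have [v vE] := sub_fun_surj WF; move: FZ; rewrite vE /sub_fun big1 ?eqxx // => i.
  by suff : (i < 0)%N by []; rewrite -[X in (_ < X)%N]r0; exact: ltn_ord.
move=> U kU.
pose W' := [set G | exists2 v, v \in U & G = sub_fun v].
case: (irr W') => [|g G gK [v vU ->]|G [v vU ->]|W0|WW'].
- split=> [|c G H [v vU ->] [w wU ->]].
    exists 0; rewrite ?mem0v //; apply/funext => Y.
    by rewrite /sub_fun big1 // => i _; rewrite mxE mul0r.
  exists (c *: v + w); first by rewrite memvD // memvZ.
  by apply/funext => Y; rewrite sub_fun_lin.
- exists (sub_mx (invmx g) *m v); first exact: (kU _ (SpK_invmx' gK)).
  by rewrite -(sub_fun_act v (SpK_invmx' gK)) invmxK.
- exact: sub_funW.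
- left; apply/eqP; rewrite -subv0; apply/subvP => v vU; rewrite memv0; apply/eqP.
  by apply: sub_emb_inj; apply: W0; exists v.
- right; apply/eqP; rewrite eqEsubv subvf; apply/subvP => v _.
  by have [w wU /sub_fun_inj ->] := WW' _ (sub_funW v).
Qed.

End SubRepresentation.

(** * Cyclic subspaces and comparison of the two notions of weight *)

Section Weights.
Variables (C : numClosedFieldType) (n' : nat).
Local Notation n := n'.+1.
Local Notation N := (n + n)%N.
Local Notation M := 'M[C]_N.
Local Notation E := 'M[C]_(N, 2).
Local Open Scope sesquilinear_scope.
Implicit Types (F G : E -> C) (Z : E) (W : set (E -> C)).

Definition cyc F : set (E -> C) :=
  [set G | forall W, subsp W -> kstab W -> W F -> W G].

Lemma cyc_id F : cyc F F. Proof. by []. Qed.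

Lemma cyc_subsp F : subsp (cyc F).
Proof.
split=> [W sW _ _|c G H hG hH W sW kW WF]; first exact: sW.1.
by apply: sW.2; [exact: hG|exact: hH].
Qed.

Lemma cyc_kstab F : kstab (cyc F).
Proof. by move=> g G gK hG W sW kW WF; apply: (kW) => //; exact: hG. Qed.

Lemma der_lin d F G c Z Y : hom d F -> hom d G ->
  der (fun Z => c * F Z + G Z) Z Y = c * der F Z Y + der G Z Y.
Proof.
move=> hF hG; have [p [_ pE <- _]] := hom_line Z Y hF.
have [q [_ qE <- _]] := hom_line Z Y hG.
by rewrite (@derE _ _ _ _ _ _ (c *: p + q)) ?coefD ?coefZ // => t; rewrite !hornerE pE qE.
Qed.

Lemma hw_lin d F G c : hom d F -> hom d G -> hw F -> hw G -> hw (fun Z => c * F Z + G Z).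
Proof.
move=> hF hG wF wG A nA Z.
by rewrite (der_lin _ _ _ hF hG) (wF A nA) (wG A nA) mulr0 addr0.
Qed.

Lemma wt_lin k m F G c : wt k F m -> wt k G m -> wt k (fun Z => c * F Z + G Z) m.
Proof. by move=> wF wG z Z; rewrite wF wG mulrDr mulrCA. Qed.

Lemma bideg_lin a b F G c : bideg a b F -> bideg a b G ->
  bideg a b (fun Z => c * F Z + G Z).
Proof. by move=> wF wG x y Z; rewrite wF wG mulrDr mulrCA. Qed.

(** F minus its base value times G satisfies the same conditions and vanishes at the base point, so
    [hw_zero] applies. *)
Lemma hw_unique d a b F G (la : nat -> nat) : hom d F -> hom d G -> hw F -> hw G ->
  bideg a b F -> bideg a b G -> (forall k : 'I_n, wt k F (la k)) ->
  (forall k : 'I_n, wt k G (la k)) -> G (sl n' 1 1 1 1) = 1 ->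
  forall Z, F Z = F (sl n' 1 1 1 1) * G Z.
Proof.
move=> hF hG wF wG bF bG lF lG G1 Z.
set c := F (sl n' 1 1 1 1); apply/eqP; rewrite -subr_eq0 addrC -mulNr; apply/eqP.
apply: (@hw_zero C n' d (fun Z => - c * G Z + F Z) a b la).
- exact: homP.
- exact: (hw_lin _ hG hF).
- exact: bideg_lin.
- by move=> k; apply: wt_lin.
- by rewrite G1 mulr1 /c addNr.
Qed.

Lemma gr_cay_poly d k F m Z : hom d F ->
  (forall z, `|z| = 1 -> F (gr k z *m Z) = z ^+ m * F Z) ->
  forall z, F (gr k z *m Z) = z ^+ m * F Z.
Proof.
move=> hF h z; have [p Hp] := gr_curve k hF; have [_ ev] := Hp Z.
have pE : p Z = F Z *: 'X^m.
  apply: (poly_eq_seq (@cay_inj C)) => j.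
  by rewrite -ev h ?norm_cay // hornerZ hornerXn mulrC.
by rewrite ev pE hornerZ hornerXn mulrC.
Qed.

Lemma wt_unit d k F m : hom d F ->
  (forall z Z, `|z| = 1 -> F (gr k z *m Z) = z ^+ m * F Z) -> wt k F m.
Proof. by move=> hF h z Z; apply: (gr_cay_poly hF) => w w1; exact: h. Qed.

(** A negative exponent would make X^(m+1) times a polynomial equal to the nonzero constant F Z0,
    which is impossible at 0. *)
Lemma wt_int d k F Z0 (nu : int) : hom d F -> F Z0 != 0 ->
  (forall z Z, `|z| = 1 -> F (gr k z *m Z) = z ^ (d%:Z + nu) * F Z) ->
  exists2 m : nat, m%:Z = d%:Z + nu & wt k F m.
Proof.
move=> hF FZ; case: (d%:Z + nu) => m h; first by exists m => //; apply: (wt_unit hF).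
have [p Hp] := gr_curve k hF; have [_ ev] := Hp Z0.
have pE : 'X^(m.+1) * p Z0 = (F Z0)%:P.
  apply: (poly_eq_seq (@cay_inj C)) => j.
  have z0 : cay C j != 0 by rewrite -normr_gt0 norm_cay.
  rewrite hornerM hornerXn -ev h ?norm_cay // NegzE -exprnN hornerC mulrA mulfV ?mul1r //.
  by rewrite expf_neq0.
move: FZ; have := congr1 (fun q : {poly C} => q.[0]) pE.
by rewrite hornerM hornerXn exprS !mul0r hornerC => <-; rewrite eqxx.
Qed.

Lemma invmx_torus (t : 'rV[C]_n) : (forall k, `|t 0 k| = 1) ->
  invmx (torus_mx t) = torus_mx (map_mx (fun x => x^-1) t).
Proof.
move=> t1; have t0 k : t 0 k != 0 by rewrite -normr_gt0 t1.
have e : torus_mx t *m torus_mx (map_mx (fun x => x^-1) t) = 1%:M.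
  apply/matrixP => i j; rewrite mulmx_diag !mxE; congr (_ *+ _).
  by case: splitP => k _; rewrite !mxE ?invrK ?mulfV ?mulVf.
by rewrite -[LHS]mulmx1 -e mulKmx //; have [] := mulmx1_unit e.
Qed.

Lemma gr_torus_inv (k : 'I_n) (z : C) : `|z| = 1 ->
  gr k z = z *: invmx (torus_mx (\row_i (if i == k then z else 1))).
Proof.
move=> z1; rewrite gr_torus // invmx_torus => [|l]; last first.
  by rewrite mxE; case: eqP => // _; rewrite normr1.
by congr (_ *: torus_mx _); apply/rowP => i; rewrite !mxE; case: eqP; rewrite ?invr1.
Qed.

(** The product of all gr k (t_k) is the inverse torus element times T, the product of the t_k;
    dividing by T^d removes the shift of the weights by d. *)
Lemma torus_wt d F (la : 'I_n -> nat) (t : 'rV[C]_n) Z : hom d F ->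
  (forall k, wt k F (la k)) -> (forall k, `|t 0 k| = 1) ->
  F (invmx (torus_mx t) *m Z) = (\prod_k t 0 k ^ ((la k)%:Z - d%:Z)) * F Z.
Proof.
move=> hF wF t1; have t0 k : t 0 k != 0 by rewrite -normr_gt0 t1.
pose T := \prod_k t 0 k; have T0 : T != 0 by apply/prodf_neq0 => k _.
pose D (s : seq 'I_n) : M := foldr (fun k A => gr k (t 0 k) *m A) 1%:M s.
have FD s Y : F (D s *m Y) = (\prod_(k <- s) t 0 k ^+ la k) * F Y.
  elim: s => [|k s IH]; first by rewrite big_nil mul1mx mul1r.
  by rewrite /= -mulmxA wF IH big_cons mulrA.
have DE s : D s = diag_mx (row_mx (\row_i \prod_(k <- s) (if i == k then 1 else t 0 k))
    (\row_i \prod_(k <- s) (if i == k then t 0 k ^+ 2 else t 0 k))).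
  elim: s => [|k s IH] /=.
    apply/matrixP => i j; rewrite !mxE; congr (_ *+ _).
    by case: splitP => l _; rewrite mxE big_nil.
  rewrite IH mulmx_diag; congr diag_mx; apply/rowP => i; rewrite !mxE.
  by case: splitP => l _; rewrite !mxE big_cons.
have TD : D (index_enum _) = T *: invmx (torus_mx t).
  rewrite DE invmx_torus //; apply/matrixP => i j; rewrite !mxE mulrnAr; congr (_ *+ _).
  case: splitP => l _; rewrite !mxE /T (bigD1 l) //= [\prod_k t 0 k](bigD1 l) //= eqxx.
    rewrite mul1r mulrAC mulfV // mul1r; apply: eq_bigr => k kl.
    by rewrite eq_sym (negbTE kl).
  rewrite invrK [in RHS]mulrAC -[in RHS]expr2; congr (_ * _); apply: eq_bigr => k kl.
  by rewrite eq_sym (negbTE kl).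
have : T ^+ d * F (invmx (torus_mx t) *m Z) = (\prod_k t 0 k ^+ la k) * F Z.
  by rewrite -(hom_scale _ _ hF) scalemxAl -TD FD.
move=> /(congr1 (fun x => (T ^+ d)^-1 * x)); rewrite mulKf ?expf_neq0 // => ->.
rewrite mulrA; congr (_ * _); rewrite -prodrXl -prodfV -big_split; apply: eq_bigr => k _.
by rewrite /= expfzDr // -exprnN mulrC.
Qed.

Lemma degT_subsp i : subsp (degT (C := C) (n' := n') i).
Proof.
split=> [Z|c F G hF hG Z]; first by exists 0; split; rewrite ?size_poly0 // => t; rewrite horner0.
have [p [sp pE]] := hF Z; have [q [sq qE]] := hG Z; exists (c *: p + q); split.
  rewrite (leq_trans (size_polyD _ _)) // geq_max sq andbT.
  exact: leq_trans (size_scale_leq _ _) sp.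
by move=> t; rewrite pE qE !hornerE.
Qed.

Lemma degT_kstab i : kstab (degT (C := C) (n' := n') i).
Proof.
move=> g F _ hF Z; have [p [sp pE]] := hF (g *m Z); exists p; split=> // t.
by rewrite mulmxA pE.
Qed.

Lemma bideg_subsp a b : subsp (bideg (C := C) (n' := n') a b).
Proof. by split=> [c e Z|c F G hF hG]; [rewrite mulr0|exact: bideg_lin]. Qed.

Lemma bideg_kstab a b : kstab (bideg (C := C) (n' := n') a b).
Proof. by move=> g F _ hF c e Z; rewrite mulmxA hF. Qed.

Lemma hom_subsp d : subsp (fun F : E -> C => hom d F).
Proof. by split=> [|c F G hF hG]; [exact: hom0|exact: homP]. Qed.

Lemma hom_kstab d : kstab (fun F : E -> C => hom d F).
Proof. by move=> g F _ hF; exact: (hom_lin (mulmx g) hF). Qed.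

(* The bound on the degree in t of F(U + t V, V), stable under the group and met
   by hwv i j k 0, excludes the highest weight vectors of larger weight. *)
Lemma cyc_lexmax i j k : (if (1 < n)%N then true else k == 0%N) ->
  exists (la : nat -> nat) G, lexmax (cyc (hwv (C := C) (n' := n') i j k 0)) la G /\
    forall m : 'I_n, la m = ((if val m == 0%N then i + j + k
       else if val m == 1%N then k else 0) + (i + k + (j + k)))%N.
Proof.
move=> kn; set u := hwv _ _ _ _; pose W := cyc u; rewrite -/W.
have hu : hom (i + k + (j + k)) u.
  have -> : (i + k + (j + k) = i + j + k * 2 + 0 * 2)%N by lia.
  exact: hwv_hom.
have bu : bideg (i + k) (j + k) u.
  by have := @hwv_bideg C n' i j k 0; rewrite !addn0.
have Wh G : W G -> hom (i + k + (j + k)) G.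
  by move=> WG; apply: (WG _ (hom_subsp _) (@hom_kstab _)).
have Wb G : W G -> bideg (i + k) (j + k) G.
  by move=> WG; apply: (WG _ (@bideg_subsp _ _) (@bideg_kstab _ _)).
have Wd G : W G -> degT i G.
  by move=> WG; apply: (WG _ (@degT_subsp _) (@degT_kstab _)); exact: hwv_degT.
have u1 : u (sl n' 1 1 1 1) = 1 by apply: hwv_sl.
have [la [G lG]] := lexmax_exists (@cyc_subsp u) (@cyc_kstab u) Wh
  (ex_intro _ u (conj (@cyc_id u) (ex_intro _ (sl n' 1 1 1 1)
     (etrans (congr1 (fun x => x != 0) u1) (oner_neq0 _))))).
exists la, G; split=> //; have [WG [Z0 GZ0] wG mG] := lG.
have hG := lexmax_hw (@cyc_subsp u) (@cyc_kstab u) Wh lG.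
have [i1 [j1 [k1 [s1 [e1 e2 l0 l1 l2]]]]] :=
  hw_weights (Wh _ WG) hG (Wb _ WG) wG (ex_intro _ Z0 GZ0).
have kn1 : if (1 < n)%N then true else k1 == 0%N by move: l1; case: ifP => // _ ->.
have wu m : wt m u ((if val m == 0%N then i + j + k
       else if val m == 1%N then k else 0) + (i + k + (j + k)))%N.
  have := @hwv_wt C n' i j k 0 m; set x := (X in wt _ _ X) => h.
  rewrite (_ : _ + _ = x)%N // /x; case: eqP => _; first lia; case: eqP => _; lia.
(* The vector u itself belongs to the cyclic space, so maximality bounds la 0 from below. *)
have ge0 : (i + j + k + (i + k + (j + k)) <= la 0)%N.
  have := mG ord0 u _ (@cyc_id u) (ex_intro _ (sl n' 1 1 1 1) _).
  move=> /(_ _ _ _ (wu ord0)); apply => //; by rewrite u1 oner_neq0.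
have GE Z : G Z = G (sl n' 1 1 1 1) * hwv i1 j1 k1 s1 Z.
  apply: (hw_unique (d := i + k + (j + k)) (a := i + k) (b := j + k) (la := la)).
  - exact: Wh.
  - have -> : (i + k + (j + k) = i1 + j1 + k1 * 2 + s1 * 2)%N by lia.
    exact: hwv_hom.
  - exact: hG.
  - exact: hwv_hw.
  - exact: Wb.
  - by rewrite e1 e2; exact: hwv_bideg.
  - exact: wG.
  - move=> m; have := @hwv_wt C n' i1 j1 k1 s1 m; set x := (X in wt _ _ X) => h.
    rewrite (_ : la m = x) // /x; case: (val m =P 0%N) => [m0|m0].
      rewrite m0 l0; lia.
    case: (val m =P 1%N) => [m1|m1].
      have n1 : (1 < n)%N by rewrite -m1; exact: ltn_ord.
      move: l1; rewrite n1 m1 => ->; lia.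
    have m2 : (1 < m)%N by move: m0 m1 => /=; case: (nat_of_ord m) => [|[|]].
    by rewrite (l2 m m2); lia.
  - exact: hwv_sl.
have c0 : G (sl n' 1 1 1 1) != 0.
  by apply: contraNneq GZ0 => c0; rewrite GE c0 mul0r.
have i1i : (i1 <= i)%N.
  apply: (hwv_degT_le (k := k1) (j := j1) (s := s1) c0 kn1).
  by move=> Z; have [p [sp pE]] := Wd _ WG Z; exists p; split=> // t; rewrite -GE pE.
(* Equal bidegrees give i1 - j1 = i - j, so i1 <= i implies j1 <= j; the lower bound on i1 + j1 + k1
   then forces s1 = 0 and equality throughout. *)
move=> m; have [ei ek] : i1 = i /\ k1 = k by lia.
case: (val m =P 0%N) => [->|m0]; first by rewrite l0; lia.
case: (val m =P 1%N) => [m1|m1].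
  have n1 : (1 < n)%N by rewrite -m1; exact: ltn_ord.
  by move: l1; rewrite n1 m1 => ->; lia.
have m2 : (1 < m)%N by move: m0 m1 => /=; case: (nat_of_ord m) => [|[|]].
by rewrite (l2 m m2); lia.
Qed.

End Weights.

(** * Orthogonal complements and irreducibility of cyclic subspaces *)

Section OrthogonalComplements.
Variables (R : realType) (n' : nat) (mu : R[i]) (delta : int).
Local Notation C := R[i].
Local Notation n := n'.+1.
Local Notation N := (n + n)%N.
Local Notation E := 'M[C]_(N, 2).
Variable P : @degenerate_principal_series R n mu delta.
Local Notation ip := (dps_ip P).
Local Notation act := (@dps_act _ _ _ _ P).
Variables (a b : nat).
Hypothesis ab : a%:Z - b%:Z = delta.
Local Notation iota := (iota P a b).
Implicit Types (F G : E -> C) (W : set (E -> C)).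

Definition orth W W' : set (E -> C) :=
  [set F | W F /\ forall G, W' G -> ip (iota F) (iota G) = 0].

Lemma orth_subsp W W' : W `<=` bihom a b -> subsp W -> subsp (orth W W').
Proof.
move=> Wb sW; split=> [|c F G [WF hF] [WG hG]].
  by split; [exact: sW.1|move=> G _; rewrite iota0 // ip0l].
split; first exact: sW.2.
move=> H W'H; rewrite (iota_lin P ab c (Wb _ WF) (Wb _ WG)).
by rewrite ipDl ipZl hF ?hG // mulr0 addr0.
Qed.

Lemma orth_kstab W W' : W `<=` bihom a b -> W' `<=` bihom a b -> kstab W -> kstab W' ->
  kstab (orth W W').
Proof.
move=> Wb Wb' kW kW' g F gK [WF hF]; split; first exact: kW.
move=> G W'G; have gU : g \in unitmx by have [gU _] := gK; exact: unitarymx_unit.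
have W'G' := kW' _ _ (SpK_invmx' gK) W'G.
rewrite -(hF _ W'G') -(iota_ip_inv P ab gK (Wb _ WF) (Wb' _ W'G')).
congr (ip _ (_ _)); apply/funext => Z; by rewrite mulKmx.
Qed.

Lemma orth_decomp W W' F : W `<=` bihom a b -> subsp W -> W' `<=` W -> subsp W' ->
  W F -> exists F1 F2, [/\ W' F1, orth W W' F2 & F = (fun Z => 1 * F1 Z + F2 Z)].
Proof.
move=> Wb sW W'W sW' WF; have Wb' := subset_trans W'W Wb.
have [r [B [oB Bspan]]] := onb_exists P ab sW' Wb'.
pose F1 Z := \sum_i ip (iota F) (iota (B i)) * B i Z.
have W'F1 : W' F1 by apply: (subsp_sum _ _ sW'); exact: oB.1.
pose F2 Z := -1 * F1 Z + F Z.
have WF2 : W F2 by apply: sW.2 => //; exact: W'W.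
exists F1, F2; split=> //; last by apply/funext => Z; rewrite /F2 mul1r mulN1r addrA subrr add0r.
split=> // G W'G.
have F2B j : ip (iota F2) (iota (B j)) = 0.
  rewrite (iota_lin P ab _ (Wb' _ W'F1) (Wb _ WF)) ipDl ipZl.
  by rewrite (ip_iota_sum ab _ _ Wb' oB) mulN1r addNr.
have -> : G = fun Z => \sum_i ip (iota G) (iota (B i)) * B i Z.
  by apply/funext => Z; exact: Bspan.
have [_ ->] := iota_sum P ab (index_enum _) (fun i => ip (iota G) (iota (B i)))
  (fun i => Wb' _ (oB.1 i)).
by rewrite ip_sumr big1 // => i _; rewrite ipZr F2B mulr0.
Qed.

Lemma orth_indep W W' F1 F2 : W `<=` bihom a b -> W' `<=` W -> W' F1 -> orth W W' F2 ->
  (forall Z, 1 * F1 Z + F2 Z = 0) -> (forall Z, F1 Z = 0) /\ (forall Z, F2 Z = 0).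
Proof.
move=> Wb W'W W'F1 [WF2 hF2] e.
have F10 : forall Z, F1 Z = 0.
  apply: (iota_eq0 (P := P) ab (Wb _ (W'W _ W'F1))).
  apply/eqP; rewrite -(dnorm_eq0 ip); apply/eqP.
  have : iota (fun Z => 1 * F1 Z + F2 Z) = 0.
    by rewrite (_ : (fun Z => _) = fun=> 0) ?iota0 //; exact/funext.
  rewrite (iota_lin P ab _ (Wb _ (W'W _ W'F1)) (Wb _ WF2)) scale1r => /(congr1 (ip^~ (iota F1))).
  by rewrite ip0l ipDl hF2 // addr0.
by split=> // Z; rewrite -[RHS](e Z) F10 mulr0 add0r.
Qed.

(** Root operators and torus elements preserve both W' and its complement, so the conditions on F1 +
    F2 split. Only |z| = 1 comes from the group; [wt_unit] extends the weight relation to all z. *)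
Lemma hw_component W W' F1 F2 (la : nat -> nat) : W `<=` bihom a b -> subsp W -> kstab W ->
  W' `<=` W -> subsp W' -> kstab W' -> W' F1 -> orth W W' F2 ->
  hw (fun Z => 1 * F1 Z + F2 Z) ->
  (forall k : 'I_n, wt k (fun Z => 1 * F1 Z + F2 Z) (la k)) ->
  [/\ hw F1, hw F2, forall k : 'I_n, wt k F1 (la k) & forall k : 'I_n, wt k F2 (la k)].
Proof.
move=> Wb sW kW W'W sW' kW' W'F1 oF2 hF wF.
have Wb' := subset_trans W'W Wb.
have sO := orth_subsp W' Wb sW; have kO := orth_kstab Wb Wb' kW kW'.
have h1 := (Wb' _ W'F1).1; have h2 := (Wb _ oF2.1).1.
have H A : posroot A -> (forall Z, der F1 Z (A *m Z) = 0) /\ (forall Z, der F2 Z (A *m Z) = 0).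
  move=> rA; apply: (orth_indep Wb W'W).
  - exact: (kstab_nilroot sW' kW' h1 W'F1 (posroot_nilroot rA)).
  - exact: (kstab_nilroot sO kO h2 oF2 (posroot_nilroot rA)).
  - by move=> Z; rewrite -(der_lin 1 _ _ h1 h2); exact: (hF A (posroot_nplus rA)).
have T k z : `|z| = 1 -> (forall Z, F1 (gr k z *m Z) = z ^+ la k * F1 Z) /\
    (forall Z, F2 (gr k z *m Z) = z ^+ la k * F2 Z).
  move=> z1.
  have [e1 e2] : (forall Z, - z ^+ la k * F1 Z + F1 (gr k z *m Z) = 0) /\
      (forall Z, - z ^+ la k * F2 Z + F2 (gr k z *m Z) = 0).
    apply: (orth_indep Wb W'W).
    - by apply: sW'.2 => //; exact: (gr_stab k sW' kW' h1 W'F1 z1).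
    - by apply: sO.2 => //; exact: (gr_stab k sO kO h2 oF2 z1).
    - move=> Z; have := wF k z Z; move: (F1 Z) (F2 Z) (F1 _) (F2 _) (z ^+ _) => x y x' y' w e.
      by rewrite !mul1r in e *; rewrite addrACA -mulrDr e mulNr addNr.
  by split=> Z; [have := e1 Z|have := e2 Z]; rewrite mulNr addrC => /eqP; rewrite subr_eq0 => /eqP.
split.
- by apply: (hw_posroot h1) => A rA; have [] := H A rA.
- by apply: (hw_posroot h2) => A rA; have [] := H A rA.
- by move=> k; apply: (wt_unit h1) => z Z z1; have [+ _] := T k z z1; apply.
- by move=> k; apply: (wt_unit h2) => z Z z1; have [_ +] := T k z z1; apply.
Qed.

(** The components of u along W' and its complement are highest weight vectors of the same weight,
    hence multiples of u. Either W' contains u and therefore its cyclic space, or u and all its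
    translates are orthogonal to W', which is then orthogonal to itself. *)
Lemma cyc_irreducible u (la : nat -> nat) : bihom a b u -> hw u ->
  (forall k : 'I_n, wt k u (la k)) -> u (sl n' 1 1 1 1) = 1 ->
  forall W', subsp W' -> kstab W' -> W' `<=` cyc u ->
    (forall F, W' F -> forall Z, F Z = 0) \/ cyc u `<=` W'.
Proof.
move=> bu hu wu u1 W' sW' kW' W'W; set W := cyc u in W'W *.
have sB : subsp (bihom (R := R) (n' := n') a b).
  by split=> [|c F G hF hG]; [exact: bihom0|exact: bihomP].
have kB : kstab (bihom (R := R) (n' := n') a b) by move=> g F _ hF; exact: bihom_mulmx.
have Wb : W `<=` bihom a b by move=> F WF; apply: (WF _ sB kB).
have sW := cyc_subsp u; have kW := cyc_kstab (F := u).
have Wb' := subset_trans W'W Wb.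
have [u1' [u2 [W'u1 ou2 uE]]] := orth_decomp Wb sW W'W sW' (@cyc_id C n' u).
have hu' := hu; rewrite uE in hu'; have wu' := wu; rewrite uE in wu'.
have [hw1 hw2 wt1 wt2] := hw_component Wb sW kW W'W sW' kW' W'u1 ou2 hu' wu'.
have b1 := Wb' _ W'u1; have b2 := Wb _ ou2.1.
have E1 := hw_unique b1.1 bu.1 hw1 hu b1.2 bu.2 wt1 wu u1.
have E2 := hw_unique b2.1 bu.1 hw2 hu b2.2 bu.2 wt2 wu u1.
set c1 := u1' _ in E1; set c2 := u2 _ in E2.
have [c10|c1n0] := eqVneq c1 0.
  left=> F W'F; have ou : orth W W' u.
    rewrite (_ : u = u2) //; apply/funext => Z.
    by rewrite {1}uE E1 c10 mul0r mulr0 add0r.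
  have : orth W W' F by apply: (W'W _ W'F) => //; [exact: orth_subsp|exact: orth_kstab].
  case=> _ /(_ F W'F) /eqP; rewrite (dnorm_eq0 ip) => /eqP.
  exact: iota_eq0 (Wb' _ W'F).
right=> F WF; apply: WF => //.
have -> : u = fun Z => c1^-1 * u1' Z by apply/funext => Z; rewrite E1 mulKf.
exact: subspZ.
Qed.

End OrthogonalComplements.

(** * One irreducible representation for each monomial without a power of omega *)

Section KTypes.
Variables (R : realType) (n' : nat) (mu : R[i]) (delta : int).
Local Notation C := R[i].
Local Notation n := n'.+1.
Local Notation N := (n + n)%N.
Local Notation E := 'M[C]_(N, 2).
Variable P : @degenerate_principal_series R n mu delta.
Local Notation ip := (dps_ip P).
Local Notation act := (@dps_act _ _ _ _ P).

Lemma hwv_bihom i j k s : bihom (R := R) (n' := n') (i + k + s) (j + k + s) (hwv i j k s).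
Proof.
split; last exact: hwv_bideg.
have -> : (i + k + s + (j + k + s) = i + j + k * 2 + s * 2)%N by lia.
exact: hwv_hom.
Qed.

Lemma hwv_bihom0 i j k : bihom (R := R) (n' := n') (i + k) (j + k) (hwv i j k 0).
Proof. by have := hwv_bihom i j k 0; rewrite !addn0. Qed.

Lemma ktype_exists i j k : i%:Z - j%:Z = delta ->
  (if (1 < n)%N then true else k == 0%N) ->
  exists (V : unitary_rep C n) (T : 'cV[C]_(rep_dim V) -> dps_space P),
  [/\ irreducible_rep V, highest_weight V (two_row_weight (n := n) (i + j + k, k)%N),
      intertwiner act T, forall v w, ip (T v) (T w) = \sum_k v k 0 * (w k 0)^* &
      (forall v, exists2 F, bihom (i + k) (j + k) F & T v = iota P (i + k) (j + k) F) /\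
      exists v, T v = iota P (i + k) (j + k) (hwv i j k 0)].
Proof.
move=> ij kn; pose a := (i + k)%N; pose b := (j + k)%N.
have ab : a%:Z - b%:Z = delta by rewrite -ij /a /b; lia.
pose u := hwv (C := C) (n' := n') i j k 0; pose W := cyc u.
have bu : bihom a b u := hwv_bihom0 i j k.
have sW : subsp W := cyc_subsp u; have kW : kstab W := cyc_kstab (F := u).
have Wb : W `<=` bihom a b.
  move=> F WF; apply: WF => //; first by split=> [|c G H]; [exact: bihom0|exact: bihomP].
  by move=> g G _ hG; exact: bihom_mulmx.
have u1 : u (sl n' 1 1 1 1) = 1 by apply: hwv_sl.
have wu := fun m => @hwv_wt C n' i j k 0 m; rewrite -/u in wu.
have [r [B oB]] := onb_exists P ab sW Wb.
have [la [G [lG laE]]] := @cyc_lexmax C n' i j k kn.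
have [_ _ _ mG] := lG.
exists (sub_rep ab kW Wb oB), (sub_emb P a b B); split.
- apply: (sub_rep_irreducible ab sW).
    by exists u; split; [exact: (@cyc_id C n' u)|exists (sl n' 1 1 1 1); rewrite u1 oner_neq0].
  apply: (cyc_irreducible P ab (la := fun m : nat => if m == 0%N then i * 2 + j * 2 + k * 3 + 0 * 2
   else if m == 1%N then i + j + k * 3 + 0 * 2
   else i + j + k * 2 + 0 * 2)%N bu _ _ u1); [exact: hwv_hw|exact: wu].
- have dE : (a + b = i + k + (j + k))%N by [].
  have wla (m : 'I_n) : wt m u (la m).
    have := wu m; rewrite laE; set x := (X in wt _ _ X -> _) => h.
    rewrite (_ : _ + _ = x)%N // /x; case: eqP => _; first by lia.
    by case: eqP => _; lia.
  have tw (m : 'I_n) : two_row_weight (n := n) (i + j + k, k)%N m = (la m)%:Z - (a + b)%N%:Z.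
    rewrite laE /two_row_weight /=; case: m => -[|[|m]] mn /=; rewrite ?nth_nil; lia.
  split.
    have [v vE] := sub_fun_surj oB (@cyc_id C n' u).
    exists v.
      apply: contra_eq_neq u1 => v0; rewrite vE v0 /sub_fun big1 ?oner_neq0 1?eq_sym ?oner_neq0 //.
      by move=> l _; rewrite mxE mul0r.
    move=> t t1; apply: (sub_fun_inj ab Wb oB).
    rewrite -(sub_fun_act ab kW Wb oB v (torus_SpK t1)); apply/funext => Z.
    rewrite -vE (torus_wt Z bu.1 wla t1) {1}vE.
    have -> : \prod_m t 0 m ^ two_row_weight (n := n) (i + j + k, k)%N m =
        \prod_m t 0 m ^ ((la m)%:Z - (a + b)%N%:Z).
      by apply: eq_bigr => m _; rewrite tw.
    rewrite /sub_fun mulr_sumr; apply: eq_bigr => l _.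
    by rewrite [in RHS]mxE mulrA.
  move=> nu [v v0 vE]; pose F := sub_fun B v.
  have WF : W F := sub_funW sW oB v.
  have hF := (Wb _ WF).1.
  have [Z0 FZ0] : exists Z, F Z != 0.
    apply: contrapT => /forallNP h; move: v0; rewrite (sub_emb_inj ab Wb oB (v := v)) ?eqxx // => Z.
    by have /negP/negPn/eqP := h Z.
  have FT (t : 'rV[C]_n) : (forall m, `|t 0 m| = 1) -> forall Z,
      F (invmx (torus_mx t) *m Z) = (\prod_m t 0 m ^ nu m) * F Z.
    move=> t1 Z; have /(congr1 (@^~ Z)) := sub_fun_act ab kW Wb oB v (torus_SpK t1).
    rewrite [_ *m v](vE t t1) => /= e; rewrite /F e.
    by rewrite /sub_fun mulr_sumr; apply: eq_bigr => l _; rewrite mxE mulrA.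
  have wF (m : 'I_n) : exists2 q : nat, q%:Z = (a + b)%N%:Z + nu m & wt m F q.
    apply: (wt_int hF FZ0) => z Z z1.
    have z0 : z != 0 by rewrite -normr_gt0 z1.
    rewrite gr_torus_inv // -scalemxAl (hom_scale _ _ hF) FT => [|l]; last first.
      by rewrite mxE; case: eqP; rewrite ?normr1.
    rewrite (bigD1 m) //= mxE eqxx big1 => [|l lm]; last by rewrite mxE (negbTE lm) exp1rz.
    by rewrite mulr1 expfzDr // mulrA.
  (* Weights of the representation, shifted by a + b, are weights in the sense of [wt], so the
     lexicographic maximality of [la] applies. *)
  have cmp (m : 'I_n) : (forall l : 'I_n, (l < m)%N -> nu l = two_row_weight (n := n) (i + j + k, k)%N l) ->
      nu m <= two_row_weight (n := n) (i + j + k, k)%N m.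
    move=> hl; have [q qE wq] := wF m.
    suff : (q <= la m)%N by rewrite tw; lia.
    apply: (mG m F q WF (ex_intro _ Z0 FZ0)) => // l lm.
    have [q' q'E] := wF l; rewrite (_ : q' = la l) //.
    by move: q'E; rewrite (hl l lm) tw; lia.
  have [e|/existsNP [m1 m1E]] := pselect (nu =1 two_row_weight (n := n) (i + j + k, k)%N).
    by left.
  right; have ex : exists m, (m < n)%N && [exists l : 'I_n, (val l == m) && (nu l != two_row_weight (n := n) (i + j + k, k)%N l)].
    exists m1; rewrite ltn_ord; apply/existsP; exists m1; rewrite eqxx /=; exact/eqP.
  case: (ex_minnP ex) => m /andP[mn /existsP[l /andP[/eqP lm ln]]] mmin.
  have hl (l' : 'I_n) : (l' < l)%N -> nu l' = two_row_weight (n := n) (i + j + k, k)%N l'.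
    move=> l'l; apply/eqP/negPn/negP => ne.
    have : (m <= l')%N.
      by apply: mmin; rewrite ltn_ord; apply/existsP; exists l'; rewrite eqxx.
    by rewrite -lm leqNgt l'l.
  exists l; split=> //; rewrite lt_neqAle ln; exact: cmp.
- exact: (sub_rep_intertwiner ab sW kW Wb oB).
- exact: (ip_sub_emb2 ab Wb oB).
- split=> [v|].
    by exists (sub_fun B v) => //; exact: (sub_fun_bihom sW Wb oB).
  by have [v vE] := sub_fun_surj oB (@cyc_id C n' u); exists v; rewrite /sub_emb -vE.
Qed.

End KTypes.

(** * The decomposition *)

Section Assembly.
Variables (R : realType) (n' : nat) (mu : R[i]) (delta : int).
Local Notation C := R[i].
Local Notation n := n'.+1.
Local Notation N := (n + n)%N.
Local Notation E := 'M[C]_(N, 2).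
Local Open Scope sesquilinear_scope.
Variable P : @degenerate_principal_series R n mu delta.
Local Notation H := (dps_space P).
Local Notation ip := (dps_ip P).
Local Notation act := (@dps_act _ _ _ _ P).
Implicit Types (F G : E -> C) (x y : H).

Lemma bihom_om a b s F : bihom a b F -> bihom (a + s) (b + s) (fun Z => om Z ^+ s * F Z).
Proof.
move=> [hF bF]; split.
  have -> : (a + s + (b + s) = s * 2 + (a + b))%N by lia.
  by apply: hom_mul => //; exact: (hom_exp s (@om_hom C n')).
move=> c e Z; rewrite om_dg bF !exprMn !exprD.
by move: (c ^+ s) (e ^+ s) (om Z ^+ s) (c ^+ a) (e ^+ b) (F Z) => *; ring.
Qed.

(** omega takes the value |X|^2 on the pair, and the extra |X|^(2s) is absorbed by the radial
    exponent. *)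
Lemma iota_om a b s F : a%:Z - b%:Z = delta -> bihom a b F ->
  iota P (a + s) (b + s) (fun Z => om Z ^+ s * F Z) = iota P a b F.
Proof.
move=> ab hF; have ab' : (a + s)%N%:Z - (b + s)%N%:Z = delta by rewrite -ab; lia.
apply: dps_inj_ext; first exact: (bihom_Vinfty mu ab' (bihom_om s hF)).
move=> X X0; rewrite /ext; have r0 : 0 < rad X by rewrite rad_gt0.
have rC : (rad X)%:C%C != 0 by rewrite eq_complex /= gt_eqF.
have -> : om (pairmx X) = (rad X)%:C%C ^+ 2.
  by rewrite /om omega_pairmx -rad_sqr rmorphXn.
rewrite !cpowD !cpowNn // mulrA; congr (_ * _); rewrite -mulrA; congr (_ * _).
rewrite -exprM (_ : a + s + (b + s) = a + b + 2 * s)%N; last by lia.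
by rewrite exprD invfM mulfVK // expf_neq0.
Qed.

Definition kpoly : set H := [set x | exists a b F,
  [/\ a%:Z - b%:Z = delta, bihom a b F & x = iota P a b F]].

Lemma kpoly0 : kpoly 0.
Proof.
case: (lerP 0 delta) => [d0|d0]; [exists `|delta|%N, 0%N|exists 0%N, `|delta|%N];
  exists (fun=> 0); split; try exact: bihom0; try by lia.
- by rewrite iota0 //; lia.
- by rewrite iota0 //; lia.
Qed.

Lemma kpoly_lin c x y : kpoly x -> kpoly y -> kpoly (c *: x + y).
Proof.
move=> [a [b [F [ab hF ->]]]] [a' [b' [G [ab' hG ->]]]].
(* Powers of omega bring both terms to bidegree (a + a', b + a'), which equals (a' + a, b' + a)
   since a - b = a' - b'. *)
have e1 : (a' + a = a + a')%N by rewrite addnC.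
have e2 : (b' + a = b + a')%N by lia.
have hG' := bihom_om a hG; rewrite e1 e2 in hG'.
have iG := iota_om a ab' hG; rewrite e1 e2 in iG.
have ab2 : (a + a')%N%:Z - (b + a')%N%:Z = delta by rewrite -ab; lia.
exists (a + a')%N, (b + a')%N, (fun Z => c * (om Z ^+ a' * F Z) + om Z ^+ a * G Z).
split=> //; first by apply: bihomP => //; exact: bihom_om.
by rewrite (iota_lin P ab2 c (bihom_om a' hF) hG') iG iota_om.
Qed.

Lemma kpoly_sum (I : Type) (s : seq I) (Q : pred I) (f : I -> H) :
  (forall t, Q t -> kpoly (f t)) -> kpoly (\sum_(t <- s | Q t) f t).
Proof.
move=> hf; elim/big_ind: _ => [|x y hx hy|t Qt]; [exact: kpoly0| |exact: hf].
by rewrite -[x]scale1r; exact: kpoly_lin.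
Qed.

Lemma norm_lt_ip x (r : C) : 0 < r -> ip x x < r ^+ 2 -> `|x| < r.
Proof.
by move=> r0; rewrite -dps_normE ltr_pXn2r // nnegrE ?normr_ge0 // ltW.
Qed.

Lemma kpoly_dense x (r : C) : 0 < r -> exists2 y, kpoly y & `|x - y| < r.
Proof.
move=> r0; have r20 : 0 < r / 2 by rewrite divr_gt0.
have [z [xz [f Vf fE]]] := @dps_inj_dense _ _ _ _ P (ball x (r / 2))
  (ex_intro _ x (ballxx x r20)) (ball_open _ _).
have [s s0 sE] : exists2 s : R, 0 < s & s%:C%C = (r / 2) ^+ 2.
  have : 0 < (r / 2) ^+ 2 by rewrite exprn_gt0.
  case: ((r / 2) ^+ 2) => [u v]; rewrite ltcE /= => /andP[/eqP -> u0].
  by exists u.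
have [T [a [b [F [hF HF]]]]] := iota_dense P Vf s0.
exists (\sum_(t | (a t)%:Z - (b t)%:Z == delta) iota P (a t) (b t) (F t)).
  by apply: kpoly_sum => t /eqP abt; exists (a t), (b t), (F t).
move: HF; rewrite sE /= => /(norm_lt_ip r20); rewrite fE => h2.
move: xz; rewrite -ball_normE /= => h1.
set y := \sum_(t | _) _ in h2 *.
have -> : x - y = (x - z) + (z - y) by rewrite addrA subrK.
by apply: le_lt_trans (ler_normD _ _) _; rewrite [r]splitr ltrD.
Qed.

Lemma act_lin g c x y : SpK g -> act g (c *: x + y) = c *: act g x + act g y.
Proof. by move=> gK; exact: (@dps_act_linear _ _ _ _ P _ (SpK_SpC gK)). Qed.

Lemma act0 g : SpK g -> act g 0 = 0.
Proof.
move=> gK; have := act_lin (-1) 0 0 gK; rewrite !scaleN1r !addNr //.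
Qed.

Lemma act_sum (I : Type) (s : seq I) (f : I -> H) g : SpK g ->
  act g (\sum_(t <- s) f t) = \sum_(t <- s) act g (f t).
Proof.
move=> gK; elim: s => [|t s IH]; first by rewrite !big_nil act0.
by rewrite !big_cons; have := act_lin 1 (f t) (\sum_(t <- s) f t) gK; rewrite !scale1r IH.
Qed.

Lemma act_norm_kpoly g x : SpK g -> kpoly x -> ip (act g x) (act g x) = ip x x.
Proof.
move=> gK [a [b [F [ab hF ->]]]]; rewrite (iota_act P ab gK hF).
exact: (iota_norm_inv P ab (SpK_invmx' gK) hF).
Qed.

(** The action is isometric on the dense set [kpoly] and continuous, hence isometric everywhere. *)
Lemma act_norm g x : SpK g -> `|act g x| = `|x|.
Proof.
move=> gK; have cg := @dps_act_continuous _ _ _ _ P _ (SpK_SpC gK) x.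
apply/eqP; rewrite -subr_eq0 -normr_eq0; apply/negPn/negP => ne.
set d := `|_| in ne; have d0 : 0 < d by rewrite lt_neqAle eq_sym ne normr_ge0.
have d20 : 0 < d / 2 by rewrite divr_gt0.
have /nbhs_ballP [r /= r0 Hr] :
    \forall y \near x, `|act g x - act g y| < d / 2 /\ `|x - y| < d / 2.
  near=> y; split; near: y; first by move/cvgrPdist_lt: cg; apply.
  by move/cvgrPdist_lt: (@cvg_id _ (nbhs x)); apply.
have [y py xy] := kpoly_dense x r0.
have [h1 h2] : `|act g x - act g y| < d / 2 /\ `|x - y| < d / 2.
  by apply: Hr; rewrite -ball_normE.
have e : `|act g y| = `|y|.
  apply/eqP; rewrite -(@eqrXn2 _ 2) ?normr_ge0 // !dps_normE; apply/eqP.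
  exact: act_norm_kpoly.
suff : d < d by rewrite ltxx.
rewrite {1}/d; have -> : `|act g x| - `|x| = (`|act g x| - `|act g y|) - (`|x| - `|y|).
  by rewrite e; ring.
apply: le_lt_trans (ler_normB _ _) _; rewrite [X in _ < X]splitr ltrD //.
  exact: le_lt_trans (ler_dist_dist _ _) h1.
exact: le_lt_trans (ler_dist_dist _ _) h2.
Unshelve. all: by end_near. Qed.

Lemma act_ip g x y : SpK g -> ip (act g x) (act g y) = ip x y.
Proof.
move=> gK; apply: ip_polarization => a b.
have h c u v : act g (c *: u + b *: v) = c *: act g u + b *: act g v.
  rewrite act_lin // -[b *: v]addr0 act_lin // act0 // addr0 //.
by rewrite -h -!dps_normE act_norm.
Qed.

Section Intertwiners.
Variables V W : unitary_rep C n.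
Variables (T : 'cV[C]_(rep_dim V) -> H) (U : 'cV[C]_(rep_dim W) -> H).
Hypotheses (hT : intertwiner act T) (hU : intertwiner act U).

(** The matrix of T followed by the adjoint of U. *)
Definition cross_mx : 'M[C]_(rep_dim W, rep_dim V) :=
  \matrix_(i, j) ip (T (delta_mx j 0)) (U (delta_mx i 0)).

Lemma linear_col d (S : 'cV[C]_d -> H) v : linear S -> S v = \sum_j v j 0 *: S (delta_mx j 0).
Proof.
move=> lS; pose SL : {linear _ -> _} := HB.pack S (GRing.isLinear.Build _ _ _ _ S lS).
rewrite -[S v]/(SL v) {1}[v]matrix_sum_delta linear_sum; apply: eq_bigr => j _.
by rewrite big_ord1 linearZ.
Qed.

Lemma cross_mxE v w : ip (T v) (U w) = \sum_i (cross_mx *m v) i 0 * (w i 0)^*.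
Proof.
rewrite (linear_col v hT.1) (linear_col w hU.1) ip_sumr; apply: eq_bigr => i _.
rewrite ipZr mulrC; congr (_ * _); rewrite ip_suml mxE; apply: eq_bigr => j _.
by rewrite ipZl mxE mulrC.
Qed.

Lemma cross_mx_hom : rep_hom cross_mx.
Proof.
move=> g gK; have [_ _ gU _] := rep_mxP W; have {}gU := gU g gK.
suff e : (rep_mx W g)^t* *m (cross_mx *m rep_mx V g) = cross_mx.
  rewrite -{2}e mulmxA; have /unitarymxP -> := gU; by rewrite mul1mx.
apply/matrixP => i j; rewrite [RHS]mxE -(act_ip _ _ gK).
rewrite -(hT.2 g gK) -(hU.2 g gK) cross_mxE mxE; apply: eq_bigr => l _.
rewrite mulmxA -colE [in RHS]mxE -colE ![col _ _ _ _]mxE ![_^t* _ _]mxE mulrC; congr (_ * _).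
by rewrite mxE.
Qed.

End Intertwiners.

End Assembly.

(** * Hilbert sum and multiplicity one *)

Section Decomposition.
Variables (R : realType) (n' : nat) (mu : R[i]) (delta : int).
Local Notation C := R[i].
Local Notation n := n'.+1.
Local Notation N := (n + n)%N.
Local Notation E := 'M[C]_(N, 2).
Variable P : @degenerate_principal_series R n mu delta.
Local Notation H := (dps_space P).
Local Notation ip := (dps_ip P).
Local Notation act := (@dps_act _ _ _ _ P).
Local Notation index := {p : nat * nat | ktype_index n delta p}.
Implicit Types (F G : E -> C) (x y : H).

(** With l' = k, the bound and the parity condition say that l - l' = i + j and delta = i - j are
    solvable in natural numbers. *)
Lemma ktype_indexP p : reflect
  (exists i j k, [/\ p = (i + j + k, k)%N, i%:Z - j%:Z = delta &
     if (1 < n)%N then true else k == 0%N]) (ktype_index n delta p).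
Proof.
have n1 (k : nat) : ((n == 1)%N ==> (k == 0)%N) = (if (1 < n)%N then true else k == 0%N).
  by case: n' => [|m] //=; rewrite implyTb.
apply: (iffP idP) => [|[i [j [k [-> ij kn]]]]].
  case: p => l l' /and3P[/andP[/= ll' kn] dl /eqP/eqP par].
  (* Here l - l' - delta = 2q; then j = q and i = q + delta are nonnegative by the bound on
     |delta|. *)
  move: par; rewrite eqz_mod_dvd => /dvdzP [q qE].
  have [j jE] : exists j : nat, q = j%:Z by exists `|q|%N; lia.
  have [i iE] : exists i : nat, (q + delta)%R = i%:Z by exists (absz (q + delta)%R); lia.
  exists i, j, l'; split; [congr (_, _); lia|lia|].
  by rewrite -n1.
apply/and3P; split; rewrite /= ?addnK.
- by rewrite /two_row /= leq_addl n1.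
- lia.
- by rewrite eqz_mod_dvd; apply/dvdzP; exists j%:Z; lia.
Qed.

Lemma ktypes_exist : exists VT : index -> {V : unitary_rep C n & 'cV[C]_(rep_dim V) -> H},
  forall p, let V := projT1 (VT p) in let T := projT2 (VT p) in
  [/\ irreducible_rep V, highest_weight V (two_row_weight (val p)),
      intertwiner act T, forall v w, ip (T v) (T w) = \sum_k v k 0 * (w k 0)^* &
      (forall v, kpoly (P := P) (T v)) /\
      forall i j k, val p = (i + j + k, k)%N -> i%:Z - j%:Z = delta ->
        exists v, T v = iota P (i + k) (j + k) (hwv i j k 0)].
Proof.
suff h : forall p : index, exists x : {V : unitary_rep C n & 'cV[C]_(rep_dim V) -> H},
  [/\ irreducible_rep (projT1 x),
      highest_weight (projT1 x) (two_row_weight (val p)),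
      intertwiner act (projT2 x),
      forall v w, ip (projT2 x v) (projT2 x w) = \sum_k v k 0 * (w k 0)^* &
      (forall v, kpoly (P := P) (projT2 x v)) /\
      forall i j k, val p = (i + j + k, k)%N -> i%:Z - j%:Z = delta ->
        exists v, projT2 x v = iota P (i + k) (j + k) (hwv i j k 0)] by have [f fE] := choice h; exists f.
move=> -[p pI] /=; have /ktype_indexP [i [j [k [-> ij kn]]]] := pI.
have [V [T [iV hV hT isoT [rT uT]]]] := ktype_exists P ij kn.
exists (existT _ V T); split=> //=; split=> [v|i1 j1 k1 [e1 e2] ij1].
  by have [F hF ->] := rT v; exists (i + k)%N, (j + k)%N, F; split=> //; lia.
have -> : i1 = i by lia.
have -> : j1 = j by lia.
by rewrite -e2.
Qed.

Lemma two_row_weight_inj (p q : nat * nat) : two_row n p -> two_row n q ->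
  two_row_weight (n := n) p =1 two_row_weight q -> p = q.
Proof.
case: p q => [l l'] [m m'] /andP[_ /= pn] /andP[_ /= qn] e.
have := e ord0; rewrite /two_row_weight /= => -[->].
case: n' pn qn e => [|n1] /= pn qn e; first by rewrite (eqP pn) (eqP qn).
by have := e (lift ord0 ord0); rewrite /two_row_weight /= => -[->].
Qed.

Variable VT : index -> {V : unitary_rep C n & 'cV[C]_(rep_dim V) -> H}.
Local Notation V p := (projT1 (VT p)).
Local Notation T p := (projT2 (VT p)).
Hypothesis VTP : forall p,
  [/\ irreducible_rep (V p), highest_weight (V p) (two_row_weight (val p)),
      intertwiner act (T p), forall v w, ip (T p v) (T p w) = \sum_k v k 0 * (w k 0)^* &
      (forall v, kpoly (P := P) (T p v)) /\
      forall i j k, val p = (i + j + k, k)%N -> i%:Z - j%:Z = delta ->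
        exists v, T p v = iota P (i + k) (j + k) (hwv i j k 0)].

Lemma T_intertwiner p : intertwiner act (T p). Proof. by have [] := VTP p. Qed.

Lemma T0 p : T p 0 = 0.
Proof.
have := (T_intertwiner p).1 (-1) 0 0; rewrite scaler0 addr0 => e.
by rewrite e scaleN1r addNr.
Qed.

Lemma cross_eq0 (W : unitary_rep C n) (U : 'cV[C]_(rep_dim W) -> H) p q :
  two_row n p -> irreducible_rep W -> highest_weight W (two_row_weight p) ->
  intertwiner act U -> p != val q -> cross_mx U (T q) = 0.
Proof.
move=> pn iW hW hU pq; apply/eqP; apply: contraNT pq => A0.
have [iV hV hT _ _] := VTP q.
apply/eqP/two_row_weight_inj => //; first by have /and3P[] := valP q.
exact: (schur_highest iW iV (cross_mx_hom hU hT) A0 hW hV).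
Qed.

Lemma T_orth p q v w : p != q -> ip (T p v) (T q w) = 0.
Proof.
move=> pq; have [iV hV hT _ _] := VTP p.
rewrite (cross_mxE hT (T_intertwiner q)) (cross_eq0 _ iV hV hT) ?mul0mx.
- by apply: big1 => i _; rewrite mxE mul0r.
- by have /and3P[] := valP p.
- by rewrite (inj_eq val_inj).
Qed.

Definition spanT : set H := [set x | exists (s : seq index)
  (v : forall p, 'cV[C]_(rep_dim (V p))), uniq s /\ x = \sum_(p <- s) T p (v p)].

Lemma spanT_extend (s s1 : seq index) (v : forall p, 'cV[C]_(rep_dim (V p))) :
  uniq s -> uniq s1 -> {subset s1 <= s} ->
  \sum_(p <- s1) T p (v p) = \sum_(p <- s) T p (if p \in s1 then v p else 0).
Proof.
move=> us us1 sub; rewrite [RHS](bigID (mem s1)) /= [X in _ = _ + X]big1 => [|p /negbTE ->]; last exact: T0.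
rewrite addr0 [RHS](eq_bigr (fun p => T p (v p))) => [|p ->] //.
rewrite -[RHS]big_filter; apply: perm_big; apply: uniq_perm => //; first exact: filter_uniq.
by move=> p; rewrite mem_filter /=; case ps1: (p \in s1) => //=; rewrite sub.
Qed.

Lemma spanT_lin c x y : spanT x -> spanT y -> spanT (c *: x + y).
Proof.
move=> [s1 [v1 [u1 ->]]] [s2 [v2 [u2 ->]]].
pose s := undup (s1 ++ s2); have us : uniq s by exact: undup_uniq.
have sub1 : {subset s1 <= s} by move=> p ps; rewrite mem_undup mem_cat ps.
have sub2 : {subset s2 <= s} by move=> p ps; rewrite mem_undup mem_cat ps orbT.
exists s, (fun p => c *: (if p \in s1 then v1 p else 0) + (if p \in s2 then v2 p else 0)).
split=> //; rewrite (spanT_extend v1 us u1 sub1) (spanT_extend v2 us u2 sub2).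
rewrite scaler_sumr -big_split; apply: eq_bigr => p _ /=.
by rewrite (T_intertwiner p).1.
Qed.

Lemma spanT0 : spanT 0.
Proof. by exists [::], (fun=> 0); rewrite big_nil. Qed.

Lemma spanT_act g x : SpK g -> spanT x -> spanT (act g x).
Proof.
move=> gK [s [v [us ->]]]; exists s, (fun p => rep_mx (V p) g *m v p); split=> //.
by rewrite act_sum //; apply: eq_bigr => p _; rewrite (T_intertwiner p).2.
Qed.

Lemma spanT_hwv i j k s : i%:Z - j%:Z = delta -> (if (1 < n)%N then true else k == 0%N) ->
  spanT (iota P (i + k + s) (j + k + s) (hwv i j k s)).
Proof.
move=> ij kn; have pI : ktype_index n delta (i + j + k, k)%N.
  by apply/ktype_indexP; exists i, j, k.
pose q0 : index := exist _ (i + j + k, k)%N pI.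
have [_ _ _ _ [_ hT]] := VTP q0.
have [v vE] := hT i j k erefl ij.
have -> : hwv i j k s = fun Z : E => om Z ^+ s * hwv i j k 0 Z.
  by apply/funext => Z; rewrite /hwv expr0 mulr1 mulrC.
rewrite iota_om; [|lia|exact: hwv_bihom0]; rewrite -vE.
(* The vector v is transported to the fibre over an index equal to q0; other fibres receive 0. *)
pose w p' : 'cV[C]_(rep_dim (V p')) := if eqVneq p' q0 is EqNotNeq e then
  eq_rect_r (fun p => 'cV[C]_(rep_dim (V p))) v e else 0.
exists [:: q0], w; rewrite big_seq1; split=> //; rewrite /w.
by case: eqVneq => [e|/eqP //]; rewrite (eq_axiomK e).
Qed.

(** A polynomial outside the span would leave a highest weight vector in the orthogonal complement.
    By the classification it is a multiple of some [hwv i j k s], whose image lies in the span since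
    omega^s does not change the vector; it is thus orthogonal to itself. *)
Lemma kpoly_spanT x : kpoly (P := P) x -> spanT x.
Proof.
move=> [a [b [F [ab hF ->]]]].
pose B : set (E -> C) := bihom a b.
have sB : subsp B by split=> [|c G1 G2]; [exact: bihom0|exact: bihomP].
have kB : kstab B by move=> g G _; exact: bihom_mulmx.
pose S : set (E -> C) := [set G | B G /\ spanT (iota P a b G)].
have sS : subsp S.
  split=> [|c G1 G2 [B1 S1] [B2 S2]]; split; try exact: bihom0; try exact: bihomP.
    by rewrite iota0 //; exact: spanT0.
  by rewrite (iota_lin P ab c B1 B2); exact: spanT_lin.
have kS : kstab S.
  move=> g G gK [BG SG]; split; first exact: kB.
  have := spanT_act (SpK_invmx' gK) SG; rewrite (iota_act P ab (SpK_invmx' gK) BG) //.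
  by rewrite invmxK.
have SB : S `<=` B by move=> G [].
have [F1 [F2 [SF1 oF2 FE]]] := orth_decomp P ab (fun G hG => hG) sB SB sS hF.
suff F20 : forall Z, F2 Z = 0.
  suff -> : F = F1 by case: SF1.
  by apply/funext => Z; rewrite FE F20 mul1r addr0.
move=> Z; apply/eqP/negPn/negP => F2Z.
pose O := orth P a b B S.
have sO : subsp O := orth_subsp P ab S (fun G hG => hG) sB.
have kO : kstab O := orth_kstab ab (fun G hG => hG) SB kB kS.
have hO G : O G -> hom (a + b) G by move=> [[]].
have [la [G lG]] := lexmax_exists sO kO hO (ex_intro _ F2 (conj oF2 (ex_intro _ Z F2Z))).
have hG := lexmax_hw sO kO hO lG; have [OG [Z0 GZ0] wG _] := lG.
have [[homG bG] oG] := OG.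
have [i [j [k [s [ea eb l0 l1 l2]]]]] := hw_weights homG hG bG wG (ex_intro _ Z0 GZ0).
have kn : if (1 < n)%N then true else k == 0%N by move: l1; case: ifP => // _ ->.
have ij : i%:Z - j%:Z = delta by lia.
have Su : S (hwv i j k s).
  by split; [rewrite /B ea eb; exact: hwv_bihom|rewrite ea eb; exact: spanT_hwv].
have GE : G = fun Z => G (sl n' 1 1 1 1) * hwv i j k s Z.
  apply/funext => Y.
  apply: (hw_unique (d := a + b) (a := a) (b := b) (la := la)) => //.
  - by have [[]] := Su.
  - exact: hwv_hw.
  - by have [[]] := Su.
  - move=> m; have := @hwv_wt C n' i j k s m; set x' := (X in wt _ _ X) => h.
    rewrite (_ : la m = x') // /x'; case: (val m =P 0%N) => [m0|m0].
      rewrite m0 l0; lia.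
    case: (val m =P 1%N) => [m1|m1].
      have n1 : (1 < n)%N by rewrite -m1; exact: ltn_ord.
      move: l1; rewrite n1 m1 => ->; lia.
    have m2 : (1 < m)%N by move: m0 m1 => /=; case: (nat_of_ord m) => [|[|]].
    by rewrite (l2 m m2); lia.
  - exact: hwv_sl.
have SG : S G by rewrite GE; exact: subspZ.
have /eqP := oG G SG; rewrite (dnorm_eq0 ip) => /eqP G0.
by move: GZ0; rewrite (iota_eq0 ab (conj homG bG) G0) eqxx.
Qed.

Lemma spanT_dense : dense [set x : H | exists (s : seq index)
    (v : forall p, 'cV[C]_(rep_dim (V p))), x = \sum_(p <- s) T p (v p)].
Proof.
move=> O [x Ox] oO; have : nbhs x O by exact: open_nbhs_nbhs.
move=> /nbhs_ballP [r /= r0 Hr]; have [y py xy] := kpoly_dense x r0.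
exists y; split; first by apply: Hr; rewrite -ball_normE.
by have [s [v [_ ->]]] := kpoly_spanT py; exists s, v.
Qed.

Lemma hilbert_sum : hilbert_sum_of ip act (fun p => V p).
Proof.
exists (fun p => T p); split.
- exact: T_intertwiner.
- by move=> p; have [] := VTP p.
- by move=> p q v w; exact: T_orth.
- exact: spanT_dense.
Qed.

(** Were U v nonzero, some y in the dense span would satisfy |U v - y| < |U v|, whereas
    orthogonality gives |U v - y|^2 = |U v|^2 + |y|^2. *)
Lemma cross_all_eq0 (W : unitary_rep C n) (U : 'cV[C]_(rep_dim W) -> H) :
  intertwiner act U -> (forall q, cross_mx U (T q) = 0) -> forall v, U v = 0.
Proof.
move=> hU A0 v; apply/eqP; rewrite -(dnorm_eq0 ip); apply/negPn/negP => n0.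
have u0 : 0 < `|U v| by rewrite normr_gt0 -(dnorm_eq0 ip).
have [y py] := kpoly_dense (U v) u0.
have [s [w [_ yE]]] := kpoly_spanT py.
have uy : ip (U v) y = 0.
  rewrite yE ip_sumr big1 // => p _; rewrite (cross_mxE hU (T_intertwiner p)) A0 mul0mx.
  by apply: big1 => i _; rewrite mxE mul0r.
rewrite -(@ltr_pXn2r _ 2) ?nnegrE ?normr_ge0 // !dps_normE ipBl !ipBr uy.
rewrite [ip y (U v)]ipC uy conjC0 subr0 sub0r opprK.
by rewrite gtrDl => /lt_geF; rewrite dnorm_ge0.
Qed.

(** Against the summand of the same highest weight the cross matrices of T1 and T2 are proportional
    by Schur, against all others they vanish; so some combination is orthogonal to every summand. If
    p is not an index, T1 itself is. *)
Lemma at_most_once p (W : unitary_rep C n) : two_row n p -> irreducible_rep W ->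
  highest_weight W (two_row_weight p) -> occurs_at_most_once act W.
Proof.
move=> pn iW hW T1 T2 h1 h2.
have [pI|pI] := boolP (ktype_index n delta p); last first.
  exists 1, 0; split=> [|v]; first by rewrite xpair_eqE oner_eq0.
  rewrite scale0r addr0 scale1r (cross_all_eq0 h1) // => q.
  by apply: (cross_eq0 pn iW hW h1); apply: contraNneq pI => ->; exact: valP.
pose q0 : index := exist _ p pI.
have off q : q != q0 -> p != val q.
  by apply: contra => /eqP pq; apply/eqP/val_inj.
have [iV hV hT _ _] := VTP q0.
have [A20|A20] := eqVneq (cross_mx T2 (T q0)) 0.
  exists 0, 1; split=> [|v]; first by rewrite xpair_eqE oner_eq0 andbF.
  rewrite scale0r add0r scale1r (cross_all_eq0 h2) // => q.
  have [->//|qq0] := eqVneq q q0.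
  exact: (cross_eq0 pn iW hW h2 (off q qq0)).
have [c cE] := schur_scalar iW iV (cross_mx_hom h1 hT) (cross_mx_hom h2 hT) A20.
exists 1, (- c); split=> [|v]; first by rewrite xpair_eqE oner_eq0.
pose U v := 1 *: T1 v + - c *: T2 v.
have hU : intertwiner act U.
  split=> [d x y|g gK x]; rewrite /U.
    rewrite h1.1 h2.1 !scalerDr !scalerA addrACA !mul1r mulr1; congr (_ + _ + _).
    by rewrite mulrC.
  by rewrite h1.2 // h2.2 // act_lin // -[- c *: T2 x]addr0 act_lin // act0 // addr0.
rewrite -/(U v) (cross_all_eq0 hU) // => q.
have UE : cross_mx U (T q) = cross_mx T1 (T q) - c *: cross_mx T2 (T q).
  by apply/matrixP => i j; rewrite !mxE /U ipDl !ipZl mul1r mulNr.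
rewrite UE; have [->|qq0] := eqVneq q q0; first by rewrite cE subrr.
by rewrite (cross_eq0 pn iW hW h1 (off q qq0)) (cross_eq0 pn iW hW h2 (off q qq0)) scaler0 subrr.
Qed.

End Decomposition.

Theorem proposition2 (R : realType) (n : nat) (mu : R[i]) (delta : int)
    (P : degenerate_principal_series n mu delta) :
  (0 < n)%N -> complex.Re mu = 0 ->
  (exists V : {p : nat * nat | ktype_index n delta p} -> unitary_rep R[i] n,
     (forall p, irreducible_rep (V p) /\
                highest_weight (V p) (two_row_weight (val p))) /\
     hilbert_sum_of (dps_ip P) (@dps_act _ _ _ _ P) V) /\
  (forall (p : nat * nat) (V : unitary_rep R[i] n),
     two_row n p -> irreducible_rep V ->
     highest_weight V (two_row_weight p) ->
     occurs_at_most_once (@dps_act _ _ _ _ P) V).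
Proof.
case: n P => [//|n'] P _ _.
have [VT VTP] := ktypes_exist P; split; last first.
  by move=> p W pn iW hW; exact: (at_most_once VTP pn iW hW).
exists (fun p => projT1 (VT p)); split=> [p|]; last exact: (hilbert_sum VTP).
by have [] := VTP p.
Qed.
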